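(* There exists a Synchronous Strict PIP algorithm to construct the 2D convex hull of $n$ presorted points.
   Context: PRAM model: synchronous processors with a shared memory, each processor also having its own private memory, measured in words. The algorithm is for the CREW PRAM (concurrent reads of a shared location allowed, concurrent writes not allowed). Span is the maximum number of operations performed by a single processor. Synchronous Strict PIP (parallel in-place): let $1\le p\le n$ be the number of processors available, where $n$ is the input size. A PRAM algorithm is Synchronous Strict PIP if it (1) allocates no shared memory aside from the input, (2) uses $\Theta(1)$ private memory per processor, (3) has $O((n/p)\,\mathrm{polylog}(n))$ span, and (4) uses at most $\Theta(1)$ additional space, i.e. is strictly in-place, when run sequentially. The input is an array of $n$ points in the plane in shared memory (each point occupying $O(1)$ words, with geometric primitives such as orientation tests and slope comparisons taking constant time), sorted by $x$-coordinate. The points are in general position and no two share the same $x$-coordinate. Constructing the convex hull means computing the upper hull (the lower hull being computed symmetrically): the array is permuted so that, where $h$ is the number of upper-hull points, its first $h$ entries are the upper-hull points in order of $x$-coordinate, the remaining points being in arbitrary order, and $h$ is known to a processor. *)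

(* Defs.v *)
From mathcomp Require Import all_boot all_order all_algebra perm.
From mathcomp Require Import reals.

Set Implicit Arguments.
Unset Strict Implicit.
Unset Printing Implicit Defensive.

Import Order.TTheory GRing.Theory Num.Theory.

(** * Plane geometry *)

Section Geometry.
Local Open Scope ring_scope.
Variable R : realType.

Definition point : Type := (R * R)%type.

(* Twice the signed area of the triangle [a b c]. *)
Definition orient (a b c : point) : R :=
  (b.1 - a.1) * (c.2 - a.2) - (b.2 - a.2) * (c.1 - a.1).

Definition slope (a b : point) : R := (b.2 - a.2) / (b.1 - a.1).

Section PointSet.
Variables (n : nat) (P : 'I_n -> point).

Definition in_hull (q : point) : Prop :=
  exists w : 'I_n -> R,
    [/\ forall i, 0 <= w i,
        \sum_(i < n) w i = 1,
        q.1 = \sum_(i < n) w i * (P i).1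
      & q.2 = \sum_(i < n) w i * (P i).2].

(* Extreme points of the convex hull. *)
Definition hull_vertex (q : point) : Prop :=
  in_hull q /\
  forall (a b : point) (t : R), in_hull a -> in_hull b -> 0 < t < 1 ->
    q.1 = (1 - t) * a.1 + t * b.1 -> q.2 = (1 - t) * a.2 + t * b.2 -> a = b.

(* The upper boundary of the convex hull. *)
Definition on_upper_boundary (q : point) : Prop :=
  in_hull q /\ forall r : point, in_hull r -> r.1 = q.1 -> r.2 <= q.2.

Definition upper_hull_point (q : point) : Prop :=
  hull_vertex q /\ on_upper_boundary q.

Definition x_sorted : Prop := forall i j : 'I_n, (i < j)%N -> (P i).1 < (P j).1.

Definition general_position : Prop :=
  forall i j k : 'I_n, i != j -> j != k -> i != k ->
    orient (P i) (P j) (P k) != 0.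

(* Strictness in [x_sorted] excludes equal x-coordinates. *)
Definition presorted : Prop := x_sorted /\ general_position.

End PointSet.
End Geometry.

(** * The CREW PRAM

    A memory cell holds O(1) machine words: either one integer word of
    O(log n) bits or one point.  Points are atomic: coordinates are accessible
    only through the geometric tests, so that no information can be packed
    into real numbers. *)

Inductive value (R : realType) :=
| Word of nat
| Pt of point R.
Arguments Word {R} _.

Inductive binop := OpAdd | OpSub | OpMul | OpDiv | OpMod | OpLeq | OpEq.

Definition eval_binop (o : binop) (x y : nat) : nat :=
  match o with
  | OpAdd => x + y
  | OpSub => x - y
  | OpMul => x * y
  | OpDiv => x %/ y
  | OpMod => x %% y
  | OpLeq => x <= y
  | OpEq => x == y
  end.

(* [d], [s], [a], [b], [c], [e] are addresses of private cells, [d] being the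
   destination; [m] is a private cell holding an address. *)
Inductive instr :=
| Const (d v : nat)
| Move (d s : nat)
| Op (o : binop) (d a b : nat)
| LoadPrivate (d m : nat)
| StorePrivate (m s : nat)
| Read (d m : nat)
| Write (m s : nat)
| LessX (d a b : nat)
| LeftTurn (d a b c : nat)
| LessSlope (d a b c e : nat)
| Jump (l : nat)
| JumpZero (a l : nat).

(* One program serves all input sizes and all numbers of processors; all
   processors run it.  An algorithm declares the private cells per processor
   and the shared cells besides the input, as functions of the input size [n]
   and the number of processors [p].  Integers have [word_factor * bits n]
   bits, with [bits] below. *)
Record algorithm := Algorithm {
  program : seq instr;
  private_size : nat -> nat -> nat;
  extra_shared : nat -> nat -> nat;
  word_factor : nat
}.

(* Number of binary digits of [n], for [n > 0]; it is Theta(log n). *)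
Definition bits (n : nat) : nat := (trunc_log 2 n).+1.

Local Notation "'let?' x ':=' e 'in' f" := (if e is Some x then f else None)
  (at level 200, x name, e at level 200, f at level 200).

Definition update (T : Type) (f : nat -> T) (w : option (nat * T)) : nat -> T :=
  if w is Some (a, v) then fun b => if b == a then v else f b else f.

Section Machine.
Variables (R : realType) (A : algorithm) (n p : nat) (P : 'I_n -> point R).

Local Notation value := (value R).

(* Cells outside the declared sizes are never accessible, see [execute]. *)
Record config := Config {
  shared : nat -> value;
  counter : 'I_p -> nat;
  private : 'I_p -> nat -> value
}.

Record action := Action {
  goto : nat;
  private_write : option (nat * value);
  shared_write : option (nat * value)
}.

Definition init : config := {|
  shared := fun a => if insub a is Some i then Pt (P i) else Word 0;
  counter := fun _ => 0;
  private := fun i a =>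
    match a with 0 => Word n | 1 => Word p | 2 => Word i | _ => Word 0 end
|}.

(* [None] is a fault: an access out of the declared memory, an ill-typed
   operand, an integer overflow, or the slope of a vertical segment. *)
Definition execute (sh : nat -> value) (pc : nat) (pr : nat -> value)
    (ins : instr) : option action :=
  let K := private_size A n p in
  let S := n + extra_shared A n p in
  let get a := if a < K then Some (pr a) else None in
  let word a := if get a is Some (Word w) then Some w else None in
  let pt a := if get a is Some (Pt q) then Some q else None in
  let put d v :=
    if d < K then Some (Action pc.+1 (Some (d, v)) None) else None in
  let put_word d w :=
    if w < 2 ^ (word_factor A * bits n) then put d (Word w) else None in
  match ins with
  | Const d v => put_word d v
  | Move d s => let? v := get s in put d v
  | Op o d a b =>
      let? x := word a in let? y := word b in put_word d (eval_binop o x y)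
  | LoadPrivate d m => let? a := word m in let? v := get a in put d v
  | StorePrivate m s => let? a := word m in let? v := get s in put a v
  | Read d m => let? a := word m in if a < S then put d (sh a) else None
  | Write m s =>
      let? a := word m in let? v := get s in
      if a < S then Some (Action pc.+1 None (Some (a, v))) else None
  | LessX d a b =>
      let? x := pt a in let? y := pt b in put_word d (x.1 < y.1)%R
  | LeftTurn d a b c =>
      let? x := pt a in let? y := pt b in let? z := pt c in
      put_word d (0 < orient x y z)%R
  | LessSlope d a b c e =>
      let? x := pt a in let? y := pt b in let? z := pt c in let? t := pt e in
      if (x.1 == y.1) || (z.1 == t.1) then None
      else put_word d (slope x y < slope z t)%R
  | Jump l => Some (Action l None None)
  | JumpZero a l =>
      let? x := word a in Some (Action (if x == 0 then l else pc.+1) None None)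
  end.

(* A processor halts by leaving the program. *)
Definition active (c : config) (i : 'I_p) : bool :=
  counter c i < size (program A).

Definition proc_action (c : config) (i : 'I_p) : option action :=
  if onth (program A) (counter c i) is Some ins
  then execute (shared c) (counter c i) (private c i) ins
  else Some (Action (counter c i) None None).

Definition write_target (c : config) (i : 'I_p) : option nat :=
  if proc_action c i is Some (Action _ _ (Some (a, _))) then Some a else None.

Definition exclusive_write (c : config) : bool :=
  [forall i, forall j, (i != j) ==> (write_target c i != None) ==>
     (write_target c i != write_target c j)].

(* All processors execute one instruction simultaneously, reading the memory as
   it was before the step. *)
Definition step (c : config) : option config :=
  if [forall i, isSome (proc_action c i)] && exclusive_write c then
    let acts i := odflt (Action 0 None None) (proc_action c i) in
    Some {|
      shared :=
        foldl (fun f i => update f (shared_write (acts i))) (shared c)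
          (enum 'I_p);
      counter := fun i => goto (acts i);
      private := fun i => update (private c i) (private_write (acts i))
    |}
  else None.

Definition run (t : nat) : option config := iter t (obind step) (Some init).

Definition halts_at (t : nat) (c : config) : Prop :=
  run t = Some c /\ forall i, ~~ active c i.

(* Number of operations performed by processor [i] during the first [t]
   steps; halted processors perform none. *)
Definition operations (t : nat) (i : 'I_p) : nat :=
  \sum_(0 <= s < t) (if run s is Some c then active c i : nat else 0).

(* The span of an execution that has halted by time [t]. *)
Definition span (t : nat) : nat := \max_(i < p) operations t i.

(* The value in cell 0 of processor 0 is the returned count [h]. *)
Definition upper_hull_output (c : config) : Prop :=
  exists (s : {perm 'I_n}) (h : nat),
    [/\ h <= n,
        forall i : 'I_n, shared c i = Pt (P (s i)),
        forall i : 'I_n, i < h <-> upper_hull_point P (P (s i)),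
        forall i j : 'I_n, i < j -> j < h -> ((P (s i)).1 < (P (s j)).1)%R
      & forall i : 'I_p, i = 0 :> nat -> private c i 0 = Word h].

End Machine.

Definition input_class (R : realType) := forall n : nat, ('I_n -> point R) -> Prop.

Definition presorted_points (R : realType) : input_class R := @presorted R.

Definition constructs_convex_hull (R : realType) (A : algorithm)
    (valid : input_class R) : Prop :=
  forall (n p : nat) (P : 'I_n -> point R), 0 < p <= n -> valid n P ->
    exists (t : nat) (c : config R p),
      halts_at A P t c /\ upper_hull_output P c.

(** * Synchronous Strict PIP algorithms *)

Definition no_extra_shared_memory (A : algorithm) : Prop :=
  forall n p : nat, 0 < p <= n -> extra_shared A n p = 0.

Definition constant_private_memory (A : algorithm) : Prop :=
  exists C : nat, forall n p : nat, 0 < p <= n -> 0 < private_size A n p <= C.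

(* [span <= C * (n / p) * (bits n)^k], multiplied by [p]. *)
Definition pip_span (R : realType) (A : algorithm) (valid : input_class R) : Prop :=
  exists C k : nat, forall (n p : nat) (P : 'I_n -> point R),
    0 < p <= n -> valid n P ->
    exists (t : nat) (c : config R p),
      halts_at A P t c /\ span A p P t * p <= C * n * bits n ^ k.

(* Sequential execution is execution by a single processor. *)
Definition sequentially_in_place (A : algorithm) : Prop :=
  exists C : nat, forall n : nat, 0 < n ->
    extra_shared A n 1 + private_size A n 1 <= C.

Definition sync_strict_PIP (R : realType) (A : algorithm)
    (valid : input_class R) : Prop :=
  [/\ no_extra_shared_memory A,
      constant_private_memory A,
      pip_span A valid
    & sequentially_in_place A].

(* Main.v *)
Require Import Defs.
From mathcomp Require Import all_boot all_algebra reals.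
From mathcomp Require Import all_order perm zify ring lra.

(* Processor [i] owns the points of ranks [i * n %/ p, ..., (i + 1) * n %/ p - 1]
   and first computes their hull by a Graham scan that keeps the stack at the
   beginning of the block; 2 (n / p + 1) scan steps always suffice, since each
   of them increases twice the number of points read minus the stack size.
   Then groups of 1, 2, 4, ... processors are merged pairwise.  To learn the two
   hull sizes, each processor posts the size of its group in its own first cell,
   keeping the point of this cell in private memory for the time of the exchange.
   All processors of the pair find the common tangent by themselves: a vertex [u]
   of the left hull survives iff the right hull lies below the line through [u]
   and its predecessor, which is tested at the right vertex extremal in the
   direction of this line, found by binary search on the slopes; survivors form
   a prefix, so a second binary search finds the last one, and a third one finds
   the tangent from it to the right hull.  The surviving right vertices are moved
   next to the left ones by two reversals, which are products of disjoint
   transpositions and hence parallelize.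

   All processors run in lockstep: loops have the same number of iterations for
   all of them, and a skipped conditional is padded with idle steps.  During each
   phase a processor writes only to cells that no other processor accesses, so a
   phase is verified as a sequential program for one processor. *)

Set Implicit Arguments.
Unset Strict Implicit.
Unset Printing Implicit Defensive.

(** * A structured language for the machine *)

(** Without scratch space a hull can only be kept as a sorted prefix of its block, with the
    discarded points somewhere behind it, so merging has to permute the array. Reversing the cells
    from just behind the last surviving left vertex up to the end of the right hull brings the
    surviving right vertices to the front in reverse order. Reversing these alone restores their
    order. The third reversal of a full rotation is omitted because discarded points may stand in
    any order.

    Concurrent reads let every processor repeat the tangent search of its pair. The nested binary
    searches cost [O(log^2 n)] and there are about [log p] rounds, whence the exponent 3 in the
    span. The sizes are exchanged in three separate phases, so that no cell is written in the phase
    in which others read it.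

    Geometrically, everything rests on the linear functionals [y - m * x]: a maximizer over a range
    of points is a hull vertex of this range, so comparisons with the hull vertices decide about all
    points. General position makes the resulting inequalities strict. *)

Inductive expr :=
| Var of nat
| Cst of nat
| Bin of binop & expr & expr.

(* [While e k c] carries the exact number [k n p] of its iterations as a ghost
   annotation, so that the running time of a command is a function of [n] and
   [p] only and the processors stay synchronous. *)
Inductive cmd :=
| Assign of nat & expr
| Fetch of nat & expr
| Store of expr & nat
| Turn of nat & nat & nat & nat
| Steeper of nat & nat & nat & nat & nat
| Seq of cmd & cmd
| When of expr & cmd
| While of expr & (nat -> nat -> nat) & cmd.

(* Private cells from [tmp] on hold intermediate results of expressions. *)
Definition tmp := 30.
Definition ncells := 40.

Fixpoint compile_expr (e : expr) (d : nat) : seq instr :=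
  match e with
  | Var x => [:: Move (tmp + d) x]
  | Cst v => [:: Const (tmp + d) v]
  | Bin o e1 e2 => compile_expr e1 d ++ compile_expr e2 d.+1 ++
      [:: Op o (tmp + d) (tmp + d) (tmp + d.+1)]
  end.

Definition esize e := size (compile_expr e 0).

Fixpoint cost (n p : nat) (c : cmd) : nat :=
  match c with
  | Assign _ e | Fetch _ e | Store e _ => (esize e).+1
  | Turn _ _ _ _ | Steeper _ _ _ _ _ => 1
  | Seq c1 c2 => cost n p c1 + cost n p c2
  | When e c => esize e + (cost n p c).+2
  | While e k c => k n p * (esize e + (cost n p c).+2) + (esize e).+1
  end.

(* The body of [When] has no loop, so its cost does not depend on [n], [p];
   processors skipping it idle for the same time. *)
Fixpoint csize (c : cmd) : nat :=
  match c with
  | Assign _ e | Fetch _ e | Store e _ => (esize e).+1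
  | Turn _ _ _ _ | Steeper _ _ _ _ _ => 1
  | Seq c1 c2 => csize c1 + csize c2
  | When e c => esize e + (1 + (csize c + (1 + (cost 0 0 c).+1)))
  | While e k c => esize e + (1 + (csize c + 1))
  end.

(** The padding of [When] is one instruction longer than the body runs, to match the final [Jump] of
    the body. Including [JumpZero], both branches then take [(cost n p c).+2] steps after the test
    expression. *)
Fixpoint compile (c : cmd) (l : nat) : seq instr :=
  match c with
  | Assign x e => compile_expr e 0 ++ [:: Move x tmp]
  | Fetch x e => compile_expr e 0 ++ [:: Read x tmp]
  | Store e x => compile_expr e 0 ++ [:: Write tmp x]
  | Turn d x y z => [:: LeftTurn d x y z]
  | Steeper d x y z t => [:: LessSlope d x y z t]
  | Seq c1 c2 => compile c1 l ++ compile c2 (l + csize c1)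
  | When e c =>
      compile_expr e 0 ++ [:: JumpZero tmp (l + esize e + 1 + csize c + 1)] ++
      compile c (l + esize e + 1) ++ [:: Jump (l + csize (When e c))] ++
      nseq (cost 0 0 c).+1 (Const tmp 0)
  | While e k c =>
      compile_expr e 0 ++ [:: JumpZero tmp (l + csize (While e k c))] ++
      compile c (l + esize e + 1) ++ [:: Jump l]
  end.

Fixpoint wf_expr (e : expr) (d : nat) : bool :=
  match e with
  | Var x => (x < tmp) && (tmp + d < ncells)
  | Cst _ => tmp + d < ncells
  | Bin _ e1 e2 => wf_expr e1 d && wf_expr e2 d.+1
  end.

Fixpoint loop_free (c : cmd) : bool :=
  match c with
  | Seq c1 c2 => loop_free c1 && loop_free c2
  | When _ c => loop_free c
  | While _ _ _ => false
  | _ => true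
  end.

Fixpoint wf (c : cmd) : bool :=
  match c with
  | Assign x e | Fetch x e | Store e x => (x < tmp) && wf_expr e 0
  | Turn d x y z => all (fun v => v < tmp) [:: d; x; y; z]
  | Steeper d x y z t => all (fun v => v < tmp) [:: d; x; y; z; t]
  | Seq c1 c2 => wf c1 && wf c2
  | When e c => [&& wf_expr e 0, wf c & loop_free c]
  | While e _ c => wf_expr e 0 && wf c
  end.

Lemma size_compile c l : size (compile c l) = csize c.
Proof.
elim: c l => //=.
- by move=> x e l; rewrite size_cat addn1.
- by move=> x e l; rewrite size_cat addn1.
- by move=> x e l; rewrite size_cat addn1.
- by move=> c1 IH1 c2 IH2 l; rewrite size_cat IH1 IH2.
- by move=> e c IH l; rewrite size_cat /= size_cat IH /= size_nseq.
- by move=> e k c IH l; rewrite size_cat /= size_cat IH.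
Qed.

Lemma loop_free_cost c n p : loop_free c -> cost n p c = cost 0 0 c.
Proof.
elim: c => //= [c1 IH1 c2 IH2 /andP[h1 h2]|e c IH h]; first by rewrite IH1 ?IH2.
by rewrite IH.
Qed.

Lemma update_out (T : Type) (f : nat -> T) (w : option (nat * T)) a :
  (forall v, w <> Some (a, v)) -> update f w a = f a.
Proof.
case: w => [[b v]|] //= h; case: eqP => // ab; by case: (h v); rewrite ab.
Qed.

(** * Weakest preconditions for a single processor, and their soundness for the compiled code *)

Section Sequential.
Variables (R : realType) (prog : seq instr) (n p : nat).

Definition algorithm_of : algorithm :=
  Algorithm prog (fun _ _ => ncells) (fun _ _ => 0) 8.

Definition max_word := 2 ^ (8 * bits n).

Lemma bool_lt_max_word (b : bool) : b < max_word.
Proof.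
rewrite /max_word; apply: (@leq_trans (2 ^ 1)); first by case: b.
by rewrite leq_exp2l // muln_gt0.
Qed.

Notation value := (value R).
Notation memory := (nat -> value).

Definition is_word (v : value) := if v is Word _ then true else false.
Definition word_of (v : value) := if v is Word w then w else 0.
Definition is_point (v : value) := if v is Pt _ then true else false.
Definition point_of (v : value) : point R := if v is Pt q then q else (0, 0)%R.

Fixpoint eval (pr : memory) (e : expr) : nat :=
  match e with
  | Var x => word_of (pr x)
  | Cst v => v
  | Bin o e1 e2 => eval_binop o (eval pr e1) (eval pr e2)
  end.

Fixpoint safe (pr : memory) (e : expr) : Prop :=
  match e with
  | Var x => is_word (pr x)
  | Cst v => v < max_word
  | Bin o e1 e2 => [/\ safe pr e1, safe pr e2 & eval pr (Bin o e1 e2) < max_word]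
  end.

Notation put pr x v := (update pr (Some (x, v))).

(* [rd] and [wr] are the shared addresses that may be read and written. *)
Section WeakestPrecondition.
Variables rd wr : nat -> Prop.

Section Loop.
Variables (e : expr) (body : (memory -> memory -> Prop) -> memory -> memory -> Prop).
(** The guard has to succeed exactly [k] times and then fail, so a proof of the precondition also
    certifies the annotated running time. *)
Fixpoint wp_loop (k : nat) (Q : memory -> memory -> Prop) (sh pr : memory) : Prop :=
  safe pr e /\
  match k with
  | 0 => eval pr e = 0 /\ Q sh pr
  | k'.+1 => eval pr e <> 0 /\ body (wp_loop k' Q) sh pr
  end.
End Loop.

Fixpoint wp (c : cmd) (Q : memory -> memory -> Prop) (sh pr : memory) : Prop :=
  match c with
  | Assign x e => safe pr e /\ Q sh (put pr x (Word (eval pr e)))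
  | Fetch x e =>
      [/\ safe pr e, eval pr e < n, rd (eval pr e)
        & Q sh (put pr x (sh (eval pr e)))]
  | Store e x =>
      [/\ safe pr e, eval pr e < n, wr (eval pr e)
        & Q (put sh (eval pr e) (pr x)) pr]
  | Turn d x y z =>
      all (fun v => is_point (pr v)) [:: x; y; z] /\
      Q sh (put pr d (Word
        (0 < orient (point_of (pr x)) (point_of (pr y)) (point_of (pr z)))%R))
  | Steeper d x y z t =>
      [/\ all (fun v => is_point (pr v)) [:: x; y; z; t],
          (point_of (pr x)).1 != (point_of (pr y)).1,
          (point_of (pr z)).1 != (point_of (pr t)).1
        & Q sh (put pr d (Word (slope (point_of (pr x)) (point_of (pr y)) <
                                slope (point_of (pr z)) (point_of (pr t)))%R))]
  | Seq c1 c2 => wp c1 (wp c2 Q) sh pr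
  | When e c => safe pr e /\ if eval pr e == 0 then Q sh pr else wp c Q sh pr
  | While e k c => wp_loop e (wp c) (k n p) Q sh pr
  end.

Lemma wp_loop_mono e (body : (memory -> memory -> Prop) -> memory -> memory -> Prop) k
    (Q Q' : memory -> memory -> Prop) sh pr :
  (forall Q Q' sh pr, (forall sh pr, Q sh pr -> Q' sh pr) ->
    body Q sh pr -> body Q' sh pr) ->
  (forall sh pr, Q sh pr -> Q' sh pr) ->
  wp_loop e body k Q sh pr -> wp_loop e body k Q' sh pr.
Proof.
move=> hb hQ; elim: k sh pr => [|k IH] sh pr /= [hs [he h]]; do 2?split=> //.
  exact: hQ.
by apply: hb h.
Qed.

Lemma wp_mono c (Q Q' : memory -> memory -> Prop) sh pr :
  (forall sh pr, Q sh pr -> Q' sh pr) -> wp c Q sh pr -> wp c Q' sh pr.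
Proof.
elim: c Q Q' sh pr => /=.
- by move=> x e Q Q' sh pr hQ [h1 h2]; split=> //; apply: hQ.
- by move=> x e Q Q' sh pr hQ [h1 h2 h3 h4]; split=> //; apply: hQ.
- by move=> x e Q Q' sh pr hQ [h1 h2 h3 h4]; split=> //; apply: hQ.
- by move=> x y z t Q Q' sh pr hQ [h1 h2]; split=> //; apply: hQ.
- by move=> x y z t u Q Q' sh pr hQ [h1 h2 h3 h4]; split=> //; apply: hQ.
- by move=> c1 IH1 c2 IH2 Q Q' sh pr hQ; apply: IH1 => sh' pr'; apply: IH2.
- move=> e c IH Q Q' sh pr hQ [h1]; split=> //; move: b.
  by case: ifP => _; [apply: hQ | apply: IH].
- by move=> e k c IH Q Q' sh pr hQ; apply: wp_loop_mono.
Qed.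

Lemma wp_while (I : nat -> memory -> memory -> Prop) e k c (Q : memory -> memory -> Prop) sh pr :
  I 0 sh pr ->
  (forall j sh pr, j < k n p -> I j sh pr ->
     [/\ safe pr e, eval pr e <> 0 & wp c (I j.+1) sh pr]) ->
  (forall sh pr, I (k n p) sh pr -> [/\ safe pr e, eval pr e = 0 & Q sh pr]) ->
  wp (While e k c) Q sh pr.
Proof.
move=> h0 hS hE /=.
have: forall j sh pr, j <= k n p -> I (k n p - j) sh pr ->
    wp_loop e (wp c) j Q sh pr.
  elim=> [|j IH] sh' pr' hj hI /=.
    by rewrite subn0 in hI; case: (hE _ _ hI).
  have [|h1 h2 h3] := hS _ _ _ _ hI; first lia.
  do 2!split=> //; apply: wp_mono h3 => sh2 pr2 hI2; apply: IH; first lia.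
  by have -> : k n p - j = (k n p - j.+1).+1 by lia.
by apply=> //; rewrite subnn.
Qed.

(* Runs of one processor owning its view [sh] of the shared memory; a step is
   insensitive to the contents of the addresses outside [rd]. *)
Inductive srun : nat -> nat -> memory -> memory -> nat -> memory -> memory -> Prop :=
| srun0 pc sh pr : srun 0 pc sh pr pc sh pr
| srunS t pc sh pr ins act pc' sh' pr' :
    onth prog pc = Some ins ->
    (forall sh2, (forall a, rd a -> sh2 a = sh a) ->
       execute algorithm_of n p sh2 pc pr ins = Some act) ->
    (forall a v, shared_write act = Some (a, v) -> wr a) ->
    srun t (goto act) (update sh (shared_write act))
      (update pr (private_write act)) pc' sh' pr' ->
    srun t.+1 pc sh pr pc' sh' pr'.

Lemma srun_trans t1 t2 pc1 sh1 pr1 pc2 sh2 pr2 pc3 sh3 pr3 :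
  srun t1 pc1 sh1 pr1 pc2 sh2 pr2 -> srun t2 pc2 sh2 pr2 pc3 sh3 pr3 ->
  srun (t1 + t2) pc1 sh1 pr1 pc3 sh3 pr3.
Proof.
elim=> // t pc sh pr ins act pc' sh' pr' h1 h2 h3 _ IH h.
by rewrite addSn; apply: srunS h1 h2 h3 (IH h).
Qed.

Definition code_at (l : nat) (s : seq instr) : Prop :=
  forall k ins, onth s k = Some ins -> onth prog (l + k) = Some ins.

Lemma code_at_cat l s1 s2 :
  code_at l (s1 ++ s2) -> code_at l s1 /\ code_at (l + size s1) s2.
Proof.
move=> h; split=> k ins hk.
  apply: h; rewrite onth_cat; case: ltnP => // /onth_default; by rewrite hk.
by rewrite -addnA; apply: h; rewrite onth_cat ltnNge leq_addr /= addKn.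
Qed.

Lemma code_at1 l ins s : code_at l (ins :: s) ->
  onth prog l = Some ins /\ code_at l.+1 s.
Proof.
move=> h; split; first by rewrite -[l]addn0; apply: h.
by move=> k i hk; rewrite addSnnS; apply: h.
Qed.

Definition agree (d : nat) (pr1 pr2 : memory) := forall y, y < d -> pr1 y = pr2 y.

Lemma srun1 pc sh pr ins act :
  onth prog pc = Some ins ->
  (forall sh2, (forall a, rd a -> sh2 a = sh a) ->
       execute algorithm_of n p sh2 pc pr ins = Some act) ->
  (forall a v, shared_write act = Some (a, v) -> wr a) ->
  srun 1 pc sh pr (goto act) (update sh (shared_write act))
      (update pr (private_write act)).
Proof. by move=> h1 h2 h3; apply: srunS h1 h2 h3 _; apply: srun0. Qed.

(** Cells from [tmp] on serve as an evaluation stack of which only the part from [tmp + d] on is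
    touched. The value of a left operand therefore survives the evaluation of the right one. *)
Lemma srun_expr e d l sh pr pr1 :
  wf_expr e d -> code_at l (compile_expr e d) -> safe pr e -> agree tmp pr1 pr ->
  exists pr2, [/\ srun (size (compile_expr e d)) l sh pr1
                    (l + size (compile_expr e d)) sh pr2,
                  pr2 (tmp + d) = Word (eval pr e) & agree (tmp + d) pr2 pr1].
Proof.
elim: e d l pr1 => [x|v|o e1 IH1 e2 IH2] d l pr1 /=.
- move=> /andP[hx hd] /code_at1[hc _] hs ha.
  exists (put pr1 (tmp + d) (pr1 x)); split.
  + rewrite addn1.
    apply: (@srun1 l sh pr1 _ (Action l.+1 (Some (tmp + d, pr1 x)) None) hc) => //= sh2 _.
    by rewrite /= hd (ltn_trans hx).
  + rewrite /= eqxx ha //; by case: (pr x) hs.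
  + by move=> y hy; rewrite /= ltn_eqF.
- move=> hd /code_at1[hc _] hs ha.
  exists (put pr1 (tmp + d) (Word v)); split.
  + rewrite addn1.
    apply: (@srun1 l sh pr1 _ (Action l.+1 (Some (tmp + d, Word v)) None) hc) => //= sh2 _.
    by rewrite /= hd -/max_word hs.
  + by rewrite /= eqxx.
  + by move=> y hy; rewrite /= ltn_eqF.
- move=> /andP[hw1 hw2] /code_at_cat[hc1 /code_at_cat[hc2 /code_at1[hc3 _]]].
  case=> hs1 hs2 hb ha.
  have [pr2 [hr1 hv1 ha1]] := IH1 _ _ _ hw1 hc1 hs1 ha.
  have ha' : agree tmp pr2 pr.
    by move=> y hy; rewrite ha1 ?ha // (leq_trans hy) // leq_addr.
  have [pr3 [hr2 hv2 ha2]] := IH2 _ _ _ hw2 hc2 hs2 ha'.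
  exists (put pr3 (tmp + d) (Word (eval_binop o (eval pr e1) (eval pr e2)))); split.
  + rewrite !size_cat /=; apply: srun_trans hr1 _; rewrite addnA.
    apply: srun_trans hr2 _; rewrite addnA addn1.
    have hd2 : tmp + d.+1 < ncells.
      clear -hw2; elim: e2 d.+1 hw2 => //=.
        by move=> x d' /andP[].
      by move=> o e1 IH1 e2 IH2 d' /andP[/IH1].
    apply: (@srun1 _ sh pr3 _ (Action _ (Some (tmp + d, _)) None) hc3) => //= sh2 _.
    rewrite hd2 (leq_ltn_trans _ hd2) ?leq_add2l //.
    rewrite hv2 ha2 ?hv1 ?addnS //=; rewrite -/max_word hb; reflexivity.
  + by rewrite /= eqxx.
  + move=> y hy; rewrite /= ltn_eqF // ha2 ?ha1 //; by rewrite addnS ltnS ltnW.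
Qed.

Lemma agree_put d x v pr1 pr2 : agree d pr1 pr2 -> agree d (put pr1 x v) (put pr2 x v).
Proof. by move=> h y hy /=; rewrite h. Qed.

Lemma srun_nops m l sh pr : code_at l (nseq m (Const tmp 0)) ->
  exists pr', srun m l sh pr (l + m) sh pr' /\ agree tmp pr' pr.
Proof.
elim: m l pr => [|m IH] l pr.
  by move=> _; exists pr; rewrite addn0; split=> //; apply: srun0.
move=> /code_at1[hc hcs].
have [pr' [hr ha]] := IH _ (put pr tmp (Word 0)) hcs.
exists pr'; split; last first.
  by move=> y hy; rewrite ha //= ltn_eqF.
rewrite addnS -addSn.
apply: (srunS (act := Action l.+1 (Some (tmp, Word 0)) None) hc) => //= sh2 _.
by rewrite -/max_word expn_gt0.
Qed.

(** Assertions speak of an idealized private memory [pr] in which expressions leave no traces; the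
    machine has [pr1], which may differ from [tmp] on. The run takes exactly [cost n p c] steps,
    whatever branches are taken. *)
Lemma wp_sound c l (Q : memory -> memory -> Prop) sh pr pr1 :
  wf c -> code_at l (compile c l) -> agree tmp pr1 pr -> wp c Q sh pr ->
  exists sh' pr' pr1',
    [/\ srun (cost n p c) l sh pr1 (l + csize c) sh' pr1',
        agree tmp pr1' pr' & Q sh' pr'].
Proof.
have tn : tmp < ncells by [].
elim: c l Q sh pr pr1 => /=.
- move=> x e l Q sh pr pr1 /andP[hx he] /code_at_cat[hc1 /code_at1[hc2 _]] ha [hs hQ].
  have [pr2 [hr hv ha2]] := srun_expr sh he hc1 hs ha; rewrite !addn0 in hv ha2.
  exists sh, (put pr x (Word (eval pr e))), (put pr2 x (Word (eval pr e))); split=> //.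
    rewrite /esize -addn1; apply: srun_trans hr _; rewrite addnA addn1.
    apply: (@srun1 _ sh pr2 _ (Action _ (Some (x, _)) None) hc2) => //= sh2 _.
    by rewrite (ltn_trans hx) // hv.
  by apply: agree_put => y hy; rewrite ha2 ?ha.
- move=> x e l Q sh pr pr1 /andP[hx he] /code_at_cat[hc1 /code_at1[hc2 _]] ha [hs hn hrd hQ].
  have [pr2 [hr hv ha2]] := srun_expr sh he hc1 hs ha; rewrite !addn0 in hv ha2.
  exists sh, (put pr x (sh (eval pr e))), (put pr2 x (sh (eval pr e))); split=> //.
    rewrite /esize -addn1; apply: srun_trans hr _; rewrite addnA addn1.
    apply: (@srun1 _ sh pr2 _ (Action _ (Some (x, _)) None) hc2) => //= sh2 hsh.
    by rewrite hv addn0 hn (ltn_trans hx) // hsh.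
  by apply: agree_put => y hy; rewrite ha2 ?ha.
- move=> e x l Q sh pr pr1 /andP[hx he] /code_at_cat[hc1 /code_at1[hc2 _]] ha [hs hn hwr hQ].
  have [pr2 [hr hv ha2]] := srun_expr sh he hc1 hs ha; rewrite !addn0 in hv ha2.
  exists (put sh (eval pr e) (pr x)), pr, pr2; split=> //.
    rewrite /esize -addn1; apply: srun_trans hr _; rewrite addnA addn1.
    apply: (@srun1 _ sh pr2 _ (Action _ None (Some (eval pr e, pr x))) hc2) => [sh2 hsh|a v [<- _] //].
    by rewrite /= hv addn0 hn (ltn_trans hx) // ha2 ?ha.
  by move=> y hy; rewrite ha2 ?ha.
- move=> d x y z l Q sh pr pr1 hw /code_at1[hc _] ha [hp hQ].
  have /and5P[hd hx hy hz _] := hw.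
  set w := Word _ in hQ.
  exists sh, (put pr d w), (put pr1 d w); split=> //; last exact: agree_put.
  rewrite addn1; apply: (@srun1 _ sh pr1 _ (Action _ (Some (d, w)) None) hc) => //= sh2 _.
  rewrite !(ltn_trans _ tn) // !ha //; move: hp; rewrite /w /=.
  case: (pr x) => //= qx; case: (pr y) => //= qy; case: (pr z) => //= qz _.
  by rewrite -/max_word bool_lt_max_word.
- move=> d x y z t l Q sh pr pr1 hw /code_at1[hc _] ha [hp hxy hzt hQ].
  have /and5P[hd hx hy hz /andP[ht _]] := hw.
  set w := Word _ in hQ.
  exists sh, (put pr d w), (put pr1 d w); split=> //; last exact: agree_put.
  rewrite addn1; apply: (@srun1 _ sh pr1 _ (Action _ (Some (d, w)) None) hc) => //= sh2 _.
  rewrite !(ltn_trans _ tn) // !ha //; move: hp hxy hzt; rewrite /w /=.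
  case: (pr x) => //= qx; case: (pr y) => //= qy; case: (pr z) => //= qz.
  case: (pr t) => //= qt _ /negbTE-> /negbTE-> /=.
  by rewrite -/max_word bool_lt_max_word.
- move=> c1 IH1 c2 IH2 l Q sh pr pr1 /andP[h1 h2] /code_at_cat[hc1 hc2] ha hw.
  have [sh2 [pr2 [pr2' [hr ha2 hw2]]]] := IH1 _ _ _ _ _ h1 hc1 ha hw.
  rewrite size_compile in hc2.
  have [sh3 [pr3 [pr3' [hr3 ha3 hw3]]]] := IH2 _ _ _ _ _ h2 hc2 ha2 hw2.
  exists sh3, pr3, pr3'; split=> //; rewrite addnA; exact: srun_trans hr hr3.
- move=> e c IH l Q sh pr pr1 /and3P[he hc hl].
  move=> /code_at_cat[hc1 /code_at1[hc2 /code_at_cat[hc3 /code_at1[hc4 hc5]]]] ha [hs].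
  have [pr2 [hr hv ha2]] := srun_expr sh he hc1 hs ha; rewrite !addn0 in hv ha2.
  have ha3 : agree tmp pr2 pr by move=> y hy; rewrite ha2 ?ha.
  rewrite size_compile in hc4 hc5; rewrite -/(esize e) in hc2 hc3 hc4 hc5 hr *.
  rewrite addn1 in hc3; case: eqP => hev hQ.
    have [pr3 [hr3 ha4]] := @srun_nops (cost 0 0 c).+1 _ sh pr2 hc5.
    exists sh, pr, pr3; split=> //; last by move=> y hy; rewrite ha4 ?ha3.
    apply: srun_trans hr _; rewrite -add1n (loop_free_cost _ _ hl).
    apply: (@srun_trans 1) (_ : srun 1 _ _ _ (l + esize e + 1 + csize c + 1) sh pr2) _.
      apply: (@srun1 _ sh pr2 _ (Action _ None None) hc2) => //= sh2 _.
      by rewrite hv hev.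
    by move: hr3; congr srun; lia.
  have [sh3 [pr3 [pr3' [hr3 ha4 hQ3]]]] := IH _ _ _ _ _ hc hc3 ha3 hQ.
  exists sh3, pr3, pr3'; split=> //.
  apply: srun_trans hr _; rewrite -add1n -[(cost n p c).+1]addn1.
  apply: (@srun_trans 1) (_ : srun 1 _ _ _ (l + esize e).+1 sh pr2) _.
    apply: (@srun1 _ sh pr2 _ (Action _ None None) hc2) => //= sh2 _.
    by rewrite hv; move: hev; case: (eval pr e).
  apply: srun_trans hr3 _.
  by apply: (@srun1 _ sh3 pr3' _ (Action _ None None) hc4).
- move=> e k c IH l Q sh pr pr1 /andP[he hc].
  move=> /code_at_cat[hc1 /code_at1[hc2 /code_at_cat[hc3 /code_at1[hc4 _]]]].
  rewrite size_compile in hc4; rewrite -/(esize e) in hc2 hc3 hc4 *.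
  rewrite addn1 in hc3.
  elim: (k n p) sh pr pr1 => [|j IHj] sh pr pr1 ha /= [hs [hev hQ]].
    have [pr2 [hr hv ha2]] := srun_expr sh he hc1 hs ha; rewrite !addn0 in hv ha2.
    exists sh, pr, pr2; split=> //; last by move=> y hy; rewrite ha2 ?ha.
    rewrite mul0n add0n -addn1; apply: srun_trans hr _.
    apply: (@srun1 _ sh pr2 _ (Action _ None None) hc2) => //= sh2 _.
    by rewrite hv hev.
  have [pr2 [hr hv ha2]] := srun_expr sh he hc1 hs ha; rewrite !addn0 in hv ha2.
  have ha3 : agree tmp pr2 pr by move=> y hy; rewrite ha2 ?ha.
  have [sh3 [pr3 [pr3' [hr3 ha4 hQ3]]]] := IH _ _ _ _ _ hc hc3 ha3 hQ.
  have [sh4 [pr4 [pr4' [hr4 ha5 hQ4]]]] := IHj _ _ _ ha4 hQ3.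
  exists sh4, pr4, pr4'; split=> //.
  rewrite mulSn; set r := j * _ in hr4 *.
  have -> : esize e + (cost n p c).+2 + r + (esize e).+1 =
    esize e + (1 + (cost n p c + (1 + (r + (esize e).+1)))) by lia.
  apply: srun_trans hr _.
  apply: (@srun_trans 1) (_ : srun 1 _ _ _ (l + esize e).+1 sh pr2) _.
    apply: (@srun1 _ sh pr2 _ (Action _ None None) hc2) => //= sh2 _.
    by rewrite hv; move: hev; case: (eval pr e).
  apply: srun_trans hr3 _.
  apply: (@srun_trans 1) (_ : srun 1 _ _ _ l sh3 pr3') hr4.
  by apply: (@srun1 _ sh3 pr3' _ (Action _ None None) hc4).
Qed.

End WeakestPrecondition.
End Sequential.
Arguments wp_loop : simpl never.

(** * From sequential runs with disjoint ownership to synchronous parallel runs *)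

Section Parallel.
Variables (R : realType) (prog : seq instr) (n p : nat).

Notation memory := (nat -> value R).
Notation A := (algorithm_of prog).
Notation config := (config R p).

Definition reaches (t : nat) (c c' : config) : Prop :=
  iter t (obind (Defs.step A n (p := p))) (Some c) = Some c'.

Lemma reaches_trans t1 t2 c1 c2 c3 :
  reaches t1 c1 c2 -> reaches t2 c2 c3 -> reaches (t1 + t2) c1 c3.
Proof. by rewrite /reaches addnC iterD => ->. Qed.

Lemma foldl_update_out (w : 'I_p -> option (nat * value R)) (sh : memory) r a :
  (forall i v, i \in r -> w i <> Some (a, v)) ->
  foldl (fun f i => update f (w i)) sh r a = sh a.
Proof.
elim: r sh => //= x r IH sh h; rewrite IH.
  by apply: update_out => v; apply: h; rewrite mem_head.
by move=> i v hi; apply: h; rewrite in_cons hi orbT.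
Qed.

Lemma foldl_update_in (w : 'I_p -> option (nat * value R)) (sh : memory) r a i v :
  uniq r -> i \in r -> w i = Some (a, v) ->
  (forall j v', j != i -> w j <> Some (a, v')) ->
  foldl (fun f i => update f (w i)) sh r a = v.
Proof.
elim: r sh => //= x r IH sh /andP[hx hu]; rewrite in_cons.
case: (i =P x) => [ex _ hw ho|_ /= hi hw ho]; last exact: IH.
rewrite -ex in hx *; rewrite foldl_update_out; first by rewrite hw /= eqxx.
by move=> j v' hj; apply: ho; apply: contraNneq hx => <-.
Qed.

Section Ownership.
Variables rd wr : 'I_p -> nat -> Prop.
Hypothesis wr_rd : forall i a, wr i a -> rd i a.
Hypothesis wr_excl : forall i j a, i != j -> wr i a -> ~ rd j a.

(** A processor never writes to what another one may read, so the private view of each remains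
    correct on its own [rd], and the steps of [srun] depend on nothing else. As [wr] is part of
    [rd], the same disjointness makes writes exclusive. *)
Lemma srun_parallel t (c : config) (view view' : 'I_p -> memory) pc' pr' :
  (forall i, srun prog n p (rd i) (wr i) t (counter c i) (view i) (private c i)
     (pc' i) (view' i) (pr' i)) ->
  (forall i a, rd i a -> shared c a = view i a) ->
  exists c', [/\ reaches t c c',
    forall i, counter c' i = pc' i,
    forall i, private c' i = pr' i,
    forall i a, rd i a -> shared c' a = view' i a
    & forall a, (forall i, ~ wr i a) -> shared c' a = shared c a].
Proof.
elim: t c view => [|t IH] c view hr hv.
  exists c; split=> // i; move: (hr i) => h; inversion h => //; subst.
  by move=> a; apply: hv.
pose act i := odflt (Action 0 None None) (proc_action A n c i).
pose sh' := foldl (fun f i => update f (shared_write (act i))) (shared c) (enum 'I_p).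
pose c1 := Config sh' (fun i => goto (act i))
  (fun i => update (private c i) (private_write (act i))).
have hact i : [/\ proc_action A n c i = Some (act i),
   forall a v, shared_write (act i) = Some (a, v) -> wr i a &
   srun prog n p (rd i) (wr i) t (goto (act i)) (update (view i) (shared_write (act i)))
     (update (private c i) (private_write (act i))) (pc' i) (view' i) (pr' i)].
  move: (hr i) => h; inversion h; subst.
  have e : proc_action A n c i = Some act0.
    by rewrite /proc_action H0; apply: H1 => a; apply: hv.
  by rewrite /act e.
have hw i : write_target A n c i = omap fst (shared_write (act i)).
  by rewrite /write_target; case: (hact i) => -> _ _; case: (act i) => ? ? [[]|].
have hstep : Defs.step A n c = Some c1.
  rewrite /Defs.step ifT //; apply/andP; split.
    by apply/forallP => i; case: (hact i) => ->.
  apply/forallP => i; apply/forallP => j; apply/implyP => hij; rewrite !hw.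
  case: (hact i) => _ hi _; case: (hact j) => _ hj _.
  case: (shared_write (act i)) hi => [[a v]|] //= /(_ _ _ erefl) hia.
  case: (shared_write (act j)) hj => [[b v']|] //= /(_ _ _ erefl) hjb.
  apply/eqP => -[eab]; subst b.
  exact: (wr_excl hij hia (wr_rd hjb)).
have hv1 i a : rd i a -> shared c1 a = update (view i) (shared_write (act i)) a.
  move=> hia; rewrite /= /sh'.
  case e : (shared_write (act i)) => [[b v]|]; last first.
    rewrite foldl_update_out; first exact: hv.
    move=> j v _ ej.
    have [eji|hji] := eqVneq j i; first by rewrite -eji ej in e.
    by case: (hact j) => _ /(_ _ _ ej) hj _; apply: (wr_excl hji hj).
  rewrite /=; case: eqP => [eab|hab].
    subst b; apply: (@foldl_update_in (fun i => shared_write (act i)) _ _ a i v)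
      => [|||j v' hji ej]; rewrite ?enum_uniq ?mem_enum //.
    by case: (hact j) => _ /(_ _ _ ej) hj _; apply: (wr_excl hji hj).
  rewrite foldl_update_out; first exact: hv.
  move=> j v' _ ej.
  have [eji|hji] := eqVneq j i; first by move: ej; rewrite eji e => -[/esym].
  by case: (hact j) => _ /(_ _ _ ej) hj _; apply: (wr_excl hji hj).
have [|c' [h1 h2 h3 h4 h5]] := IH c1 _ _ hv1.
  by move=> i; case: (hact i).
exists c'; split=> //.
  by rewrite /reaches iterSr /= hstep.
move=> a ha; rewrite h5 //= /sh' foldl_update_out // => i v _ ei.
by case: (hact i) => _ /(_ _ _ ei) /ha.
Qed.

End Ownership.

Definition assertion := memory -> ('I_p -> memory) -> Prop.

Definition at_line (l : nat) (sh : memory) (prs : 'I_p -> memory) (c : config) : Prop :=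
  [/\ forall i, counter c i = l, forall i, agree tmp (private c i) (prs i)
    & shared c =1 sh].

Definition triple (c : cmd) (Pre Post : assertion) : Prop :=
  forall l cfg sh prs, code_at prog l (compile c l) -> at_line l sh prs cfg ->
  Pre sh prs ->
  exists cfg' sh' prs', [/\ reaches (cost n p c) cfg cfg',
    at_line (l + csize c) sh' prs' cfg' & Post sh' prs'].

(** Ownership is chosen anew for every segment and may depend on the memory found there. The
    resulting shared memory is known from the view of [i] on [rd i], and is unchanged on cells that
    nobody may write. *)
Lemma triple_segment c (Pre Post : assertion) :
  wf c ->
  (forall sh prs, Pre sh prs ->
    exists (rd wr : 'I_p -> nat -> Prop) (Q : 'I_p -> memory -> memory -> Prop),
    [/\ forall i a, wr i a -> rd i a,
        forall i j a, i != j -> wr i a -> ~ rd j a,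
        forall i, wp n p (rd i) (wr i) c (Q i) sh (prs i)
      & forall sh' prs',
        (forall i, exists view, Q i view (prs' i) /\ forall a, rd i a -> sh' a = view a) ->
        (forall a, (forall i, ~ wr i a) -> sh' a = sh a) -> Post sh' prs']) ->
  triple c Pre Post.
Proof.
move=> hwf h l cfg sh prs hc [hpc hag hsh] /h [rd [wr [Q [h1 h2 h3 h4]]]].
have hx i := wp_sound hwf hc (hag i) (h3 i).
have [view {}hx] := fin_all_exists hx.
have [prs' {}hx] := fin_all_exists hx.
have [prf {}hx] := fin_all_exists hx.
have hr i : srun prog n p (rd i) (wr i) (cost n p c) (counter cfg i) sh (private cfg i)
     (l + csize c) (view i) (prf i).
  by rewrite hpc; case: (hx i).
have [|cfg' [k1 k2 k3 k4 k5]] := srun_parallel h1 h2 hr.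
  by move=> i a _; apply: hsh.
exists cfg', (shared cfg'), prs'; split=> //.
  by split=> // i; rewrite k3; case: (hx i).
apply: h4 => [i|a ha]; last by rewrite k5.
by exists (view i); split; [case: (hx i) | apply: k4].
Qed.

Lemma triple_seq c1 c2 (P Q S : assertion) :
  triple c1 P Q -> triple c2 Q S -> triple (Seq c1 c2) P S.
Proof.
move=> h1 h2 l cfg sh prs /= /code_at_cat[hc1 hc2] hat hP.
rewrite size_compile in hc2.
have [cfg' [sh' [prs' [k1 k2 k3]]]] := h1 _ _ _ _ hc1 hat hP.
have [cfg2 [sh2 [prs2 [k4 k5 k6]]]] := h2 _ _ _ _ hc2 k2 k3.
exists cfg2, sh2, prs2; rewrite addnA; split=> //; exact: reaches_trans k1 k4.
Qed.

Lemma triple_weaken c (P P' Q Q' : assertion) :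
  (forall sh prs, P' sh prs -> P sh prs) -> (forall sh prs, Q sh prs -> Q' sh prs) ->
  triple c P Q -> triple c P' Q'.
Proof.
move=> hP hQ h l cfg sh prs hc hat /hP hp.
have [cfg' [sh' [prs' [k1 k2 /hQ k3]]]] := h _ _ _ _ hc hat hp.
by exists cfg', sh', prs'.
Qed.

(** The outcome [b] is common to all processors, which keeps them on the same line after the
    branch. *)
Lemma reaches_test e target l cfg sh prs (b : bool) :
  wf_expr e 0 -> code_at prog l (compile_expr e 0 ++ [:: JumpZero tmp target]) ->
  at_line l sh prs cfg ->
  (forall i, safe n (prs i) e /\ (eval (prs i) e == 0) = b) ->
  exists cfg', reaches (esize e).+1 cfg cfg' /\
    at_line (if b then target else (l + esize e).+1) sh prs cfg'.
Proof.
move=> he /code_at_cat[hc1 /code_at1[hc2 _]] [hpc hag hsh] hb.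
have tn : tmp < ncells by [].
have hx i : exists pr, srun prog n p (fun=> False) (fun=> False) (esize e).+1 (counter cfg i)
    sh (private cfg i) (if b then target else (l + esize e).+1) sh pr /\
    agree tmp pr (prs i).
  have [hs hev] := hb i.
  have [pr [hr hv ha]] := @srun_expr R prog n p (fun=> False) (fun=> False) e 0 l sh _ _ he hc1 hs (hag i).
  rewrite !addn0 in hv ha; exists pr; split; last first.
    by move=> y hy; rewrite ha // hag.
  rewrite hpc -addn1; apply: srun_trans hr _.
  apply: (srun1 (act := Action _ None None) hc2) => //= sh2 _.
  by rewrite hv hev.
have [prf {}hx] := fin_all_exists hx.
have [||i||cfg' [k1 k2 k3 _ k5]] := @srun_parallel (fun _ _ => False) (fun _ _ => False)
  _ _ (esize e).+1 cfg (fun=> sh) (fun=> sh) (fun=> if b then target else (l + esize e).+1) prf => //.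
  by case: (hx i).
exists cfg'; split=> //; split=> //.
  by move=> i; rewrite k3; case: (hx i).
by move=> a; rewrite k5 // => _ [].
Qed.

Lemma triple_while (I : nat -> assertion) e k c :
  wf_expr e 0 ->
  (forall j sh prs i, j <= k n p -> I j sh prs ->
     safe n (prs i) e /\ (eval (prs i) e == 0) = (j == k n p)) ->
  (forall j, j < k n p -> triple c (I j) (I j.+1)) ->
  triple (While e k c) (I 0) (I (k n p)).
Proof.
move=> he hI hS l cfg sh prs /= hc hat h0.
have hc1 : code_at prog l (compile_expr e 0 ++ [:: JumpZero tmp (l + csize (While e k c))]).
  by move: hc; rewrite -cat1s catA => /code_at_cat[].
move: hc => /code_at_cat[_ /code_at1[_ /code_at_cat[hc3 /code_at1[hc4 _]]]].
rewrite size_compile -/(esize e) in hc3 hc4; rewrite addn1 in hc3.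
suff: forall j cfg sh prs, j <= k n p -> at_line l sh prs cfg -> I (k n p - j) sh prs ->
  exists cfg' sh' prs',
  [/\ reaches (j * (esize e + (cost n p c).+2) + (esize e).+1) cfg cfg',
      at_line (l + csize (While e k c)) sh' prs' cfg' & I (k n p) sh' prs'].
  by move=> h; apply: (h (k n p) cfg sh prs) => //; rewrite subnn.
elim=> [|j IH] {h0} {}cfg {}sh {}prs hj {}hat hIj.
  rewrite subn0 in hIj.
  have [i|cfg' [k1 k2]] := reaches_test (b := true) he hc1 hat.
    by have := hI _ _ _ i (leqnn _) hIj; rewrite eqxx.
  by exists cfg', sh, prs.
have [i|cfg1 [k1 k2]] := reaches_test (b := false) he hc1 hat.
  by have := hI _ _ _ i (leq_subr _ _) hIj; rewrite (_ : (_ == k n p) = false) //; lia.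
have hj' : k n p - j.+1 < k n p by lia.
have [cfg2 [sh2 [prs2 [k3 k4 k5]]]] := hS _ hj' _ _ _ _ hc3 k2 hIj.
have [cfg3 [k6 k7]] : exists cfg3, reaches 1 cfg2 cfg3 /\ at_line l sh2 prs2 cfg3.
  case: k4 => hpc hag hsh.
  have [||i||cfg' [m1 m2 m3 _ m5]] := @srun_parallel (fun _ _ => False) (fun _ _ => False)
    _ _ 1 cfg2 (fun=> sh2) (fun=> sh2) (fun=> l) (private cfg2) => //.
    rewrite hpc.
    exact: (@srun1 R prog n p (fun=> False) (fun=> False) _ sh2 (private cfg2 i) _
      (Action l None None) hc4).
  exists cfg'; split=> //; split=> //; first by move=> i; rewrite m3.
  by move=> a; rewrite m5 // => _ [].
have [||cfg4 [sh4 [prs4 [k8 k9 k10]]]] := IH cfg3 sh2 prs2 _ k7; first lia.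
  by have -> : k n p - j = (k n p - j.+1).+1 by lia.
exists cfg4, sh4, prs4; split=> //.
rewrite mulSn; set r := j * _ in k8 *.
have -> : esize e + (cost n p c).+2 + r + (esize e).+1 =
    (esize e).+1 + (cost n p c + (1 + (r + (esize e).+1))) by lia.
apply: reaches_trans k1 _; apply: reaches_trans k3 _; exact: reaches_trans k6 k8.
Qed.

End Parallel.

(** * Binary search *)

(** The accepted index [x] grows by decreasing powers of two. Index 0 is accepted untested, so [q v]
    may be a test comparing [v] with its predecessor. *)
Fixpoint bsearch (q : nat -> bool) (N k x : nat) : nat :=
  if k is k'.+1 then
    bsearch q N k' (if (x + 2 ^ k' < N) && q (x + 2 ^ k') then x + 2 ^ k' else x)
  else x.

Lemma bsearchP (q : nat -> bool) N k : 0 < N -> N <= 2 ^ k ->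
  (forall u v, 0 < u <= v -> v < N -> q v -> q u) ->
  [/\ bsearch q N k 0 < N, forall v, 0 < v <= bsearch q N k 0 -> q v
    & forall v, bsearch q N k 0 < v < N -> ~~ q v].
Proof.
move=> hN hk hq.
(* Invariant: all positive indices up to [x] pass, and all indices from [x + 2 ^ k] on fail. *)
suff: forall k x, x < N -> (forall v, 0 < v <= x -> q v) ->
    (forall v, x + 2 ^ k <= v < N -> ~~ q v) ->
    [/\ bsearch q N k x < N, forall v, 0 < v <= bsearch q N k x -> q v
    & forall v, bsearch q N k x < v < N -> ~~ q v].
  by apply=> // v; lia.
elim=> {hk k} [|k IH] x hx h1 h2 /=; first by split=> // v hv; apply: h2; rewrite expn0; lia.
have hp : 0 < 2 ^ k by rewrite expn_gt0.
have e : 2 ^ k.+1 = 2 ^ k + 2 ^ k by rewrite expnS mul2n addnn.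
case: (ltnP (x + 2 ^ k) N) => [hlt|hge]; last first.
  by apply: IH => // v hv; lia.
case hqx : (q (x + 2 ^ k)).
  apply: IH => // v hv; first by apply: (hq _ (x + 2 ^ k)); lia.
  by apply: h2; lia.
apply: IH => // v hv; apply/negP => hqv.
by rewrite (hq (x + 2 ^ k) v) // in hqx; lia.
Qed.

(** * Upper hulls of sorted points *)

Section Hull.
Import Order.TTheory GRing.Theory Num.Theory.
Variables (R : realType) (Q : nat -> point R) (N : nat).
Hypothesis xlt : forall i j, i < j -> j < N -> ((Q i).1 < (Q j).1)%R.
Hypothesis gp : forall i j k, i < j -> j < k -> k < N -> orient (Q i) (Q j) (Q k) != 0%R.

Notation ori i j k := (orient (Q i) (Q j) (Q k)).
Notation sl i j := (slope (Q i) (Q j)).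

(** Combinatorial form of an upper hull vertex of the points [a, ..., c.-1]: point [k] is strictly
    above every segment joining a point to its left with one to its right. *)
Definition hull (a c k : nat) : Prop :=
  a <= k < c /\ forall i j, a <= i < k -> k < j < c -> (ori i k j < 0)%R.

(** The intercept of the line of slope [m] through point [i]; its maximizers are the points of
    contact of the upper tangent of slope [m]. *)
Definition height (m : R) (i : nat) : R := ((Q i).2 - m * (Q i).1)%R.

Lemma orient_cycle (a b c : point R) : orient a b c = orient b c a.
Proof. by rewrite /orient; ring. Qed.

Lemma orient_swap (a b c : point R) : orient a b c = (- orient a c b)%R.
Proof. by rewrite /orient; ring. Qed.

(** Points [i] and [j] have the same height for their own slope. This turns orientation tests into
    comparisons of a linear functional, which are transitive. *)
Lemma height_orient i j k : i < j -> j < N ->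
  (height (sl i j) k - height (sl i j) i = ori i j k / ((Q j).1 - (Q i).1))%R.
Proof.
move=> ij jN; have := xlt ij jN; rewrite -subr_gt0 => /lt0r_neq0 h.
by rewrite /height /slope /orient; field.
Qed.

Lemma height_lt i j k : i < j -> j < N ->
  (height (sl i j) k < height (sl i j) i)%R = (ori i j k < 0)%R.
Proof.
move=> ij jN; rewrite -subr_lt0 height_orient // pmulr_llt0 //.
by rewrite invr_gt0 subr_gt0 xlt.
Qed.

Lemma height_le i j k : i < j -> j < N ->
  (height (sl i j) k <= height (sl i j) i)%R = (ori i j k <= 0)%R.
Proof.
move=> ij jN; rewrite -subr_le0 height_orient // pmulr_lle0 //.
by rewrite invr_gt0 subr_gt0 xlt.
Qed.

Lemma height_slope i j : i < j -> j < N -> height (sl i j) j = height (sl i j) i.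
Proof.
move=> ij jN; apply/eqP; rewrite -subr_eq0 height_orient // /orient.
by apply/eqP; ring.
Qed.

Lemma slope_height m i j : i < j -> j < N ->
  (m < sl i j)%R = (height m i < height m j)%R.
Proof.
move=> ij jN; rewrite /slope ltr_pdivlMr ?subr_gt0 ?xlt // /height.
by apply/idP/idP => h; lra.
Qed.

Lemma slope_orient i j k : i < j -> j < k -> k < N ->
  (sl i j < sl i k)%R = (0 < ori i j k)%R.
Proof.
move=> ij jk kN; rewrite slope_height //; last exact: ltn_trans jk.
rewrite -height_slope; [|lia|lia]; rewrite -subr_gt0 height_slope; [|lia|lia].
rewrite height_orient; [|lia|lia]; rewrite pmulr_lgt0 //.
by rewrite invr_gt0 subr_gt0 xlt //; lia.
Qed.

Lemma orient_lt0 i j k : i < j -> j < k -> k < N ->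
  (ori i j k < 0)%R = ~~ (0 < ori i j k)%R.
Proof. by move=> ij jk kN; rewrite -leNgt lt_neqAle gp. Qed.

(** For a linear functional, being at least as high as both ends puts [k] weakly above the segment;
    general position makes this strict. *)
Lemma orient_max m i k j : i < k -> k < j -> j < N ->
  (height m i <= height m k)%R -> (height m j <= height m k)%R -> (ori i k j < 0)%R.
Proof.
move=> ik kj jN h1 h2; rewrite lt_neqAle gp //=.
have := xlt ik (ltn_trans kj jN); have := xlt kj jN; move: h1 h2.
rewrite /height /orient.
move: (Q i) (Q j) (Q k) => [xi yi] [xj yj] [xk yk] /= h1 h2 h3 h4.
by nra.
Qed.

(** Both hypotheses say that a point, [i] or [j], is below the line through [k1] and [k2]. So [k1]
    and [k2] are maximal among the four points for the slope of this line; the next lemma uses [k2]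
    instead of [k1]. *)
Lemma orient_transl i k1 k2 j : i < k1 -> k1 < k2 -> k2 < j -> j < N ->
  (ori i k1 k2 < 0)%R -> (ori k1 k2 j < 0)%R -> (ori i k1 j < 0)%R.
Proof.
move=> h1 h2 h3 h4 h5 h6.
rewrite orient_cycle -height_lt in h5; [|lia..]; rewrite -height_lt in h6; [|lia..].
by apply: (@orient_max (sl k1 k2)); rewrite ?(ltW h5) ?(ltW h6) //; lia.
Qed.

Lemma orient_transr i k1 k2 j : i < k1 -> k1 < k2 -> k2 < j -> j < N ->
  (ori i k1 k2 < 0)%R -> (ori k1 k2 j < 0)%R -> (ori i k2 j < 0)%R.
Proof.
move=> h1 h2 h3 h4 h5 h6.
rewrite orient_cycle -height_lt in h5; [|lia..]; rewrite -height_lt in h6; [|lia..].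
by apply: (@orient_max (sl k1 k2)); rewrite ?(height_slope h2) ?(ltW h5) ?(ltW h6) //; lia.
Qed.

Lemma argmax (f : nat -> R) a c : a < c ->
  exists2 k, a <= k < c & forall i, a <= i < c -> (f i <= f k)%R.
Proof.
elim: c => // c IH; rewrite ltnS leq_eqVlt => /orP[/eqP->|/IH [k hk h]].
  by exists c => [|i]; rewrite ?leqnn ?ltnS // -eqn_leq => /eqP->.
have [hc|hc] := leP (f c) (f k).
  exists k => [|i]; first lia.
  have [->//|hi hi2] := eqVneq i c; apply: h; lia.
exists c => [|i]; first lia.
have [->//|hi hi2] := eqVneq i c; apply: le_trans (ltW hc); apply: h; lia.
Qed.

Lemma max_hull m a c k : c <= N -> a <= k < c ->
  (forall i, a <= i < c -> (height m i <= height m k)%R) -> hull a c k.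
Proof.
move=> cN hk h; split=> // i j hi hj.
by apply: (@orient_max m); rewrite ?h //; lia.
Qed.

Lemma hull_first a c : a < c -> hull a c a.
Proof. by move=> ac; split=> [|i j]; lia. Qed.

Lemma hull_last a c : a <= c -> hull a c.+1 c.
Proof. by move=> ac; split=> [|i j]; lia. Qed.

Lemma hull_sub a b c d k : a <= b -> c <= d -> b <= k < c -> hull a d k -> hull b c k.
Proof. by move=> h1 h2 h3 [h4 h]; split=> // i j hi hj; apply: h; lia. Qed.

(** A point maximal in the direction of the edge is a hull vertex. If it were strictly above the
    edge, it could not lie between the consecutive vertices [k1] and [k2], and outside of them it
    would contradict that [k1] or [k2] is a hull vertex. *)
Lemma hull_edge a c k1 k2 i : c <= N -> hull a c k1 -> hull a c k2 -> k1 < k2 ->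
  (forall k, k1 < k < k2 -> ~ hull a c k) -> a <= i < c ->
  (height (sl k1 k2) i <= height (sl k1 k2) k1)%R.
Proof.
move=> cN [b1 h1] [b2 h2] k12 no hi.
have k2N : k2 < N by lia.
have [k hk hmax] := @argmax (height (sl k1 k2)) a c ltac:(lia).
apply: le_trans (hmax _ hi) _; rewrite leNgt; apply/negP => hlt.
have hh := max_hull cN hk hmax.
have e := height_slope k12 k2N.
have ne1 : k != k1 by apply: contraTneq hlt => ->; rewrite ltxx.
have ne2 : k != k2 by apply: contraTneq hlt => ->; rewrite e ltxx.
have [lt1|ge1] := ltnP k k1.
  have := h1 k k2 ltac:(lia) ltac:(lia).
  by rewrite orient_cycle -height_lt // => /lt_trans/(_ hlt); rewrite ltxx.
have [lt2|ge2] := ltnP k k2; first by apply: (no k) => //; lia.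
have := h2 k1 k ltac:(lia) ltac:(lia).
by rewrite -height_lt // => /lt_trans/(_ hlt); rewrite ltxx.
Qed.

Definition chain (a c : nat) (t : nat -> nat) (h : nat) : Prop :=
  [/\ forall u, u < h -> hull a c (t u),
      forall u v, u < v -> v < h -> t u < t v
    & forall k, hull a c k -> exists2 u, u < h & t u = k].

Lemma chain_le a c t h u v : chain a c t h -> u <= v -> v < h -> t u <= t v.
Proof.
case=> _ h2 _; rewrite leq_eqVlt => /orP[/eqP->//|uv vh].
by apply: ltnW; apply: h2.
Qed.

Lemma chain_first a c t h : chain a c t h -> a < c -> 0 < h /\ t 0 = a.
Proof.
move=> hc ac; have [h1 h2 h3] := hc; have [u hu e] := h3 _ (hull_first ac).
split; first lia; have := chain_le hc (leq0n u) hu.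
by case: (h1 0 _) => //; lia.
Qed.

Lemma chain_edge a c t h u i : c <= N -> chain a c t h -> u.+1 < h -> a <= i < c ->
  (height (sl (t u) (t u.+1)) i <= height (sl (t u) (t u.+1)) (t u))%R.
Proof.
move=> cN hc hu hi; have [h1 h2 h3] := hc.
apply: (@hull_edge a c) => //; [apply: h1; lia|exact: h1|exact: h2|].
move=> k hk /h3 [v hv ev]; subst k.
have [le|lt] := leqP v u; first by have := chain_le hc le ltac:(lia); lia.
by have := chain_le hc lt hv; lia.
Qed.

(* The state of a Graham scan: hull vertices [t 0, ..., t h.-1] of the points
   [a, ..., j.-1], from which points hidden by point [j] may have been removed. *)
Definition scan (a j : nat) (t : nat -> nat) (h : nat) : Prop :=
  [/\ forall u, u < h -> hull a j (t u),
      forall u v, u < v -> v < h -> t u < t v,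
      forall k, hull a j k -> (exists2 u, u < h & t u = k) \/ (forall u, u < h -> t u < k)
    & forall k, k < j -> hull a j.+1 k -> exists2 u, u < h & t u = k].

Lemma chain_scan a j t h : chain a j t h -> scan a j t h.
Proof.
move=> [h1 h2 h3]; split=> // [k /h3|k kj hk]; first by left.
have [bk _] := hk; apply: h3; apply: hull_sub hk => //; lia.
Qed.

(** The removed vertex is below the segment from its predecessor to [j], hence no hull vertex once
    [j] is included. It now falls under the alternative of lying to the right of all kept
    vertices. *)
Lemma scan_pop a j t h : scan a j t h.+2 -> (0 < ori (t h) (t h.+1) j)%R ->
  scan a j t h.+1.
Proof.
move=> [h1 h2 h3 h4] ho; have [b _] := h1 h.+1 ltac:(lia).
have [b' _] := h1 h ltac:(lia).
have hlt := h2 h h.+1 ltac:(lia) ltac:(lia).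
split=> [u hu|u v uv hv|k /h3 [[u hu e]|hk]|k kj hk].
- by apply: h1; lia.
- by apply: h2; lia.
- have [e1|ne] := eqVneq u h.+1; last by left; exists u => //; lia.
  by right=> v hv; rewrite -e e1; apply: h2.
- by right=> v hv; apply: hk; lia.
- have [u hu e] := h4 _ kj hk.
  have [e1|ne] := eqVneq u h.+1; last by exists u => //; lia.
  case: hk => _ /(_ (t h) j); rewrite -e e1 => /(_ ltac:(lia) ltac:(lia)).
  by rewrite ltNge (ltW ho).
Qed.

Lemma scan_push a j t t' h : a <= j -> j < N -> scan a j t h ->
  (forall h', h = h'.+2 -> (ori (t h') (t h'.+1) j <= 0)%R) ->
  (forall u, u < h -> t' u = t u) -> t' h = j -> chain a j.+1 t' h.+1.
Proof.
move=> aj jN [h1 h2 h3 h4] ho ht hth.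
have bnd u : u < h -> a <= t u < j by move=> /h1[].
(* The top of the stack remains a hull vertex: in the direction of the last stacked edge, no earlier
   point is higher by [hull_edge], and [j] is not higher because the pop test failed. With a single
   stacked vertex there is no earlier point. *)
have top u i : h = u.+1 -> a <= i < t u -> (ori i (t u) j < 0)%R.
  move=> eh hi; case: u eh hi => [|u] eh hi.
    have b0 := bnd 0 ltac:(lia).
    have [v hv e] := h4 a ltac:(lia) (@hull_first a j.+1 ltac:(lia)).
    by have ev : v = 0 by [lia]; subst v; lia.
  subst h; have b1 := bnd u.+1 ltac:(lia); have b2 := bnd u ltac:(lia).
  have lt := h2 u u.+1 ltac:(lia) ltac:(lia).
  have hj := ho _ erefl.
  apply: (@orient_max (sl (t u) (t u.+1))); [lia|lia|by []| |].
    rewrite height_slope; [|by []|lia].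
    apply: (@hull_edge a j); [lia|apply: h1; lia|by apply: h1|by []| |lia].
    move=> k hk /h3 [[v hv e]|hk']; last by have := hk' u.+1 ltac:(lia); lia.
    have [e1|ne] := eqVneq v u.+1; first by subst v; lia.
    have [e1|ne1] := eqVneq v u; first by subst v; lia.
    by have := h2 v u ltac:(lia) ltac:(lia); lia.
  by rewrite height_slope; [rewrite height_le //; lia|by []|lia].
split=> [u hu|u v uv hv|k hk].
- have [e|ne] := eqVneq u h; first by rewrite e hth; apply: hull_last.
  have hu' : u < h by lia.
  rewrite ht //; have [b hk] := h1 u hu'; split; first lia.
  move=> i j' hi hj'; have [lt|ge] := ltnP j' j; first by apply: hk; lia.
  have -> : j' = j by lia.
  have eh : h = h.-1.+1 by lia.
  have [e|ne'] := eqVneq u h.-1; first by rewrite e in hi *; apply: top.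
  have lt := h2 u h.-1 ltac:(lia) ltac:(lia); have b2 := bnd h.-1 ltac:(lia).
  (* Deeper vertices inherit the property with respect to [j] from the top. *)
  apply: (@orient_transl i (t u) (t h.-1)); [lia|lia|lia|lia| |].
    by apply: hk; lia.
  by apply: top => //; lia.
- have [e|ne] := eqVneq v h.
    by rewrite e hth ht; [have := bnd u; lia|lia].
  by rewrite !ht ?h2 //; lia.
- have [bk _] := hk; have [e|ne] := eqVneq k j; first by exists h; rewrite ?hth.
  have [|u hu e] := h4 k _ hk; first lia.
  by exists u; rewrite ?ht //; lia.
Qed.

(** Concavity of the hull; it makes the slope test monotone, as binary search requires. *)
Lemma chain_slopes a c t h u : c <= N -> chain a c t h -> u.+2 < h ->
  (sl (t u.+1) (t u.+2) < sl (t u) (t u.+1))%R.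
Proof.
move=> cN [h1 h2 h3] hu.
have l1 := h2 u u.+1 ltac:(lia) ltac:(lia); have l2 := h2 u.+1 u.+2 ltac:(lia) ltac:(lia).
have [b1 _] := h1 u ltac:(lia); have [b3 _] := h1 u.+2 ltac:(lia).
have [b2 /(_ (t u) (t u.+2) ltac:(lia) ltac:(lia))] := h1 u.+1 ltac:(lia).
rewrite -height_lt; [|by []|lia]; rewrite -height_slope; [|by []|lia] => hh.
rewrite ltNge; apply/negP; rewrite le_eqVlt => /orP[/eqP e|].
  by move: hh; rewrite e height_slope ?ltxx //; lia.
rewrite slope_height; [|by []|lia]; move=> /lt_trans/(_ hh); by rewrite ltxx.
Qed.

(** Heights increase along the vertices up to [z] and do not increase afterwards. This settles all
    points, because some maximizer among them is a vertex of the chain by [max_hull]. *)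
Lemma chain_max a c t h m z : c <= N -> a < c -> chain a c t h -> z < h ->
  (forall v, 0 < v <= z -> (m < sl (t v.-1) (t v))%R) ->
  (forall v, z < v < h -> (sl (t v.-1) (t v) <= m)%R) ->
  forall j, a <= j < c -> (height m j <= height m (t z))%R.
Proof.
move=> cN ac hc hz hl hr j hj; have [h1 h2 h3] := hc.
have hN u : u < h -> t u < N by move=> /h1[]; lia.
have up v : v <= z -> (height m (t v) <= height m (t z))%R.
  move=> hv; rewrite -(subKn hv); elim: (z - v) => [|d IH]; first by rewrite subn0.
  have [le|lt] := leqP z d; first by rewrite (_ : z - d.+1 = z - d); last lia.
  apply: le_trans IH; have e : z - d = (z - d.+1).+1 by lia.
  have := hl (z - d) ltac:(lia); rewrite e /= slope_height ?hN ?h2 //; [|lia|lia].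
  exact: ltW.
have down d : z + d < h -> (height m (t (z + d)%N) <= height m (t z))%R.
  elim: d => [|d IH] hd; first by rewrite addn0.
  apply: le_trans (IH _); last lia.
  have := hr (z + d.+1) ltac:(lia); rewrite addnS /= leNgt slope_height ?hN ?h2 //; [|lia..].
  by rewrite -leNgt.
have [k hk hmax] := @argmax (height m) a c ac.
apply: le_trans (hmax _ hj) _.
have [u hu <-] := h3 _ (max_hull cN hk hmax).
have [le|lt] := leqP u z; first exact: up.
by rewrite -(subnKC (ltnW lt)); apply: down; lia.
Qed.

Section Merge.
Variables (a b c : nat) (t1 t2 : nat -> nat) (h1 h2 : nat).
Hypothesis ab : a < b.
Hypothesis bc : b < c.
Hypothesis cN : c <= N.
Hypothesis left_chain : chain a b t1 h1.
Hypothesis right_chain : chain b c t2 h2.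

Let bnd1 u : u < h1 -> a <= t1 u < b.
Proof. by case: left_chain => h _ _ /h[]. Qed.

Let bnd2 u : u < h2 -> b <= t2 u < c.
Proof. by case: right_chain => h _ _ /h[]. Qed.

(** If even the highest right vertex [t2 z] is below the line of the edge ending in [t1 u.+1], then
    this vertex maximizes the height of that slope over both blocks, left points being controlled by
    [chain_edge]. Otherwise it lies below the segment from [t1 u] to [t2 z]. *)
Lemma left_survive u z : u.+1 < h1 -> z < h2 ->
  (forall j, b <= j < c ->
    (height (sl (t1 u) (t1 u.+1)) j <= height (sl (t1 u) (t1 u.+1)) (t2 z))%R) ->
  hull a c (t1 u.+1) <-> ~~ (0 < ori (t1 u) (t1 u.+1) (t2 z))%R.
Proof.
move=> hu hz hmax.
have b1 := bnd1 hu; have b2 := bnd1 (ltnW hu); have b3 := bnd2 hz.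
have lt : t1 u < t1 u.+1 by case: left_chain => _ h _; apply: h.
rewrite -orient_lt0 //; [|lia..]; split.
  by case=> _; apply; lia.
rewrite -height_lt; [|by []|lia] => ho.
apply: (@max_hull (sl (t1 u) (t1 u.+1))) => // [|i hi]; first lia.
rewrite height_slope; [|by []|lia].
have [lti|gei] := ltnP i b; first by apply: (chain_edge _ left_chain) => //; lia.
by apply: le_trans (hmax _ _) (ltW ho); lia.
Qed.

(** An earlier left vertex turns right towards [t1 v], which turns right towards every right point;
    [orient_transl] combines the two. *)
Lemma left_survive_mono u v : u <= v -> v < h1 -> hull a c (t1 v) -> hull a c (t1 u).
Proof.
rewrite leq_eqVlt => /orP[/eqP->//|uv] hv [b1 hh].
have hu : u < h1 by lia.
have b2 := bnd1 hu; have b3 := bnd1 hv.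
have [k1 k2 _] := left_chain; have lt := k2 _ _ uv hv.
have [_ h] := k1 _ hu; split=> [|i j hi hj]; first lia.
have [ltj|gej] := ltnP j b; first by apply: h; lia.
apply: (@orient_transl _ _ (t1 v)); [lia|lia|lia|lia| |].
  by apply: h; lia.
by apply: hh; lia.
Qed.

Section Bridge.
Variables x z : nat.
Hypothesis hx : x < h1.
Hypothesis x_last : forall u, u < h1 -> hull a c (t1 u) <-> u <= x.
Hypothesis hz : z < h2.
Hypothesis z_up : forall v, 0 < v <= z -> (0 < ori (t1 x) (t2 v.-1) (t2 v))%R.
Hypothesis z_down : forall v, z < v < h2 -> ~~ (0 < ori (t1 x) (t2 v.-1) (t2 v))%R.

Let m := sl (t1 x) (t2 z).

(** Seen from [t1 x], the slopes to the right vertices rise up to [z] and do not rise afterwards, so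
    [m] is the largest. A right point maximizing the height can be taken to be such a vertex. *)
Let bridge_right j : b <= j < c -> (height m j <= height m (t2 z))%R.
Proof.
move=> hj; have bx := bnd1 hx; have [k1 k2 k3] := right_chain.
have up v : v <= z -> (sl (t1 x) (t2 v) <= m)%R.
  move=> hv; rewrite -(subKn hv); elim: (z - v) => [|d IH]; first by rewrite subn0.
  have [le|lt] := leqP z d; first by rewrite (_ : z - d.+1 = z - d); last lia.
  apply: le_trans IH; have e : z - d = (z - d.+1).+1 by lia.
  have q1 := bnd2 (u := z - d) ltac:(lia); have q2 := bnd2 (u := z - d.+1) ltac:(lia).
  have q3 := k2 (z - d.+1) (z - d) ltac:(lia) ltac:(lia).
  by have := @z_up (z - d) ltac:(lia); rewrite [in (z - d).-1]e /= -slope_orient; [exact: ltW|lia..].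
have down d : z + d < h2 -> (sl (t1 x) (t2 (z + d)%N) <= m)%R.
  elim: d => [|d IH] hd; first by rewrite addn0.
  apply: le_trans (IH _); last lia.
  have q1 := bnd2 hd; have q2 := bnd2 (u := z + d) ltac:(lia).
  have q3 := k2 (z + d) (z + d.+1) ltac:(lia) ltac:(lia).
  have := @z_down (z + d.+1) ltac:(lia).
  by rewrite [in (z + d.+1).-1]addnS /= -slope_orient; [rewrite -leNgt|lia..].
have [k hk hmax] := @argmax (height m) b c bc.
apply: le_trans (hmax _ hj) _.
have [u hu <-] := k3 _ (max_hull cN hk hmax).
have b2 := bnd2 hz; have b3 := bnd2 hu.
rewrite height_slope; [|lia..].
suff : (sl (t1 x) (t2 u) <= m)%R by rewrite leNgt slope_height ?leNgt //; lia.
have [le|lt] := leqP u z; first exact: up.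
by rewrite -(subnKC (ltnW lt)); apply: down; lia.
Qed.

(** A maximizer over both blocks is a hull vertex of the union. If it is a left point, it is a
    survivor [t1 u] with [u <= x], and for [u < x] the survival of [t1 x] puts it below the
    bridge. *)
Let bridge i : a <= i < c -> (height m i <= height m (t2 z))%R.
Proof.
move=> hi; have bx := bnd1 hx; have bz := bnd2 hz.
have [k hk hmax] := @argmax (height m) a c ltac:(lia).
apply: le_trans (hmax _ hi) _.
have [lt|ge] := ltnP k b; last by apply: bridge_right; lia.
have hh := max_hull cN hk hmax.
have [_ _ /(_ k) k3] := left_chain.
have [|u hu e] := k3; first by apply: hull_sub hh => //; lia.
have ux : u <= x by apply/x_last => //; rewrite e.
rewrite height_slope; [|lia..].
move: ux; rewrite leq_eqVlt => /orP[/eqP ux|ux]; first by rewrite -e ux; exact: lexx.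
have lt2 : t1 u < t1 x by case: left_chain => _ q _; apply: q.
have [_ /(_ k (t2 z))] : hull a c (t1 x) by apply/x_last.
move=> /(_ ltac:(lia) ltac:(lia)); rewrite orient_cycle -height_lt; [exact: ltW|lia..].
Qed.

(** Right vertices before [z] are not above the segment from [t1 x] to [t2 z]. Those after [z]
    survive by [orient_transr], since [t2 z] is itself a hull vertex of the union. *)
Lemma right_survive v : v < h2 -> hull a c (t2 v) <-> z <= v.
Proof.
move=> hv; have bx := bnd1 hx; have bz := bnd2 hz; have bv := bnd2 hv.
have [k1 k2 _] := right_chain.
have hull_z : hull a c (t2 z) by apply: max_hull bridge => //; lia.
split=> [hh|].
  rewrite leqNgt; apply/negP => lt.
  have [_ /(_ (t1 x) (t2 z))] := hh.
  have lt2 := k2 _ _ lt hz.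
  move=> /(_ ltac:(lia) ltac:(lia)).
  rewrite orient_swap oppr_lt0 ltNge -height_le; [|lia..].
  by rewrite -[X in (_ <= X)%R]height_slope ?bridge //; lia.
rewrite leq_eqVlt => /orP[/eqP<-//|zv].
have lt2 := k2 _ _ zv hv.
split=> [|i j hi hj]; first lia.
have [_ hh] := k1 _ hv.
have [lti|gei] := ltnP i b; last by apply: hh; lia.
apply: (@orient_transr _ (t2 z)); [lia|lia|lia|lia| |].
  by case: hull_z => _; apply; lia.
by apply: hh; lia.
Qed.

Lemma chain_merge (t : nat -> nat) :
  (forall u, u <= x -> t u = t1 u) ->
  (forall v, z <= v < h2 -> t (x.+1 + (v - z)) = t2 v) ->
  chain a c t (x.+1 + (h2 - z)).
Proof.
move=> e1 e2.
have [p1 p2 p3] := left_chain; have [q1 q2 q3] := right_chain.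
have tr u : x < u < x.+1 + (h2 - z) -> t u = t2 (z + (u - x.+1)).
  by move=> hu; rewrite -e2; [congr t|]; lia.
split=> [u hu|u v uv hv|k hk].
- have [le|lt] := leqP u x; first by rewrite e1 //; apply/x_last => //; lia.
  by rewrite tr; [apply/right_survive|]; lia.
- have [le|lt] := leqP v x; first by rewrite !e1; [apply: p2|..]; lia.
  have [le|lt'] := leqP u x; last by rewrite !tr; [apply: q2|..]; lia.
  rewrite e1 // tr; last lia.
  have := @bnd1 u ltac:(lia); have := @bnd2 (z + (v - x.+1)) ltac:(lia); lia.
- have [bk _] := hk; have [lt|ge] := ltnP k b.
    have [|u hu e] := p3 k; first by apply: hull_sub hk => //; lia.
    have ux : u <= x by apply/x_last => //; rewrite e.
    by exists u; [lia | rewrite e1].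
  have [|u hu e] := q3 k; first by apply: hull_sub hk => //; lia.
  have zu : z <= u by apply/right_survive => //; rewrite e.
  by exists (x.+1 + (u - z)); [lia | rewrite e2 //; lia].
Qed.

End Bridge.

(** By contraposition: once the right chain turns downwards as seen from the left vertex, its
    concavity keeps it so. Hence the successful tests of the third search form a prefix. *)
Lemma bridge_mono v : v.+2 < h2 -> forall x, x < h1 ->
  (0 < ori (t1 x) (t2 v.+1) (t2 v.+2))%R -> (0 < ori (t1 x) (t2 v) (t2 v.+1))%R.
Proof.
move=> hv x hx.
have [q1 q2 q3] := right_chain; have bx := bnd1 hx.
have b0 := bnd2 (u := v) ltac:(lia); have b1 := bnd2 (u := v.+1) ltac:(lia).
have b2 := bnd2 hv.
have l0 := q2 v v.+1 ltac:(lia) ltac:(lia); have l1 := q2 v.+1 v.+2 ltac:(lia) ltac:(lia).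
apply: contraTT; rewrite -!orient_lt0; [|lia..] => ho.
apply: (@orient_transr _ (t2 v)); [lia..|by []|].
by have [_] := q1 v.+1 ltac:(lia); apply; lia.
Qed.

End Merge.

End Hull.

(** * The combinatorial hull vertices are the extreme points on the upper boundary of the convex
    hull *)

Section UpperHull.
Import Order.TTheory GRing.Theory Num.Theory.
Variables (R : realType) (n : nat) (P : 'I_n -> point R).
Hypothesis P_sorted : presorted P.

(* [P] extended to [nat] by junk values. *)
Definition nat_points (k : nat) : point R :=
  if insub k is Some i then P i else (0, 0)%R.

Notation Q := nat_points.

Lemma nat_pointsE (i : 'I_n) : Q i = P i.
Proof. by rewrite /nat_points valK. Qed.

Lemma nat_points_xlt i j : i < j -> j < n -> ((Q i).1 < (Q j).1)%R.
Proof.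
move=> ij jn; have jn' := ltn_trans ij jn.
rewrite -[i]/(val (Ordinal jn')) -[j]/(val (Ordinal jn)) !nat_pointsE.
by case: P_sorted => h _; apply: h.
Qed.

Lemma nat_points_gp i j k : i < j -> j < k -> k < n -> orient (Q i) (Q j) (Q k) != 0%R.
Proof.
move=> ij jk kn; have jn := ltn_trans jk kn; have iN := ltn_trans ij jn.
rewrite -[i]/(val (Ordinal iN)) -[j]/(val (Ordinal jn)) -[k]/(val (Ordinal kn)) !nat_pointsE.
case: P_sorted => _; apply; rewrite -val_eqE /= neq_ltn ?ij ?jk //.
by rewrite (ltn_trans ij jk).
Qed.

Local Open Scope ring_scope.

Lemma sum_delta (i : 'I_n) (c : R) (f : 'I_n -> R) :
  \sum_(l < n) (if l == i then c else 0) * f l = c * f i.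
Proof.
rewrite (bigD1 i) //= eqxx big1 ?addr0 // => l /negbTE->.
by rewrite mul0r.
Qed.

Lemma segment_in_hull (i j : 'I_n) (t : R) : 0 <= t <= 1 ->
  in_hull P ((1 - t) * (P i).1 + t * (P j).1, (1 - t) * (P i).2 + t * (P j).2).
Proof.
move=> /andP[t0 t1].
pose w (l : 'I_n) : R := (if l == i then 1 - t else 0) + (if l == j then t else 0).
have sw f : \sum_(l < n) w l * f l = (1 - t) * f i + t * f j.
  rewrite -!sum_delta -big_split /=; apply: eq_bigr => l _; exact: mulrDl.
exists w; split=> [l|||]; rewrite ?sw //.
- by rewrite /w addr_ge0 //; case: ifP; rewrite ?subr_ge0.
- have := sw (fun=> 1); under eq_bigr do rewrite mulr1.
  by move=> ->; ring.
Qed.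

Lemma in_hull_height m q (w : 'I_n -> R) : q.1 = \sum_(i < n) w i * (P i).1 ->
  q.2 = \sum_(i < n) w i * (P i).2 ->
  q.2 - m * q.1 = \sum_(i < n) w i * height Q m i.
Proof.
move=> -> ->; rewrite mulr_sumr -sumrB; apply: eq_bigr => i _.
by rewrite /height nat_pointsE; ring.
Qed.

Lemma in_hull_le m q c : (forall i : 'I_n, height Q m i <= c) -> in_hull P q ->
  q.2 - m * q.1 <= c.
Proof.
move=> hc [w [w0 w1 q1 q2]]; rewrite (in_hull_height m q1 q2).
rewrite -[c]mul1r -w1 mulr_suml; apply: ler_sum => i _.
exact: ler_wpM2l.
Qed.

(** The weighted gaps to the maximal height are nonnegative with sum zero, so all the weight is at
    [k]. *)
Lemma in_hull_max m q (k : 'I_n) :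
  (forall i : 'I_n, i != k -> height Q m i < height Q m k) -> in_hull P q ->
  q.2 - m * q.1 = height Q m k -> q = P k.
Proof.
move=> hk [w [w0 w1 q1 q2]] e.
have h0 i : 0 <= w i * (height Q m k - height Q m i).
  apply: mulr_ge0 => //; rewrite subr_ge0.
  by have [->//|/hk/ltW] := eqVneq i k.
have s0 : \sum_(i < n) w i * (height Q m k - height Q m i) = 0.
  under eq_bigr do rewrite mulrBr.
  by rewrite sumrB -mulr_suml w1 mul1r -(in_hull_height m q1 q2) e subrr.
have wi i : i != k -> w i = 0.
  move=> ik; move/eqP: s0; rewrite psumr_eq0 // => /allP/(_ i (mem_index_enum _)) /=.
  by rewrite mulf_eq0 subr_eq0 (gt_eqF (hk i ik)) orbF => /eqP.
have wE i : w i = if i == k then 1 else 0.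
  have [->|/wi//] := eqVneq i k.
  by rewrite -w1 (bigD1 k) //= big1 ?addr0.
apply: injective_projections; rewrite (q1, q2);
  under eq_bigr do rewrite wE; by rewrite sum_delta mul1r.
Qed.

(** Any [m] strictly between the largest slope from [k] to the right and the smallest slope from the
    left to [k] will do. At the first and last points one of these constraints is absent. *)
Lemma hull_support (k : 'I_n) : hull Q 0 n k ->
  exists m, forall i : 'I_n, i != k -> height Q m i < height Q m k.
Proof.
have kn : (k < n)%N by [].
move=> [_ hk].
have sN i : (i < k)%N -> forall m, (m < slope (Q i) (Q k)) = (height Q m i < height Q m k).
  by move=> ik m; apply: (slope_height nat_points_xlt).
have sP j : (k < j)%N -> (j < n)%N -> forall m, (slope (Q k) (Q j) < m) = (height Q m j < height Q m k).
  move=> kj jn m; rewrite /slope ltr_pdivrMr ?subr_gt0 ?nat_points_xlt // /height.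
  by apply/idP/idP => h; lra.
have sPN i j : (i < k)%N -> (k < j)%N -> (j < n)%N -> slope (Q k) (Q j) < slope (Q i) (Q k).
  move=> ik kj jn; rewrite sP // (height_slope nat_points_xlt ik kn).
  by rewrite (height_lt nat_points_xlt) //; apply: hk; lia.
suff [m [hl hr]] : exists m, (forall i, (i < k)%N -> m < slope (Q i) (Q k)) /\
    forall j, (k < j < n)%N -> slope (Q k) (Q j) < m.
  exists m => i ik; have [lt|gt|e] := ltngtP i k; first by rewrite -sN // hl.
    by rewrite -sP // hr // gt ltn_ord.
  by rewrite (val_inj e) eqxx in ik.
have lo : (0 < k)%N -> exists2 i, (i < k)%N & forall i', (i' < k)%N -> slope (Q i) (Q k) <= slope (Q i') (Q k).
  move=> k0; have [i hi h] := @argmax R (fun i => - slope (Q i) (Q k)) 0 k k0.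
  by exists i => // i' hi'; have := h i' hi'; rewrite lerN2.
have [hi|hi] := ltnP k.+1 n; last first.
  case: (posnP k) => [k0|/lo[i ik h]]; first by exists 0; split=> [i|j]; lia.
  exists (slope (Q i) (Q k) - 1); split=> [i' /h|j]; last lia.
  by apply: lt_le_trans; rewrite ltrBlDr ltrDl.
have [j hj hmax] := @argmax R (fun j => slope (Q k) (Q j)) k.+1 n hi.
case: (posnP k) => [k0|/lo[i ik h]].
  exists (slope (Q k) (Q j) + 1); split=> [i|j' hj']; first lia.
  by apply: le_lt_trans (hmax _ _) _; rewrite ?ltrDl //; lia.
exists ((slope (Q k) (Q j) + slope (Q i) (Q k)) / 2).
have lt := sPN i j ik ltac:(lia) ltac:(lia).
split=> [i' /h|j' hj']; first by apply: lt_le_trans; lra.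
by apply: le_lt_trans (hmax _ _) _; [lia|lra].
Qed.

(** A point on the upper boundary is not below any segment between two input points, and general
    position excludes lying on it. Conversely, a functional with its unique maximum at [P k] shows
    both extremality and membership in the upper boundary. *)
Lemma upper_hull_pointP (k : 'I_n) : upper_hull_point P (P k) <-> hull Q 0 n k.
Proof.
have kn : (k < n)%N by [].
split.
  case=> _ [_ hup]; split=> // i j /andP[_ ik] /andP[kj jn].
  have iN := ltn_trans ik kn.
  rewrite lt_neqAle nat_points_gp //=.
  have h1 := nat_points_xlt ik kn; have h2 := nat_points_xlt kj jn.
  (* The parameter at which the segment from [Q i] to [Q j] has the abscissa of [Q k]. *)
  pose t := ((Q k).1 - (Q i).1) / ((Q j).1 - (Q i).1).
  have hd : 0 < (Q j).1 - (Q i).1 by lra.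
  have ht : t * ((Q j).1 - (Q i).1) = (Q k).1 - (Q i).1 by rewrite divfK ?gt_eqF.
  have t01 : 0 <= t <= 1 by rewrite /t divr_ge0 ?ler_pdivrMr //=; lra.
  have := hup _ (segment_in_hull (Ordinal iN) (Ordinal jn) t01).
  rewrite /= -!nat_pointsE /= => /(_ _) h.
  have {h} : (1 - t) * (Q i).2 + t * (Q j).2 <= (Q k).2 by apply: h; lra.
  rewrite -(ler_pM2r hd) /orient => h.
  have e : ((1 - t) * (Q i).2 + t * (Q j).2) * ((Q j).1 - (Q i).1) =
     (Q i).2 * ((Q j).1 - (Q i).1) + ((Q k).1 - (Q i).1) * ((Q j).2 - (Q i).2).
    by rewrite -ht; ring.
  rewrite e in h; lra.
move=> /hull_support [m hm].
have hle (i : 'I_n) : height Q m i <= height Q m k.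
  by have [->//|/hm/ltW] := eqVneq i k.
have kin : in_hull P (P k).
  have := @segment_in_hull k k 0 ltac:(by rewrite lexx ler01).
  by rewrite !subr0 !mul1r !mul0r !addr0 -surjective_pairing.
have ek : (P k).2 - m * (P k).1 = height Q m k by rewrite /height nat_pointsE.
split; last first.
  split=> // r hr e; have := in_hull_le hle hr; rewrite e -ek; lra.
split=> // a b t ha hb /andP[t0 t1] e1 e2.
have la := in_hull_le hle ha; have lb := in_hull_le hle hb.
have e : (1 - t) * (a.2 - m * a.1) + t * (b.2 - m * b.1) = height Q m k.
  by rewrite -ek e1 e2; ring.
suff [ea eb] : a.2 - m * a.1 = height Q m k /\ b.2 - m * b.1 = height Q m k.
  by rewrite (in_hull_max hm ha ea) (in_hull_max hm hb eb).
move: (a.2 - _) (b.2 - _) (height Q m k) la lb e => A B H la lb e.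
have ta : 0 <= (1 - t) * (H - A) by apply: mulr_ge0; lra.
have tb : 0 <= t * (H - B) by apply: mulr_ge0; lra.
split; apply/eqP; rewrite eq_le ?la ?lb /= leNgt; apply/negP => lt.
- by have : 0 < (1 - t) * (H - A) by [apply: mulr_gt0; lra]; lra.
- by have : 0 < t * (H - B) by [apply: mulr_gt0; lra]; lra.
Qed.

End UpperHull.

(** * The program *)

Declare Scope prog_scope.
Delimit Scope prog_scope with prog.
Bind Scope prog_scope with expr.
Notation "a + b" := (Bin OpAdd a b) : prog_scope.
Notation "a - b" := (Bin OpSub a b) : prog_scope.
Notation "a * b" := (Bin OpMul a b) : prog_scope.
Notation "a / b" := (Bin OpDiv a b) : prog_scope.
Notation "a <= b" := (Bin OpLeq a b) : prog_scope.
Notation "a == b" := (Bin OpEq a b) : prog_scope.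
Notation "c1 ;; c2" := (Seq c1 c2) (at level 95, right associativity).
Coercion Cst : nat >-> expr.

(* Cells 0, 1, 2 initially hold the number of points, the number of processors
   and the rank of the processor.  [va] is the start of its own points, [vh] the
   hull size of its group, [vg] the size of the groups, [vs] the first processor
   of the pair of groups to be merged, [vl], [vr] and [vhl], [vhr] the starts and
   hull sizes of their points, [vx] and [vz] the ends of the bridge, [vW] a power
   of two above the number of points. *)
Notation vn := 0. Notation vp := 1. Notation vi := 2.
Notation vB := 3. Notation va := 4. Notation vj := 5. Notation vh := 6.
Notation vt := 7. Notation ve := 8.
Notation vX := 9. Notation vY := 10. Notation vU := 11. Notation vV := 20.
Notation vf := 12. Notation vW := 13. Notation vg := 14. Notation vs := 15.
Notation vl := 16. Notation vr := 17. Notation vhl := 18. Notation vhr := 19.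
Notation vx := 21. Notation vst := 22. Notation vz := 23. Notation vsu := 24.
Notation vok := 25. Notation vlo := 26. Notation vhi := 27. Notation vmid := 28.
Notation vk := 29.

Definition graham_test : cmd :=
  Assign vf 0 ;;
  When (2 <= Var vh) (
    Fetch vX (Var va + Var vh - 2) ;;
    Fetch vY (Var va + Var vh - 1) ;;
    Fetch vU (Var vj) ;;
    Turn vf vX vY vU).

Definition graham_pop : cmd := When (Var vf) (Assign vh (Var vh - 1)).

Definition graham_push : cmd :=
  When (Var vf == 0) (
    Fetch vX (Var va + Var vh) ;;
    Fetch vY (Var vj) ;;
    Store (Var va + Var vh) vY ;;
    Store (Var vj) vX ;;
    Assign vj (Var vj + 1) ;;
    Assign vh (Var vh + 1)).

Definition graham_loop : cmd :=
  While (Var vt) (fun n p => 2 * (n %/ p + 1)) (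
    Assign vt (Var vt - 1) ;;
    When (Var vj + 1 <= Var ve) (graham_test ;; graham_pop ;; graham_push)).

Definition width_loop : cmd :=
  While (Var vW <= Var vn) (fun n _ => bits n) (Assign vW (2 * Var vW)).

Definition setup : cmd :=
  Assign vB (Var vn / Var vp + 1) ;;
  Assign va (Var vi * Var vn / Var vp) ;;
  Assign ve ((Var vi + 1) * Var vn / Var vp) ;;
  Assign vj (Var va) ;;
  Assign vh 0 ;;
  Assign vt (2 * Var vB) ;;
  graham_loop ;;
  Assign vW 1 ;;
  width_loop ;;
  Assign vg 1.

(* Cell [va] is the first one of the processor's own points; a count replaces the
   point only until [unpost_count]. *)
Definition post_count : cmd := Fetch vV (Var va) ;; Store (Var va) vh.

(** A group without a partner keeps the sizes 0, for which the searches and reversals that follow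
    idle. *)
Definition fetch_counts : cmd :=
  Assign vs (Var vi / (2 * Var vg) * (2 * Var vg)) ;;
  Assign vl (Var vs * Var vn / Var vp) ;;
  Assign vr 0 ;;
  Assign vhl 0 ;;
  Assign vhr 0 ;;
  When (Var vs + Var vg + 1 <= Var vp) (
    Assign vr ((Var vs + Var vg) * Var vn / Var vp) ;;
    Fetch vhl (Var vl) ;;
    Fetch vhr (Var vr)).

Definition unpost_count : cmd := Store (Var va) vV.

(** Multiplication serves as conjunction: with [vok = 0] the search idles through all its rounds.
    The step takes the values [2 ^ bits n, ..., 2, 1], which makes [(bits n).+1] rounds. *)
Definition slope_search : cmd :=
  While (Var vsu) (fun n _ => (bits n).+1) (
    When (Var vok * (Var vz + Var vsu + 1 <= Var vhr)) (
      Fetch vU (Var vr + Var vz + Var vsu - 1) ;;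
      Fetch vV (Var vr + Var vz + Var vsu) ;;
      Steeper vf vX vY vU vV ;;
      When (Var vf) (Assign vz (Var vz + Var vsu))) ;;
    Assign vsu (Var vsu / 2)).

Definition left_probe : cmd :=
  Assign vok 0 ;;
  When (Var vx + Var vst + 1 <= Var vhl) (
    Fetch vX (Var vl + Var vx + Var vst - 1) ;;
    Fetch vY (Var vl + Var vx + Var vst) ;;
    Assign vok 1) ;;
  Assign vz 0 ;;
  Assign vsu (Var vW).

Definition left_update : cmd :=
  When (Var vok) (
    Fetch vV (Var vr + Var vz) ;;
    Turn vf vX vY vV ;;
    When (Var vf == 0) (Assign vx (Var vx + Var vst))) ;;
  Assign vst (Var vst / 2).

Definition left_search : cmd :=
  While (Var vst) (fun n _ => (bits n).+1) (left_probe ;; slope_search ;; left_update).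

Definition right_search : cmd :=
  While (Var vsu) (fun n _ => (bits n).+1) (
    When (Var vz + Var vsu + 1 <= Var vhr) (
      Fetch vX (Var vl + Var vx) ;;
      Fetch vU (Var vr + Var vz + Var vsu - 1) ;;
      Fetch vV (Var vr + Var vz + Var vsu) ;;
      Turn vf vX vU vV ;;
      When (Var vf) (Assign vz (Var vz + Var vsu))) ;;
    Assign vsu (Var vsu / 2)).

Definition find_bridge : cmd :=
  Assign vx 0 ;;
  Assign vst (Var vW) ;;
  left_search ;;
  Assign vz 0 ;;
  Assign vsu (Var vW) ;;
  right_search ;;
  Assign vlo 0 ;; Assign vhi 0 ;; Assign vmid 0 ;;
  When (1 <= Var vhr) (
    Assign vlo (Var vl + Var vx + 1) ;;
    Assign vhi (Var vr + Var vhr) ;;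
    Assign vmid (Var vlo + (Var vhr - Var vz)) ;;
    Assign vh (Var vx + 1 + (Var vhr - Var vz))).

Definition reverse_loop (hi : nat) : cmd :=
  While (Var vt) (fun n p => n %/ p + 1) (
    Assign vt (Var vt - 1) ;;
    When (Var vk + 1 <= (Var hi - Var vlo) / 2) (
      Fetch vX (Var vlo + Var vk) ;;
      Fetch vY (Var hi - 1 - Var vk) ;;
      Store (Var vlo + Var vk) vY ;;
      Store (Var hi - 1 - Var vk) vX) ;;
    Assign vk (Var vk + 1)).

(** The [q] processors of a pair own at most [q * B] points together, so [B] exchanges by each of
    them suffice. *)
Definition reverse (hi : nat) : cmd :=
  Assign vt (Var vB) ;;
  Assign vk ((Var vi - Var vs) * Var vB) ;;
  reverse_loop hi.

Definition merge_body : cmd :=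
  post_count ;; fetch_counts ;; unpost_count ;; find_bridge ;;
  reverse vhi ;; reverse vmid ;; Assign vg (2 * Var vg).

Definition merge_loop : cmd :=
  While (Var vg + 1 <= Var vp) (fun _ p => up_log 2 p) merge_body.

Definition hull_program : cmd := setup ;; merge_loop ;; Assign 0 (Var vh).

Import Order.TTheory.

(** * Correctness *)

Section Rules.
Variables (R : realType) (n p : nat) (rd wr : nat -> Prop).
Notation memory := (nat -> value R).

Lemma wp_seq c1 c2 (S Q : memory -> memory -> Prop) sh pr :
  wp n p rd wr c1 S sh pr ->
  (forall sh pr, S sh pr -> wp n p rd wr c2 Q sh pr) ->
  wp n p rd wr (Seq c1 c2) Q sh pr.
Proof. by move=> h1 h2 /=; apply: wp_mono h1. Qed.

Lemma wp_seqI c1 c2 (Q : memory -> memory -> Prop) sh pr :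
  wp n p rd wr c1 (wp n p rd wr c2 Q) sh pr -> wp n p rd wr (Seq c1 c2) Q sh pr.
Proof. by []. Qed.

Lemma wp_assign x e (Q : memory -> memory -> Prop) sh pr :
  safe n pr e -> Q sh (update pr (Some (x, Word (eval pr e)))) ->
  wp n p rd wr (Assign x e) Q sh pr.
Proof. by []. Qed.

Lemma wp_when e c (Q : memory -> memory -> Prop) sh pr :
  safe n pr e -> (eval pr e = 0 -> Q sh pr) ->
  (eval pr e <> 0 -> wp n p rd wr c Q sh pr) ->
  wp n p rd wr (When e c) Q sh pr.
Proof. by move=> hs h0 h1 /=; split=> //; case: eqP. Qed.

End Rules.

Fixpoint words (R : realType) (pr : nat -> value R) (l : seq (nat * nat)) : Prop :=
  if l is (x, w) :: l' then pr x = Word w /\ words pr l' else True.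

Definition same_off (R : realType) (s : seq nat) (pr pr' : nat -> value R) : Prop :=
  forall y, y \notin s -> pr' y = pr y.

Definition perm_range (a c : nat) (t : nat -> nat) : Prop :=
  (forall x, a <= x < c -> a <= t x < c) /\
  (forall x y, a <= x < c -> a <= y < c -> t x = t y -> x = y).

Lemma perm_range_comp a c t r :
  perm_range a c t -> perm_range a c r -> perm_range a c (t \o r).
Proof.
move=> [t1 t2] [r1 r2]; split=> [x hx|x y hx hy /=]; first by apply/t1/r1.
by move=> /(t2 _ _ (r1 _ hx) (r1 _ hy)); apply: r2.
Qed.

Lemma involution_perm_range a c r :
  (forall x, a <= x < c -> a <= r x < c) -> involutive r -> perm_range a c r.
Proof. by move=> h hr; split=> // x y _ _; apply: (can_inj hr). Qed.

(** Testing [v] first makes this agree with two successive stores at [u] and at [v]. They coincide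
    when the scan has discarded nothing yet. *)
Definition swap (u v x : nat) := if x == v then u else if x == u then v else x.

Lemma swapK u v : involutive (swap u v).
Proof.
move=> x; rewrite /swap.
case: (x =P v) => [->|/eqP xv]; first by rewrite eqxx; case: eqP.
by case: (x =P u) => [->|/eqP xu]; rewrite ?eqxx // (negbTE xv) (negbTE xu).
Qed.

(** Block boundaries are computed as [i * n / p], so the numbers occurring are at most quadratic in
    [n]. Of the eight factors [n.+1] granted by the word size, six pay for the constant 64. *)
Lemma max_word_ge n : 0 < n -> 64 * (n * n + n + 1) <= max_word n.
Proof.
move=> hn; rewrite /max_word /bits [8 * _]mulnC expnM.
have h : n.+1 <= 2 ^ (trunc_log 2 n).+1 by apply: trunc_log_ltn.
apply: (@leq_trans (n.+1 ^ 8)); last by rewrite leq_exp2r.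
have -> : n.+1 ^ 8 = n.+1 ^ 6 * (n.+1 * n.+1) by rewrite -[n.+1 * n.+1]/(n.+1 ^ 2) -expnD.
have h6 : 2 ^ 6 <= n.+1 ^ 6 by rewrite leq_exp2r.
by apply: leq_mul => //; lia.
Qed.


Ltac fits := by rewrite /=; repeat split; rewrite ?bool_lt_max_word //; lia.

(** * The Graham scan of one block, and the boundaries of the blocks *)

Section Correctness.
Variables (R : realType) (n p : nat) (P : 'I_n -> point R).
Hypothesis hp : 0 < p <= n.
Hypothesis P_sorted : presorted P.

Notation memory := (nat -> value R).
Notation Q := (nat_points P).
Notation B := (n %/ p + 1).

Let Qx := nat_points_xlt P_sorted.
Let Qg := nat_points_gp P_sorted.

Let hM : 64 * (n * n + n + 1) <= max_word n.
Proof. by apply: max_word_ge; lia. Qed.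

Definition layout (sh : memory) (a c : nat) (t : nat -> nat) : Prop :=
  perm_range a c t /\ forall x, a <= x < c -> sh x = Pt (Q (t x)).

Definition block (sh : memory) (a c h : nat) : Prop :=
  h <= c - a /\ exists2 t, layout sh a c t & chain Q a c (fun u => t (a + u)) h.

Lemma layout_swap sh sh' a c t u v : layout sh a c t -> a <= u < c -> a <= v < c ->
  (forall x, a <= x < c -> sh' x = sh (swap u v x)) ->
  layout sh' a c (t \o swap u v).
Proof.
move=> [ht hs] hu hv hsh.
have hr x : a <= x < c -> a <= swap u v x < c by rewrite /swap; do 2?case: ifP.
split; first by apply: perm_range_comp => //; apply: involution_perm_range (@swapK u v).
by move=> x hx; rewrite hsh // hs ?hr.
Qed.

Section Graham.
Variables (rd wr : nat -> Prop) (a e : nat).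
Hypothesis hae : a < e <= n.
Hypothesis hrd : forall x, a <= x < e -> rd x.
Hypothesis hwr : forall x, a <= x < e -> wr x.

(** [scan] refers to the next point [j], which is missing when [j = e]; there the finished [chain]
    replaces it. Unread points are still in place, so cell [j] holds point [j]. *)
Definition graham_state (sh : memory) (j h : nat) (t : nat -> nat) : Prop :=
  [/\ layout sh a e t, a <= j <= e, h <= j - a, (forall x, j <= x < e -> t x = x)
    & if j < e then scan Q a j (fun u => t (a + u)) h
      else chain Q a e (fun u => t (a + u)) h].

Lemma wp_graham_test sh pr j h t (S : memory -> memory -> Prop) :
  graham_state sh j h t -> j < e -> words pr [:: (va, a); (vj, j); (vh, h)] ->
  (forall pr' (f : bool), same_off [:: vf; vX; vY; vU] pr pr' -> pr' vf = Word f ->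
     (f -> exists2 h', h = h'.+2 & (0 < orient (Q (t (a + h'))) (Q (t (a + h'.+1))) (Q j))%R) ->
     (~~ f -> forall h', h = h'.+2 -> (orient (Q (t (a + h'))) (Q (t (a + h'.+1))) (Q j) <= 0)%R) ->
     S sh pr') ->
  wp n p rd wr graham_test S sh pr.
Proof.
move=> [[_ hl] haj hh hid hscan] hje [ea [ej [eh _]]] hS.
rewrite /= !(ea, ej, eh) /=; split; first lia.
split; first by fits.
case: (ltnP 1 h) => h2 /=; last first.
  apply: (hS _ false) => //=; last by move=> _ h' e1; lia.
  by move=> y; rewrite !inE !negb_or => /and4P[/negbTE-> _ _ _].
case: h eh hh hscan hS h2 => [|[|h]] // eh hh hscan hS _.
have -> : a + h.+2 - 2 = a + h by lia.
have -> : a + h.+2 - 1 = a + h.+1 by lia.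
split; [fits|lia|by apply: hrd; lia|].
split; [fits|lia|by apply: hrd; lia|].
split; [fits|lia|by apply: hrd; lia|].
rewrite !hl /= ?(hid j); [|lia..]; split=> //.
set f := (0 < _)%R.
apply: (hS _ f) => //=.
- by move=> y; rewrite !inE !negb_or => /and4P[/negbTE-> /negbTE-> /negbTE-> /negbTE->].
- by move=> hf; exists h.
- by move=> hf h' [<-]; rewrite leNgt.
Qed.

Lemma scan_pop_state sh j h t : graham_state sh j h.+2 t -> j < e ->
  (0 < orient (Q (t (a + h))) (Q (t (a + h.+1))) (Q j))%R -> graham_state sh j h.+1 t.
Proof.
move=> [hl haj hh hid]; rewrite /graham_state => + hje; rewrite hje => hs ho.
split=> //; first lia.
by apply: (scan_pop hs).
Qed.

Lemma scan_push_state sh sh' j h t : graham_state sh j h t -> j < e ->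
  (forall h', h = h'.+2 -> (orient (Q (t (a + h'))) (Q (t (a + h'.+1))) (Q j) <= 0)%R) ->
  (forall x, a <= x < e -> sh' x = sh (swap (a + h) j x)) ->
  graham_state sh' j.+1 h.+1 (t \o swap (a + h) j).
Proof.
move=> [hl haj hh hid]; rewrite /graham_state => + hje; rewrite hje => hs ho hsh.
have jn : j < n by lia.
split; [|lia|lia| |].
- by apply: layout_swap hsh => //; lia.
- by move=> x hx /=; rewrite /swap !ifF ?hid; lia.
have hc : chain Q a j.+1 (fun u => (t \o swap (a + h) j) (a + u)) h.+1.
  apply: (scan_push Qx Qg _ jn hs) => //=; first lia.
    by move=> u hu; rewrite /swap !ifF //; lia.
  by rewrite /swap eqxx hid; case: eqP; lia.
case: ltnP => he; first exact: chain_scan.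
by have -> : e = j.+1 by lia.
Qed.

Lemma wp_graham_loop sh pr (S : memory -> memory -> Prop) :
  e - a <= B -> (forall x, a <= x < e -> sh x = Pt (Q x)) ->
  words pr [:: (va, a); (ve, e); (vj, a); (vh, 0); (vt, 2 * B)] ->
  (forall sh' pr' h, block sh' a e h -> pr' vh = Word h ->
     same_off [:: vj; vh; vt; vX; vY; vU; vf] pr pr' -> S sh' pr') ->
  wp n p rd wr graham_loop S sh pr.
Proof.
move=> hB hsh [ea [ee [ej [eh [et _]]]]] hS.
(* A push and a pop both raise [2 * (j - a) - h] by one, so it equals the number [k] of steps while
   points are left. At [k = 2 * B] this would force [j - a >= B >= e - a], so no points are left. *)
pose I k sh' pr' := same_off [:: vj; vh; vt; vX; vY; vU; vf] pr pr' /\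
  exists j h t, [/\ words pr' [:: (vj, j); (vh, h); (vt, 2 * B - k)],
    graham_state sh' j h t & j < e -> 2 * (j - a) = k + h].
have hBn : n %/ p <= n by apply: leq_div.
apply: (@wp_while _ _ _ _ _ I).
- split=> //; exists a, 0, id; split; [by rewrite /= ej eh et subn0| |lia].
  split=> //; [lia|rewrite ifT; last lia].
  apply: chain_scan; split=> // k; by case; lia.
- move=> k sh1 pr1 hk [hoff [j [h [t [[ej1 [eh1 [et1 _]]] hg hpot]]]]].
  have ea1 : pr1 va = Word a by rewrite hoff.
  have ee1 : pr1 ve = Word e by rewrite hoff.
  split; [by rewrite /= et1|by rewrite /= et1 /=; lia|].
  have [_ haj hh _ _] := hg.
  apply: (wp_seq (S := fun sh' pr' => sh' = sh1 /\ pr' = update pr1 (Some (vt, Word (2 * B - k.+1))))).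
    rewrite /= et1 /=; split; first by split=> //; lia.
    by have -> : 2 * B - k - 1 = 2 * B - k.+1 by [lia].
  move=> _ _ [-> ->]; apply: wp_when.
  + by rewrite /= ej1 ee1; fits.
  + rewrite /= ej1 ee1 /= => he; have {he} he : j = e by move: he; case: leqP; lia.
    split; first by move=> y hy /=; case: eqP hy => [->//|_ hy]; apply: hoff.
    exists j, h, t; split=> /=; [by rewrite ej1 eh1|by []|lia].
  move=> he; rewrite /= ej1 ee1 /= in he.
  have {he} he : j < e by move: he; case: leqP; lia.
  have hp1 := hpot he.
  apply: wp_seqI; apply: (wp_graham_test hg he); first by rewrite /= ea1 ej1 eh1.
  move=> pr2 f off2 ef2 hf1 hf2.
  have ea2 : pr2 va = Word a by rewrite off2.
  have ee2 : pr2 ve = Word e by rewrite off2.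
  have ej2 : pr2 vj = Word j by rewrite off2.
  have eh2 : pr2 vh = Word h by rewrite off2.
  have et2 : pr2 vt = Word (2 * B - k.+1) by rewrite off2.
  have hoff2 : same_off [:: vj; vh; vt; vX; vY; vU; vf] pr pr2.
    move=> y hy; rewrite off2; last by move: hy; rewrite !inE !negb_or => /and5P[_ _ _ -> /and3P[-> -> ->]].
    by rewrite /=; case: eqP hy => [->//|_]; apply: hoff.
  case: f ef2 hf1 hf2 => ef2 hf1 hf2.
    have [h' eh' ho] := hf1 isT; subst h.
    rewrite /= ef2 eh2 /= ?ef2 /=; split=> //; split; first by fits.
    split; first by fits.
    split.
      by move=> y hy /=; case: eqP hy => [->//|_ hy]; apply: hoff2.
    exists j, h'.+1, t; split=> /=; [by rewrite ej2 et2 subn1| |lia].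
    exact: scan_pop_state ho.
  rewrite /= ef2 /= ?ef2 /=; split=> //; split; first by fits.
  rewrite !(ea2, ej2, eh2) /= ?(ea2, ej2, eh2) /=.
  split; [by fits|lia|by apply: hrd; lia|].
  split; [by fits|lia|by apply: hrd; lia|].
  split; [by fits|lia|by apply: hwr; lia|].
  split; [by fits|lia|by apply: hwr; lia|].
  split; first by fits.
  split; first by fits.
  split.
    move=> y; rewrite !inE !negb_or => /and5P[n1 n2 n3 n4 /and3P[n5 n6 n7]].
    rewrite (negbTE n1) (negbTE n2) (negbTE n4) (negbTE n5); apply: hoff2.
    by rewrite !inE !negb_or n1 n2 n3 n4 n5 n6 n7.
  exists j.+1, h.+1, (t \o swap (a + h) j); split=> /=; [by rewrite et2 !addn1| |lia].
  apply: (scan_push_state hg) => //; first exact: hf2.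
  by move=> x hx; rewrite /swap; case: eqP => // _; case: eqP.
- move=> sh1 pr1 [hoff [j [h [t [[ej1 [eh1 [et1 _]]] hg hpot]]]]].
  rewrite /= et1 /=; split=> //; first lia.
  have [hl haj hh hid] := hg; case: ltnP => he hs.
    by have := hpot he; lia.
  by apply: (hS _ _ h) => //; split; [lia|exists t].
Qed.

End Graham.

Definition bd x := x * n %/ p.

(** Since [p <= n], no block is empty; so every processor has a first cell of its own in which to
    post a count. *)
Lemma bd_step x : bd x < bd x.+1 <= bd x + B.
Proof.
have /andP[p0 pn] := hp; rewrite /bd mulSn addnC divnD //.
have : 0 < n %/ p by rewrite divn_gt0.
by case: (p <= _) => /=; lia.
Qed.

Lemma bd_lt x y : x < y -> bd x < bd y.
Proof.
move=> xy; rewrite -(subnKC xy); elim: (y - x.+1) => [|d IH].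
  by rewrite addn0; case/andP: (bd_step x).
by apply: ltn_trans IH _; rewrite addnS; case/andP: (bd_step (x.+1 + d)).
Qed.

Lemma bd_le x y : x <= y -> bd x <= bd y.
Proof. by rewrite leq_eqVlt => /orP[/eqP->//|/bd_lt/ltnW]. Qed.

Lemma bd_inj x y : bd x = bd y -> x = y.
Proof. by move=> e; case: (ltngtP x y) => // /bd_lt; rewrite e ltnn. Qed.

Lemma bd_p : bd p = n.
Proof. by rewrite /bd mulKn //; lia. Qed.

Lemma bd_le_n x : x <= p -> bd x <= n.
Proof. by move=> h; rewrite -bd_p; apply: bd_le. Qed.

Lemma bd_lt_n x : x < p -> bd x < n.
Proof. by move=> h; rewrite -bd_p; apply: bd_lt. Qed.

Lemma bd_len x y : x <= y -> bd y - bd x <= (y - x) * B.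
Proof.
move=> xy; rewrite -{1}(subnKC xy); elim: (y - x) => [|d IH]; first by rewrite addn0 subnn.
by rewrite addnS [d.+1 * _]mulSn; have := bd_step (x + d); lia.
Qed.

Lemma bits_gt : n < 2 ^ bits n.
Proof. by apply: trunc_log_ltn; lia. Qed.

Lemma exp_le_bits k : k < bits n -> 2 ^ k <= n.
Proof.
move=> hk; apply: leq_trans (_ : 2 ^ trunc_log 2 n <= n); first by rewrite leq_exp2l.
by apply: trunc_logP => //; lia.
Qed.

Lemma bits_le : 2 ^ bits n <= 2 * n.
Proof. by rewrite /bits expnS leq_mul2l /= trunc_logP //; lia. Qed.

Lemma wp_width_loop (rd wr : nat -> Prop) sh pr (S : memory -> memory -> Prop) :
  words pr [:: (vn, n); (vW, 1)] ->
  (forall pr', same_off [:: vW] pr pr' -> pr' vW = Word (2 ^ bits n) -> S sh pr') ->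
  wp n p rd wr width_loop S sh pr.
Proof.
move=> [en [eW _]] hS.
pose I k sh' pr' := [/\ sh' = sh, same_off [:: vW] pr pr' & pr' vW = Word (2 ^ k)].
have b1 := bits_gt; have b2 := bits_le.
have en1 pr1 : same_off [:: vW] pr pr1 -> pr1 vn = Word n by move=> ->.
apply: (@wp_while _ _ _ _ _ I) => [|k sh1 pr1 hk [-> hoff e1]|sh1 pr1 [-> hoff e1]].
- by split.
- have h := exp_le_bits hk; rewrite /= e1 (en1 _ hoff) /= h.
  split=> //; first by fits.
  split; first by fits.
  split=> //=; last by rewrite expnS.
  by move=> y hy /=; case: eqP hy => [->//|_]; apply: hoff.
- rewrite /= e1 (en1 _ hoff) /= (_ : (2 ^ bits n <= n) = false); last lia.
  split=> //; last exact: hS.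
  by fits.
Qed.

Lemma wp_setup (rd wr : nat -> Prop) i sh pr (S : memory -> memory -> Prop) :
  i < p -> words pr [:: (vn, n); (vp, p); (vi, i)] ->
  (forall x, bd i <= x < bd i.+1 -> rd x /\ wr x) ->
  (forall x, x < n -> sh x = Pt (Q x)) ->
  (forall sh' pr' h, block sh' (bd i) (bd i.+1) h ->
    words pr' [:: (vn, n); (vp, p); (vi, i); (vB, B); (va, bd i); (vh, h);
                  (vW, 2 ^ bits n); (vg, 1)] -> S sh' pr') ->
  wp n p rd wr setup S sh pr.
Proof.
move=> ip [en [epp [ei _]]] hrw hsh hS.
have p0 : p != 0 by lia.
have hin : i * n <= n * n by rewrite leq_mul2r; apply/orP; right; lia.
have hin1 : (i + 1) * n <= n * n by rewrite leq_mul2r; apply/orP; right; lia.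
have hb1 : bd i <= n by apply: bd_le_n; lia.
have hb2 : bd (i + 1) <= n by apply: bd_le_n; lia.
have hBn : n %/ p <= n by apply: leq_div.
have hs := bd_step i.
rewrite /= !(en, epp, ei) /= -/(bd i) -/(bd (i + 1)).
do 6!(split; first by fits).
rewrite addn1 in hb2 *.
apply: (@wp_graham_loop rd wr (bd i) (bd i.+1)).
- by rewrite hb2; case/andP: hs => ->.
- by move=> x /hrw[].
- by move=> x /hrw[].
- by lia.
- by move=> x hx; apply: hsh; lia.
- by [].
move=> sh1 pr1 h hblk eh1 off1; rewrite /=; split; first by fits.
apply: (@wp_width_loop rd wr); first by rewrite /= off1.
move=> pr2 off2 eW2; rewrite /=; split; first by fits.
apply: (hS _ _ h) => //; do !split=> //=; by rewrite off2 //= off1.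
Qed.

End Correctness.

(** * The binary searches for the common tangent *)

Section Search.
Variables (R : realType) (n p : nat).
Hypothesis n0 : 0 < n.
Notation memory := (nat -> value R).

Let hM : 64 * (n * n + n + 1) <= max_word n.
Proof. exact: max_word_ge. Qed.

(** The step width after [j] rounds; rounding down yields the 0 that ends the loops. *)
Definition halving j := 2 ^ bits n %/ 2 ^ j.

Lemma halvingE j : j <= bits n -> halving j = 2 ^ (bits n - j).
Proof. by move=> hj; rewrite /halving -expnB. Qed.

Lemma halving0 : halving (bits n).+1 = 0.
Proof. by rewrite /halving divn_small // ltn_exp2l. Qed.

Lemma halvingS j : halving j %/ 2 = halving j.+1.
Proof. by rewrite /halving -divnMA expnSr. Qed.

Lemma halving_le j : halving j <= 2 * n.
Proof.
apply: leq_trans (leq_div _ _) _.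
by rewrite /bits expnS leq_mul2l /= trunc_logP.
Qed.

Variables (rd wr : nat -> Prop) (sh : memory) (A : nat -> point R) (a b h1 h2 : nat).
Hypothesis rd_all : forall x, x < n -> rd x.
Hypothesis shA : forall x, x < n -> sh x = Pt (A x).
Hypothesis bound1 : a + h1 <= n.
Hypothesis bound2 : b + h2 <= n.
Hypothesis distinct1 : forall u, u.+1 < h1 -> (A (a + u)).1 != (A (a + u.+1)).1.
Hypothesis distinct2 : forall u, u.+1 < h2 -> (A (b + u)).1 != (A (b + u.+1)).1.

Notation K := (bits n).+1.

Definition slope_test (q q' : point R) (v : nat) : bool :=
  (slope q q' < slope (A (b + v.-1)) (A (b + v)))%R.

Lemma wp_slope_search pr (ok : bool) q q' (S : memory -> memory -> Prop) :
  words pr [:: (vr, b); (vhr, h2); (vok, nat_of_bool ok); (vz, 0); (vsu, 2 ^ bits n)] ->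
  (ok -> [/\ pr vX = Pt q, pr vY = Pt q' & q.1 != q'.1]) ->
  (forall pr', same_off [:: vz; vsu; vU; vV; vf] pr pr' ->
     pr' vz = Word (bsearch (slope_test q q') (ok * h2) K 0) -> S sh pr') ->
  wp n p rd wr slope_search S sh pr.
Proof.
move=> [eb [eh [eo [ez [es _]]]]] hq hS.
(* An idle search is one over an empty range. The invariant below says that the remaining rounds,
   started at the current [z], lead to the final result; monotonicity of the test plays its part
   only later, through [bsearchP]. *)
pose N := ok * h2; pose f := bsearch (slope_test q q') N.
pose I j sh' pr' := [/\ sh' = sh, same_off [:: vz; vsu; vU; vV; vf] pr pr' &
  exists z, [/\ words pr' [:: (vz, z); (vsu, halving j)], z <= N & f (K - j) z = f K 0]].
have hN : N <= h2 by rewrite /N; case: (ok); lia.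
apply: (@wp_while _ _ _ _ _ I).
- split=> //; exists 0; split=> //; by rewrite /= ez es halvingE // subn0.
- move=> j _ pr1 hj [-> off [z [[ez1 [es1 _]] hz hf]]].
  have hl := halving_le j.
  have eh1 : halving j = 2 ^ (bits n - j) by apply: halvingE; lia.
  have e0 : 0 < halving j by rewrite eh1 expn_gt0.
  split; [by rewrite /= es1|by rewrite /= es1 /=; lia|].
  have [eb1 ehr1 eo1] : [/\ pr1 vr = Word b, pr1 vhr = Word h2 & pr1 vok = Word ok].
    by rewrite !off.
  apply: (wp_seq (S := fun sh' pr' => [/\ sh' = sh, same_off [:: vz; vsu; vU; vV; vf] pr pr' &
    exists z, [/\ words pr' [:: (vz, z); (vsu, halving j)], z <= N & f (K - j.+1) z = f K 0]])); last first.
    move=> _ pr2 [-> off2 [z2 [[ez2 [es2 _]] hz2 hf2]]]; rewrite /= es2 /=.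
    split; first by fits.
    split=> //; first by move=> y hy; case: eqP hy => [->//|_]; apply: off2.
    by exists z2; split=> //=; rewrite ez2 halvingS.
  have ek : K - j = (K - j.+1).+1 by lia.
  have estep : 2 ^ (K - j.+1) = halving j by rewrite eh1; congr (2 ^ _); lia.
  rewrite ek /f /= estep -/f in hf.
  have hcond : (ok * (z + halving j + 1 <= h2) != 0) = (z + halving j < N).
    rewrite /N; case: (ok); rewrite ?mul0n ?mul1n //; by rewrite addn1; case: (_ <= _).
  apply: wp_when; rewrite /= ?(eo1, ez1, es1, ehr1) /=.
  + by have := hcond; case: (ok) => /= _; fits.
  + move=> h0; rewrite h0 in hcond; split=> //; exists z; split=> //.
    by move: hf; rewrite -hcond.
  move=> /eqP; rewrite hcond => hlt.
  rewrite ?(eb1, ez1, es1) /=.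
  have okT : ok by move: hlt; rewrite /N; case: (ok).
  have [ex ey hxy] := hq okT.
  have eN : N = h2 by rewrite /N okT mul1n.
  split; [by fits|lia|by apply: rd_all; lia|].
  rewrite ?(eb1, ez1, es1) /=.
  split; [by fits|lia|by apply: rd_all; lia|].
  have ex1 : pr1 vX = Pt q by rewrite off.
  have ey1 : pr1 vY = Pt q' by rewrite off.
  have e1 : b + z + halving j - 1 = b + (z + halving j).-1 by lia.
  have e2 : b + z + halving j = b + (z + halving j) by lia.
  rewrite ex1 ey1 e1 e2 !shA /=; [|lia|lia].
  split=> //.
    by have := @distinct2 (z + halving j).-1; rewrite prednK; [apply|]; lia.
  rewrite -/(slope_test q q' _); split=> //.
  rewrite hlt /= in hf.
  case ht: (slope_test q q' _); rewrite ht /= in hf *.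
    rewrite ?(ez1, es1) /=; split; first by fits.
    split=> //.
      move=> y; rewrite !inE !negb_or => /and5P[n1 n2 n3 n4 n5].
      rewrite (negbTE n1) (negbTE n3) (negbTE n4) (negbTE n5); apply: off.
      by rewrite !inE !negb_or n1 n2 n3 n4 n5.
    by exists (z + halving j); split=> //=; lia.
  split=> //.
    move=> y; rewrite !inE !negb_or => /and5P[n1 n2 n3 n4 n5].
    rewrite (negbTE n3) (negbTE n4) (negbTE n5); apply: off.
    by rewrite !inE !negb_or n1 n2 n3 n4 n5.
  by exists z; split=> //=; rewrite ez1 es1.
- move=> _ pr1 [-> off [z [[ez1 [es1 _]] hz hf]]].
  rewrite /= es1 /= halving0; split=> //; apply: hS => //.
  by rewrite ez1 -/N -/(f K 0) -hf subnn.
Qed.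


Lemma bsearch_lt (q : nat -> bool) N k x : x < N -> bsearch q N k x < N.
Proof. by elim: k x => //= k IH x hx; apply: IH; case: ifP => // /andP[]. Qed.

Definition slope_max u := bsearch (slope_test (A (a + u.-1)) (A (a + u))) h2 K 0.

Definition left_test u : bool :=
  ~~ (0 < orient (A (a + u.-1)) (A (a + u)) (A (b + slope_max u)))%R.

Definition bridge_left := bsearch left_test h1 K 0.

Hypothesis nonempty : 0 < h1 -> 0 < h2.

Lemma wp_left_search pr (S : memory -> memory -> Prop) :
  words pr [:: (vW, 2 ^ bits n); (vl, a); (vr, b); (vhl, h1); (vhr, h2);
               (vx, 0); (vst, 2 ^ bits n)] ->
  (forall pr', same_off [:: vx; vst; vok; vX; vY; vz; vsu; vU; vV; vf] pr pr' ->
     pr' vx = Word bridge_left -> S sh pr') ->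
  wp n p rd wr left_search S sh pr.
Proof.
move=> [eW [ea [eb [eh1 [eh2 [ex [est _]]]]]]] hS.
pose mods := [:: vx; vst; vok; vX; vY; vz; vsu; vU; vV; vf].
pose f := bsearch left_test h1.
pose I j sh' pr' := [/\ sh' = sh, same_off mods pr pr' &
  exists x, [/\ words pr' [:: (vx, x); (vst, halving j)], x <= h1 & f (K - j) x = f K 0]].
have offE pr1 : same_off mods pr pr1 ->
    words pr1 [:: (vW, 2 ^ bits n); (vl, a); (vr, b); (vhl, h1); (vhr, h2)].
  by move=> off; rewrite /= !off.
have hW : 2 ^ bits n <= 2 * n by have := halving_le 0; rewrite halvingE // subn0.
apply: (@wp_while _ _ _ _ _ I).
- split=> //; exists 0; split=> //; by rewrite /= ex est halvingE // subn0.
- move=> j _ pr1 hj [-> off [x [[ex1 [es1 _]] hx hf]]].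
  have hl := halving_le j.
  have eh : halving j = 2 ^ (bits n - j) by apply: halvingE; lia.
  have e0 : 0 < halving j by rewrite eh expn_gt0.
  split; [by rewrite /= es1|by rewrite /= es1 /=; lia|].
  have [eW1 [ea1 [eb1 [eh11 [eh21 _]]]]] := offE _ off.
  have ek : K - j = (K - j.+1).+1 by lia.
  have estep : 2 ^ (K - j.+1) = halving j by rewrite eh; congr (2 ^ _); lia.
  rewrite ek /f /= estep -/f in hf.
  pose u := x + halving j; pose ok := u < h1.
  have hcond : (x + halving j + 1 <= h1) = ok by rewrite addn1.
  pose S1 sh' pr' := [/\ sh' = sh, same_off mods pr pr',
    words pr' [:: (vx, x); (vst, halving j); (vok, nat_of_bool ok); (vz, 0); (vsu, 2 ^ bits n)] &
    ok -> pr' vX = Pt (A (a + u.-1)) /\ pr' vY = Pt (A (a + u))].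
  apply: (wp_seq (S := S1)).
    have fr (pr2 : memory) : same_off mods pr1 pr2 -> same_off mods pr pr2.
      by move=> off2 y hy; rewrite off2 // off.
    rewrite /= ?(ex1, es1, eh11, ea1) /= hcond -/u.
    split; first by fits.
    split; first by fits.
    case hok: ok => /=; last first.
      rewrite eW1 /=; split; first by fits.
      split; first by fits.
      split=> //; last by rewrite hok.
        by apply: fr => y; rewrite !inE !negb_or => /and5P[_ _ /negbTE-> _ /and5P[_ /negbTE-> /negbTE-> _ _]].
      by rewrite /= ex1 es1 hok.
    have hu : u < h1 by [].
    have e1 : a + x + halving j - 1 = a + u.-1 by rewrite /u; lia.
    have e2 : a + x + halving j = a + u by rewrite /u; lia.
    rewrite ?(ex1, es1, eh11, ea1) /= e1 e2.
    split; [by fits|lia|by apply: rd_all; lia|].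
    split; [by fits|lia|by apply: rd_all; lia|].
    split; first by fits.
    split; first by fits.
    rewrite eW1; split=> //.
    split; [by []| | |].
    - by apply: fr => y; rewrite !inE !negb_or => /and5P[_ _ /negbTE-> /negbTE-> /and5P[/negbTE-> /negbTE-> /negbTE-> _ _]].
    - by rewrite /= ex1 es1 hok.
    - by rewrite /= !shA //; lia.
  move=> _ pr2 [-> off2 [ex2 [es2 [eo2 [ez2 [esu2 _]]]]] hXY].
  have [eW2 [ea2 [eb2 [eh12 [eh22 _]]]]] := offE _ off2.
  apply: wp_seqI; apply: (wp_slope_search (q := A (a + u.-1)) (q' := A (a + u)) (ok := ok)).
  - by [].
  - move=> hok; have [-> ->] := hXY hok; split=> //.
    by have := @distinct1 u.-1; rewrite prednK; [apply|]; rewrite /u; lia.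
  move=> pr3 off3 ez3.
  have fr pr' : same_off [:: vx; vst; vV; vf] pr3 pr' -> same_off mods pr pr'.
    move=> off4 y hy; rewrite off4 ?off3 ?off2 //; move: hy; rewrite !inE !negb_or.
      by move=> /and5P[_ _ _ _ /and5P[_ -> -> -> /andP[-> ->]]].
    by move=> /and5P[-> -> _ _ /and5P[_ _ _ _ /andP[-> ->]]].
  have eb3 : pr3 vr = Word b by rewrite off3.
  have ex3 : pr3 vx = Word x by rewrite off3.
  have es3 : pr3 vst = Word (halving j) by rewrite off3.
  have eo3 : pr3 vok = Word ok by rewrite off3.
  rewrite /= eo3 /=; split=> //.
  move: hf; rewrite -/u; case hok: ok => /= hf; last first.
    move: hok; rewrite /ok => hok; rewrite hok /= in hf.
    rewrite es3 /=; split; first by fits.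
    split=> //; last by exists x; split=> //=; rewrite ex3 halvingS.
    by apply: fr => y; rewrite !inE !negb_or => /and4P[_ /negbTE-> _ _].
  have hu : u < h1 by [].
  have [eX3 eY3] : pr3 vX = Pt (A (a + u.-1)) /\ pr3 vY = Pt (A (a + u)).
    by rewrite !off3 //; apply: hXY.
  rewrite hok mul1n in ez3.
  have ez : pr3 vz = Word (slope_max u) by [].
  have hz : slope_max u < h2 by apply: bsearch_lt; apply: nonempty; lia.
  rewrite eb3 ez /=; split; [by fits|lia|by apply: rd_all; lia|].
  rewrite eX3 eY3 shA /=; last lia.
  split=> //; split; first by fits.
  rewrite hu /= /left_test in hf.
  move: hf; case: (0 < _)%R => /= hf.
    rewrite es3 /=; split; first by fits.
    split=> //; last by exists x; split=> //=; rewrite ex3 halvingS.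
    by apply: fr => y; rewrite !inE !negb_or => /and4P[_ /negbTE-> /negbTE-> /negbTE->].
  rewrite ex3 es3 /=; split; first by fits.
  split; first by fits.
  split=> //; last by exists u; split=> //=; [rewrite halvingS|lia].
  by apply: fr => y; rewrite !inE !negb_or => /and4P[/negbTE-> /negbTE-> /negbTE-> /negbTE->].
- move=> _ pr1 [-> off [x [[ex1 [es1 _]] hx hf]]].
  rewrite /= es1 /= halving0; split=> //; apply: hS => //.
  by rewrite ex1 /bridge_left -/(f K 0) -hf subnn.
Qed.

Definition right_test x v : bool :=
  (0 < orient (A (a + x)) (A (b + v.-1)) (A (b + v)))%R.

Lemma wp_right_search pr x (S : memory -> memory -> Prop) :
  (0 < h2 -> x < h1) ->
  words pr [:: (vl, a); (vr, b); (vhr, h2); (vx, x); (vz, 0); (vsu, 2 ^ bits n)] ->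
  (forall pr', same_off [:: vz; vsu; vX; vU; vV; vf] pr pr' ->
     pr' vz = Word (bsearch (right_test x) h2 K 0) -> S sh pr') ->
  wp n p rd wr right_search S sh pr.
Proof.
move=> hx [ea [eb [eh [ex [ez [es _]]]]]] hS.
pose mods := [:: vz; vsu; vX; vU; vV; vf].
pose f := bsearch (right_test x) h2.
pose I j sh' pr' := [/\ sh' = sh, same_off mods pr pr' &
  exists z, [/\ words pr' [:: (vz, z); (vsu, halving j)], z <= h2 & f (K - j) z = f K 0]].
apply: (@wp_while _ _ _ _ _ I).
- split=> //; exists 0; split=> //; by rewrite /= ez es halvingE // subn0.
- move=> j _ pr1 hj [-> off [z [[ez1 [es1 _]] hz hf]]].
  have hl := halving_le j.
  have eh1 : halving j = 2 ^ (bits n - j) by apply: halvingE; lia.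
  have e0 : 0 < halving j by rewrite eh1 expn_gt0.
  split; [by rewrite /= es1|by rewrite /= es1 /=; lia|].
  have ea1 : pr1 vl = Word a by rewrite off.
  have eb1 : pr1 vr = Word b by rewrite off.
  have ehr1 : pr1 vhr = Word h2 by rewrite off.
  have ex1 : pr1 vx = Word x by rewrite off.
  have fr pr' : same_off mods pr1 pr' -> same_off mods pr pr'.
    by move=> off2 y hy; rewrite off2 // off.
  have ek : K - j = (K - j.+1).+1 by lia.
  have estep : 2 ^ (K - j.+1) = halving j by rewrite eh1; congr (2 ^ _); lia.
  rewrite ek /f /= estep -/f in hf.
  rewrite /= ?(ez1, es1, ehr1) /= addn1; split; first by fits.
  move: hf; case: ltnP => hlt /= hf; last first.
    rewrite ?es1 /=; split; first by fits.
    split=> //; last by exists z; split=> //=; rewrite ?ez1 ?halvingS.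
    by apply: fr => y; rewrite !inE !negb_or => /andP[_ /andP[/negbTE-> _]].
  have xh : x < h1 by apply: hx; lia.
  rewrite ?(ea1, eb1, ez1, es1, ex1) /= ?(eb1, ez1, es1) /=.
  split; [by fits|lia|by apply: rd_all; lia|].
  split; [by fits|lia|by apply: rd_all; lia|].
  split; [by fits|lia|by apply: rd_all; lia|].
  have e1 : b + z + halving j - 1 = b + (z + halving j).-1 by lia.
  have e2 : b + z + halving j = b + (z + halving j) by lia.
  rewrite e1 e2 !shA /=; [|lia|lia|lia].
  split=> //; rewrite -/(right_test x _); split=> //.
  move: hf; case: (right_test x _) => /= hf.
    rewrite ?(ez1, es1) /=; split; first by fits.
    split; first by fits.
    split=> //.
      apply: fr => y; rewrite !inE !negb_or.
      by move=> /and5P[/negbTE-> /negbTE-> /negbTE-> /negbTE-> /andP[/negbTE-> /negbTE->]].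
    by exists (z + halving j); split=> //=; [rewrite ?halvingS|lia].
  rewrite ?(ez1, es1) /=; split; first by fits.
  split=> //.
    apply: fr => y; rewrite !inE !negb_or.
    by move=> /and5P[_ /negbTE-> /negbTE-> /negbTE-> /andP[/negbTE-> /negbTE->]].
  by exists z; split=> //=; rewrite ?ez1 ?halvingS.
- move=> _ pr1 [-> off [z [[ez1 [es1 _]] hz hf]]].
  rewrite /= es1 /= halving0; split=> //; apply: hS => //.
  by rewrite ez1 -/(f K 0) -hf subnn.
Qed.

Definition bridge_right := bsearch (right_test bridge_left) h2 K 0.

Lemma wp_find_bridge pr (S : memory -> memory -> Prop) :
  (0 < h2 -> 0 < h1) ->
  words pr [:: (vW, 2 ^ bits n); (vl, a); (vr, b); (vhl, h1); (vhr, h2)] ->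
  (forall pr', same_off [:: vx; vst; vok; vX; vY; vz; vsu; vU; vV; vf; vlo; vhi; vmid; vh] pr pr' ->
     (0 < h2 -> words pr' [:: (vlo, a + bridge_left + 1); (vhi, b + h2);
        (vmid, a + bridge_left + 1 + (h2 - bridge_right));
        (vh, bridge_left + 1 + (h2 - bridge_right))]) ->
     (h2 = 0 -> words pr' [:: (vlo, 0); (vhi, 0); (vmid, 0)] /\ pr' vh = pr vh) ->
     S sh pr') ->
  wp n p rd wr find_bridge S sh pr.
Proof.
move=> h21 [eW [ea [eb [eh1 [eh2 _]]]]] hS.
have hW : 2 ^ bits n <= 2 * n by have := halving_le 0; rewrite halvingE // subn0.
apply: wp_seqI; apply: wp_assign; first by fits.
apply: wp_seqI; apply: wp_assign; first by rewrite /= eW.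
apply: wp_seqI; apply: wp_left_search; first by rewrite /= eW.
move=> pr1 off1 ex1.
have eW1 : pr1 vW = Word (2 ^ bits n) by rewrite off1.
have ea1 : pr1 vl = Word a by rewrite off1.
have eb1 : pr1 vr = Word b by rewrite off1.
have eh11 : pr1 vhl = Word h1 by rewrite off1.
have eh21 : pr1 vhr = Word h2 by rewrite off1.
apply: wp_seqI; apply: wp_assign; first by fits.
apply: wp_seqI; apply: wp_assign; first by rewrite /= eW1.
have hx : 0 < h2 -> bridge_left < h1 by move=> /h21 h; apply: bsearch_lt.
apply: wp_seqI; apply: (wp_right_search (x := bridge_left)) => //; first by rewrite /= eW1.
move=> pr2 off2 ez2; rewrite -/bridge_right in ez2.
have ex2 : pr2 vx = Word bridge_left by rewrite off2.
have ea2 : pr2 vl = Word a by rewrite off2.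
have eb2 : pr2 vr = Word b by rewrite off2.
have eh22 : pr2 vhr = Word h2 by rewrite off2.
rewrite /= eh22 /=; do 4!(split; first by fits).
have fr pr' : same_off [:: vlo; vhi; vmid; vh] pr2 pr' ->
    same_off [:: vx; vst; vok; vX; vY; vz; vsu; vU; vV; vf; vlo; vhi; vmid; vh] pr pr'.
  move=> off3 y; rewrite !inE !negb_or.
  move=> /and5P[n1 n2 n3 n4 /and5P[n5 n6 n7 n8 /and5P[n9 n10 n11 n12 /andP[n13 n14]]]].
  rewrite off3; last by rewrite !inE !negb_or n11 n12 n13.
  rewrite off2 /=; last by rewrite !inE !negb_or n4 n6 n7 n8 n9.
  rewrite (negbTE n6) (negbTE n7) off1 /=; last by rewrite !inE !negb_or n1 n2 n3 n4 n5 n6 n7 n8 n9.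
  by rewrite (negbTE n1) (negbTE n2).
case: (posnP h2) => h20 /=.
  apply: hS => [|h|_]; [apply: fr|by rewrite h20 in h|split=> //=].
    by move=> y; rewrite !inE !negb_or => /and4P[/negbTE-> /negbTE-> /negbTE-> _].
  by rewrite off2 //= off1.
have hb := hx h20.
have hz : bridge_right < h2 by apply: bsearch_lt.
rewrite ?(ea2, eb2, ex2, eh22, ez2) /= ?(eh22, ex2, ez2, eb2) /=.
do 4!(split; first by fits).
apply: hS => [|_|h]; [apply: fr|by []|by rewrite h in h20].
by move=> y; rewrite !inE !negb_or => /and4P[/negbTE-> /negbTE-> /negbTE-> /negbTE->].
Qed.

End Search.

(** * Reversals of intervals *)

Definition flip (lo hi x : nat) := if lo <= x < hi then lo + hi - 1 - x else x.

Lemma flipK lo hi : involutive (flip lo hi).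
Proof. by move=> x; rewrite /flip; case: (boolP (lo <= x < hi)) => h; case: ifP; lia. Qed.

Definition depth (lo hi x : nat) := minn (x - lo) (hi - 1 - x).

Lemma flip_ends lo hi k : k.*2 + 2 <= hi - lo ->
  [/\ flip lo hi (lo + k) = hi - 1 - k, flip lo hi (hi - 1 - k) = lo + k,
      depth lo hi (lo + k) = k & depth lo hi (hi - 1 - k) = k].
Proof. by move=> h; rewrite /flip /depth; split; rewrite ?ifT; lia. Qed.

Lemma depthP lo hi x : lo <= x < hi ->
  x = lo + depth lo hi x \/ x = hi - 1 - depth lo hi x.
Proof. by rewrite /depth => h; lia. Qed.

Lemma flip_middle lo hi x : lo <= x < hi -> hi - lo < (depth lo hi x).*2 + 2 ->
  flip lo hi x = x.
Proof. by rewrite /flip /depth => h1 h2; rewrite h1; lia. Qed.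

(** * Correctness of merging two adjacent blocks *)

Section Merging.
Variables (R : realType) (n p : nat) (P : 'I_n -> point R).
Hypothesis n0 : 0 < n.
Hypothesis P_sorted : presorted P.

Notation memory := (nat -> value R).
Notation Q := (nat_points P).

Let Qx := nat_points_xlt P_sorted.
Let Qg := nat_points_gp P_sorted.

Lemma layout_flip sh sh' a c t lo hi : layout P sh a c t -> (lo < hi -> a <= lo /\ hi <= c) ->
  (forall x, a <= x < c -> sh' x = sh (flip lo hi x)) ->
  layout P sh' a c (t \o flip lo hi).
Proof.
move=> [ht hs] hb hsh.
have hr x : a <= x < c -> a <= flip lo hi x < c.
  by rewrite /flip; case: ifP => // h1 h2; have := hb ltac:(lia); lia.
split; first by apply: perm_range_comp => //; apply: involution_perm_range (@flipK lo hi).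
by move=> x hx; rewrite hsh // hs ?hr.
Qed.


Section Bridge.
Variables (sh : memory) (a b c h1 h2 : nat) (t1 t2 : nat -> nat).
Hypothesis ab : a < b.
Hypothesis bc : b < c.
Hypothesis cn : c <= n.
Hypothesis lay1 : layout P sh a b t1.
Hypothesis lay2 : layout P sh b c t2.
Hypothesis hb1 : h1 <= b - a.
Hypothesis hb2 : h2 <= c - b.
Hypothesis chain1 : chain Q a b (fun u => t1 (a + u)) h1.
Hypothesis chain2 : chain Q b c (fun u => t2 (b + u)) h2.

Notation A := (fun x => point_of (sh x)).
Notation K := (bits n).+1.

Let A1 u : u < h1 -> A (a + u) = Q (t1 (a + u)).
Proof. by move=> hu; case: lay1 => _ ->; last lia. Qed.

Let A2 u : u < h2 -> A (b + u) = Q (t2 (b + u)).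
Proof. by move=> hu; case: lay2 => _ ->; last lia. Qed.

Let bits_ge h : h <= n -> h <= 2 ^ K.
Proof.
move=> hn; apply: leq_trans hn _; apply: ltnW.
apply: (@ltn_trans (2 ^ bits n)); last by rewrite ltn_exp2l.
by apply: trunc_log_ltn.
Qed.

Let h10 : 0 < h1 /\ t1 a = a.
Proof. by have := chain_first chain1 ab; rewrite addn0. Qed.

Let h20 : 0 < h2.
Proof. by case: (chain_first chain2 bc). Qed.

Let step_mono (q : nat -> bool) N : (forall v, v.+2 < N -> q v.+2 -> q v.+1) ->
  forall u v, 0 < u <= v -> v < N -> q v -> q u.
Proof.
move=> hq u v /andP[u0 uv]; rewrite -(subnKC uv); elim: (v - u) => [|d IH].
  by rewrite addn0.
move=> hN hd; apply: IH; first lia.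
have -> : u + d = (u + d).-1.+1 by lia.
by apply: hq; [lia | have -> : (u + d).-1.+2 = u + d.+1 by lia].
Qed.

Lemma slope_max_height u : u.+1 < h1 ->
  slope_max n A a b h2 u.+1 < h2 /\ forall j, b <= j < c ->
  (height Q (slope (Q (t1 (a + u))) (Q (t1 (a + u.+1)))) j <=
   height Q (slope (Q (t1 (a + u))) (Q (t1 (a + u.+1))))
     (t2 (b + slope_max n A a b h2 u.+1)))%R.
Proof.
move=> hu; set m := slope _ _.
have em v : v < h2 -> slope_test A b (A (a + u.+1.-1)) (A (a + u.+1)) v =
    (m < slope (Q (t2 (b + v.-1))) (Q (t2 (b + v))))%R.
  by move=> hv; rewrite /slope_test /= A1 ?A1 ?A2 //; lia.
have [|||z1 z2 z3] := @bsearchP (slope_test A b (A (a + u.+1.-1)) (A (a + u.+1))) h2 K.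
- exact: h20.
- by apply: bits_ge; lia.
- apply: step_mono => v hv; rewrite (em _ hv) (em _ (ltnW hv)) /=.
  move=> hm; apply: lt_trans hm _.
  exact: (chain_slopes Qx cn chain2 hv).
split=> // j hj.
apply: (chain_max Qx Qg cn bc chain2 z1) => // v hv.
  have hv2 : v < h2 by case/andP: hv => _ h; apply: leq_ltn_trans h z1.
  by rewrite -em // z2.
by have := z3 _ hv; rewrite em ?leNgt //; case/andP: hv.
Qed.

Lemma left_testE u : u.+1 < h1 ->
  left_test n A a b h2 u.+1 <-> hull Q a c (t1 (a + u.+1)).
Proof.
move=> hu; have [hz hmax] := slope_max_height hu.
rewrite /left_test /= A1 ?A1 ?A2 //; last lia.
by rewrite (left_survive Qx Qg ab bc cn chain1 chain2 hu hz hmax).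
Qed.

Notation X := (bridge_left n A a b h1 h2).
Notation Z := (bridge_right n A a b h1 h2).

Lemma bridge_leftP : X < h1 /\ forall u, u < h1 -> hull Q a c (t1 (a + u)) <-> u <= X.
Proof.
have [|||x1 x2 x3] := @bsearchP (left_test n A a b h2) h1 K.
- by case: h10.
- by apply: bits_ge; lia.
- apply: step_mono => v hv /(left_testE hv) hh; apply/(left_testE (ltnW hv)).
  exact: (left_survive_mono Qx Qg ab bc cn chain1 _ hv hh).
(* Vertex 0 is never tested by the search; it is the leftmost point [a] and always survives. *)
split=> // -[|u] hu.
  by split=> // _; rewrite addn0; case: h10 => _ ->; apply: hull_first; lia.
rewrite -(left_testE hu) leqNgt; split=> [h|/negP h].
  by apply/negP => lt; have := x3 u.+1; rewrite h lt hu => /(_ isT).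
by apply: x2; rewrite /= leqNgt; apply/negP.
Qed.

Lemma bridge_rightP : [/\ Z < h2,
  forall v, 0 < v <= Z -> (0 < orient (Q (t1 (a + X))) (Q (t2 (b + v.-1))) (Q (t2 (b + v))))%R
  & forall v, Z < v < h2 -> ~~ (0 < orient (Q (t1 (a + X))) (Q (t2 (b + v.-1))) (Q (t2 (b + v))))%R].
Proof.
have [hx _] := bridge_leftP.
have em v : v < h2 -> right_test A a b X v =
   (0 < orient (Q (t1 (a + X))) (Q (t2 (b + v.-1))) (Q (t2 (b + v))))%R.
  by move=> hv; rewrite /right_test A1 ?A2 //; lia.
have [|||z1 z2 z3] := @bsearchP (right_test A a b X) h2 K.
- exact: h20.
- by apply: bits_ge; lia.
- apply: step_mono => v hv; rewrite (em _ hv) (em _ (ltnW hv)) /=.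
  exact: (bridge_mono Qx Qg ab bc cn chain1 chain2 hv hx).
split=> // v hv.
  by rewrite -em ?z2 //; case/andP: hv => _ h; apply: leq_ltn_trans h _.
by rewrite -em ?z3 //; case/andP: hv.
Qed.

(** As maps of addresses the reversals compose contravariantly: a cell of the final array is first
    sent through the later, shorter reversal and then through the longer one. *)
Lemma block_merge sh' :
  let lo := a + X + 1 in let mid := lo + (h2 - Z) in
  (forall x, a <= x < c -> sh' x = sh (flip lo (b + h2) (flip lo mid x))) ->
  block P sh' a c (X + 1 + (h2 - Z)).
Proof.
have [hx x_last] := bridge_leftP; have [hz z_up z_down] := bridge_rightP.
move: X Z hx x_last hz z_up z_down => x z hx x_last hz z_up z_down lo mid hsh.
split; first lia.
pose t y := if y < b then t1 y else t2 y.
have lay : layout P sh a c t.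
  case: lay1 => -[p1 p2] p3; case: lay2 => -[q1 q2] q3; split; last first.
    by move=> y hy; rewrite /t; case: ltnP => hyb; [apply: p3|apply: q3]; lia.
  split=> [y hy|y y' hy hy']; rewrite /t.
    by case: ltnP => hyb; [have := p1 y ltac:(lia)|have := q1 y ltac:(lia)]; lia.
  case: ltnP => hyb; case: ltnP => hyb'.
  - by apply: p2; lia.
  - by have := p1 y ltac:(lia); have := q1 y' ltac:(lia); lia.
  - by have := q1 y ltac:(lia); have := p1 y' ltac:(lia); lia.
  - by apply: q2; lia.
exists ((t \o flip lo (b + h2)) \o flip lo mid).
  apply: (layout_flip (sh := fun x => sh (flip lo (b + h2) x))) => //; last by rewrite /mid /lo; lia.
  apply: (layout_flip (sh := sh)) => //; rewrite /lo; lia.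
rewrite addn1; apply: (chain_merge Qx Qg ab bc cn chain1 chain2 hx x_last hz z_up z_down).
  move=> u hu /=.
  have fl m : flip lo m (a + u) = a + u by rewrite /flip /lo ifF //; lia.
  by rewrite !fl /t ifT //; lia.
move=> v hv; rewrite /comp; have hv' : v < h2 by case/andP: hv.
have -> : flip lo (b + h2) (flip lo mid (a + (x.+1 + (v - z)))) = b + v.
  have -> : flip lo mid (a + (x.+1 + (v - z))) = mid - 1 - (v - z).
    by rewrite /flip ifT /mid /lo; lia.
  by rewrite /flip ifT /mid /lo; lia.
by rewrite /t ifF //; lia.
Qed.

End Bridge.
End Merging.

(** * The share of one processor in a reversal *)

Section Reversal.
Variables (R : realType) (n p : nat).
Hypothesis n0 : 0 < n.
Notation memory := (nat -> value R).
Notation B := (n %/ p + 1).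

Let hM : 64 * (n * n + n + 1) <= max_word n.
Proof. exact: max_word_ge. Qed.

(* Reversing [lo, ..., hi.-1] exchanges the [k]-th cells from both ends; the
   processor with offset [k0] deals with [k0 <= k < k0 + B]. *)
Definition flip_share (lo hi k0 x : nat) : Prop :=
  lo <= x < hi /\ k0 <= depth lo hi x < k0 + B.

Lemma wp_reverse_loop (rd wr : nat -> Prop) hc lo hi k0 sh pr (S : memory -> memory -> Prop) :
  hc \notin [:: vt; vk; vX; vY] -> lo <= n -> hi <= n -> k0 + B <= 4 * n ->
  (forall x, flip_share lo hi k0 x -> rd x /\ wr x) ->
  words pr [:: (vlo, lo); (hc, hi); (vk, k0); (vt, B)] ->
  (forall sh' pr', same_off [:: vt; vk; vX; vY] pr pr' ->
    (forall x, flip_share lo hi k0 x -> sh' x = sh (flip lo hi x)) -> S sh' pr') ->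
  wp n p rd wr (reverse_loop hc) S sh pr.
Proof.
move=> hc0 hlo hhi hk0 hrw [el [eh [ek [et _]]]] hS.
have := hc0; rewrite !inE !negb_or => /and4P[/negbTE c1 /negbTE c2 /negbTE c3 /negbTE c4].
pose I j sh' pr' := [/\ same_off [:: vt; vk; vX; vY] pr pr',
  words pr' [:: (vk, k0 + j); (vt, B - j)] &
  forall x, flip_share lo hi k0 x ->
    sh' x = if depth lo hi x < k0 + j then sh (flip lo hi x) else sh x].
apply: (@wp_while _ _ _ _ _ I) => [|j sh1 pr1 hj [off [ek1 [et1 _]] hsh]|sh1 pr1 [off [ek1 [et1 _]] hsh]].
- split=> //=; first by rewrite addn0 subn0.
  by move=> x [_ hx]; rewrite ifF //; lia.
- have el1 : pr1 vlo = Word lo by rewrite off.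
  have eh1 : pr1 hc = Word hi by rewrite off.
  split; [by rewrite /= et1|by rewrite /= et1 /=; lia|].
  have fr pr' : same_off [:: vt; vk; vX; vY] pr1 pr' -> same_off [:: vt; vk; vX; vY] pr pr'.
    by move=> off2 y hy; rewrite off2 // off.
  rewrite /= et1 /=; split; first by fits.
  rewrite ?(ek1, el1, eh1, c1, c2, c3, c4) /= ?(ek1, el1, eh1, c1, c2, c3, c4) /=.
  pose k := k0 + j.
  have hcond : (k + 1 <= (hi - lo) %/ 2) = (k.*2 + 2 <= hi - lo).
    by rewrite leq_divRL //; apply/idP/idP; lia.
  have hd := leq_div (hi - lo) 2.
  split; first by fits.
  rewrite -/k hcond; case: (leqP (k.*2 + 2) (hi - lo)) => hk /=; last first.
    split; first by fits.
    split=> [||x hx]; first last.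
    (* No pair of depth [k] is left; a cell of this depth can only be the middle one, which the
       reversal fixes. *)
    + rewrite hsh // addnS ltnS [in RHS]leq_eqVlt; case: eqP => [e|_] /=; last by [].
      case: hx => hx1 _; rewrite e ltnn flip_middle // e -/k; exact: hk.
    + by rewrite /= /k; split; [|split]; rewrite //; congr Word; lia.
    + by apply: fr => y; rewrite !inE !negb_or => /and4P[/negbTE-> /negbTE-> _ _].
  have [f1 f2 d1 d2] := flip_ends hk.
  have s1 : flip_share lo hi k0 (lo + k) by rewrite /flip_share d1 /k; lia.
  have s2 : flip_share lo hi k0 (hi - 1 - k) by rewrite /flip_share d2 /k; lia.
  have [r1 w1] := hrw _ s1; have [r2 w2] := hrw _ s2.
  rewrite ?(ek1, el1, eh1, c1, c2, c3, c4) /= -/k.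
  split; [by fits|lia|by []|].
  split; [by fits|lia|by []|].
  split; [by fits|lia|by []|].
  split; [by fits|lia|by []|].
  split; first by fits.
  split=> [||x hx]; first last.
  + rewrite !hsh // d1 d2 -/k ltnn addnS ltnS -/k.
    case: (x =P hi - 1 - k) => [->|n1]; first by rewrite d2 leqnn f2.
    case: (x =P lo + k) => [->|n2]; first by rewrite d1 leqnn f1.
    rewrite [in RHS]leq_eqVlt; case: eqP => //= e.
    by case: hx => /depthP; rewrite e => -[].
  + by rewrite /= /k; split; [|split]; rewrite //; congr Word; lia.
  + by apply: fr => y; rewrite !inE !negb_or => /and4P[/negbTE-> /negbTE-> /negbTE-> /negbTE->].
- rewrite /= et1 /= subnn; split=> //; apply: hS => // x hx.
  by rewrite hsh // ifT //; case: hx => _ /andP[].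
Qed.

End Reversal.

(** * Groups of processors *)

Definition start g i := i %/ g * g.

Lemma start_bounds g i : 0 < g -> start g i <= i < start g i + g.
Proof. by move=> g0; rewrite /start leq_divM -mulSnr ltn_ceil. Qed.

Lemma dvdn_start g i : g %| start g i.
Proof. exact: dvdn_mull. Qed.

Lemma start_eq g s i : 0 < g -> g %| s -> s <= i < s + g -> start g i = s.
Proof.
move=> g0 /dvdnP[k ->] hi; congr (_ * _).
rewrite -(subnKC (m := k * g) (n := i)); last by case/andP: hi.
by rewrite divnMDl // divn_small ?addn0 //; lia.
Qed.

(** * Setup and the exchange of hull sizes for all processors *)

Section Assembly.
Variables (R : realType) (prog : seq instr) (n p : nat) (P : 'I_n -> point R).
Hypothesis hp : 0 < p <= n.
Hypothesis P_sorted : presorted P.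

Notation memory := (nat -> value R).
Notation Q := (nat_points P).
Notation B := (n %/ p + 1).
Notation bd := (bd n p).
Notation triple := (triple prog n (p := p)).

Let hM : 64 * (n * n + n + 1) <= max_word n.
Proof. by apply: max_word_ge; lia. Qed.

Let n0 : 0 < n.
Proof. by lia. Qed.

Definition base (i g : nat) : seq (nat * nat) :=
  [:: (vn, n); (vp, p); (vi, i); (vB, B); (va, bd i); (vW, 2 ^ bits n); (vg, g)].

(* The processors are grouped by [g]; [H s] is the number of hull points of the
   block of points handled by the group starting at processor [s]. *)
Definition blocks (g : nat) (H : nat -> nat) (sh : memory) : Prop :=
  forall s, s < p -> g %| s -> block P sh (bd s) (bd (minn (s + g) p)) (H s).

Definition level (g : nat) (H : nat -> nat) (sh : memory) (prs : 'I_p -> memory) : Prop :=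
  blocks g H sh /\ forall i : 'I_p, words (prs i) (base i g ++ [:: (vh, H (start g i))]).

Lemma block_eq sh sh' a c h : (forall x, a <= x < c -> sh' x = sh x) ->
  block P sh a c h -> block P sh' a c h.
Proof.
move=> e [h1 [t [t1 t2] t3]]; split=> //; exists t => //; split=> // x hx.
by rewrite e // t2.
Qed.

Lemma blocks_eq g H sh sh' : (forall x, x < n -> sh' x = sh x) ->
  blocks g H sh -> blocks g H sh'.
Proof.
move=> e hb s sp gs; apply: block_eq (hb s sp gs) => x hx; apply: e.
by have := bd_le_n hp (geq_minr (s + g) p); lia.
Qed.

Lemma bd_cover x : x < n -> exists i : 'I_p, bd i <= x < bd i.+1.
Proof.
move=> xn; have p0 : 0 < p by case/andP: hp.
have [] := @ex_maxnP (fun i => (bd i <= x)) p; first by exists 0; rewrite /bd mul0n div0n.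
  by move=> i hi; rewrite leqNgt; apply/negP => /(bd_lt hp); rewrite (bd_p hp); lia.
move=> i hi hmax.
have ip : i < p by rewrite ltnNge; apply/negP => /(bd_le hp); rewrite (bd_p hp); lia.
exists (Ordinal ip); rewrite hi /= ltnNge; apply/negP => /hmax; by rewrite ltnn.
Qed.

Lemma blocks_cover g H sh x : 0 < g -> blocks g H sh -> x < n -> sh x = Pt (point_of (sh x)).
Proof.
move=> g0 hb /bd_cover [i hi]; have hs := start_bounds i g0.
have sp : start g i < p by have := ltn_ord i; lia.
have [_ [t [_ e] _]] := hb _ sp (dvdn_start g i).
suff hx : bd (start g i) <= x < bd (minn (start g i + g) p) by rewrite e.
have h1 := bd_le hp (x := start g i) (y := i) ltac:(lia).
have h2 := bd_le hp (x := i.+1) (y := minn (start g i + g) p) ltac:(have := ltn_ord i; lia).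
lia.
Qed.

Definition initial (sh : memory) (prs : 'I_p -> memory) : Prop :=
  (forall x, x < n -> sh x = Pt (Q x)) /\
  forall i : 'I_p, words (prs i) [:: (vn, n); (vp, p); (vi, nat_of_ord i)].

Lemma triple_setup : triple setup initial (fun sh prs => exists H, level 1 H sh prs).
Proof.
apply: triple_segment => // sh prs [hsh hw].
pose own (i : 'I_p) x := bd i <= x < bd i.+1.
exists own, own, (fun (i : 'I_p) (sh' pr' : memory) => exists2 h, block P sh' (bd i) (bd i.+1) h &
  words pr' (base i 1 ++ [:: (vh, h)])); split=> //.
- move=> i j x hij; rewrite /own => h1 h2.
  case: (ltngtP i j) => [lt|lt|/val_inj e]; last by rewrite e eqxx in hij.
    by have := bd_le hp lt; lia.
  by have := bd_le hp lt; lia.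
- move=> i; apply: (wp_setup hp P_sorted (ltn_ord i) (hw i)) => //.
  move=> sh' pr' h hb [e0 [e1 [e2 [e3 [e4 [e5 [e6 [e7 _]]]]]]]].
  by exists h; rewrite //= e0 e1 e2 e3 e4 e5 e6 e7.
- move=> sh' prs' hq _.
  have hex (i : 'I_p) : exists h, block P sh' (bd i) (bd i.+1) h /\ words (prs' i) (base i 1 ++ [:: (vh, h)]).
    have [view [[h hb hws] hv]] := hq i; exists h; split=> //.
    by apply: block_eq hb => x; apply: hv.
  have [h {}hex] := fin_all_exists hex.
  exists (fun s => if insub s is Some i then h i else 0); split.
    move=> s sp _; rewrite insubT /= addn1 (minn_idPl sp).
    by case: (hex (Ordinal sp)).
  by move=> i; rewrite /start divn1 muln1 valK; case: (hex i).
Qed.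

Section Merge.
Variable g : nat.
Hypothesis g0 : 0 < g.
Hypothesis gp : g < p.

Notation first i := (start (2 * g) i).

(** The geometric facts are kept about [sh0], the memory before posting; the displaced points wait
    in the cells [vV]. *)
Definition posted (H : nat -> nat) (sh0 sh : memory) (prs : 'I_p -> memory) : Prop :=
  [/\ level g H sh0 prs,
    forall i : 'I_p, sh (bd i) = Word (H (start g i)),
    forall x, (forall i : 'I_p, x <> bd i) -> sh x = sh0 x
    & forall i : 'I_p, prs i vV = sh0 (bd i)].

Lemma triple_post : triple post_count (fun sh prs => exists H, level g H sh prs)
  (fun sh prs => exists H sh0, posted H sh0 sh prs).
Proof.
apply: triple_segment => // sh prs [H [hb hw]].
pose own (i : 'I_p) x := x = bd i.
exists own, own, (fun (i : 'I_p) (sh' pr' : memory) => [/\ sh' (bd i) = Word (H (start g i)), pr' vV = sh (bd i) &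
  same_off [:: vV] (prs i) pr']); split=> //.
- by move=> i j x hij -> /(bd_inj hp)/val_inj e; rewrite e eqxx in hij.
- move=> i; have [_ [_ [_ [_ [ea [_ [_ [eh _]]]]]]]] := hw i.
  rewrite /= !(ea, eh) /=.
  have hbn := bd_lt_n hp (ltn_ord i).
  split=> //; split=> //; rewrite eqxx; split=> // y.
  by rewrite inE => /negbTE->.
- move=> sh' prs' hq hun; exists H, sh; split.
  + split=> // i; have [view [[_ _ off] _]] := hq i.
    by move: (hw i); rewrite /= !off.
  + by move=> i; have [view [[h1 _ _] ->]] := hq i.
  + by move=> x hx; apply: hun => i; apply: hx.
  + by move=> i; have [view [[_ h1 _] _]] := hq i.
Qed.

(** The factor [b] is 0 exactly for groups without a partner. *)
Definition fetched (H : nat -> nat) (prs : 'I_p -> memory) : Prop :=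
  forall i : 'I_p, let s := first i in let b := (s + g < p : nat) in
  words (prs i) [:: (vs, s); (vl, bd s); (vr, b * bd (s + g));
     (vhl, b * H s); (vhr, b * H (s + g))].

Lemma first_bounds (i : 'I_p) : first i <= i < first i + 2 * g.
Proof. by apply: start_bounds; rewrite muln_gt0. Qed.

Lemma start_first s : 2 * g %| s -> start g s = s /\ start g (s + g) = s + g.
Proof.
move=> hd; have hg : g %| s := dvdn_trans (dvdn_mull 2 (dvdnn g)) hd.
by split; apply: start_eq; rewrite ?dvdn_addl ?dvdnn //; lia.
Qed.

Lemma triple_fetch :
  triple fetch_counts (fun sh prs => exists H sh0, posted H sh0 sh prs)
    (fun sh prs => exists H sh0, posted H sh0 sh prs /\ fetched H prs).
Proof.
apply: triple_segment => // sh prs [H [sh0 [[hb hw] h1 h2 h3]]].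
pose b s := nat_of_bool (s + g < p).
pose mods := [:: vs; vl; vr; vhl; vhr].
(* Nobody writes in this phase, so everybody may read every cell. *)
exists (fun _ _ => True), (fun _ _ => False), (fun (i : 'I_p) (sh' pr' : memory) => [/\ sh' = sh,
  same_off mods (prs i) pr' &
  words pr' [:: (vs, first i); (vl, bd (first i)); (vr, b (first i) * bd (first i + g));
    (vhl, b (first i) * H (first i)); (vhr, b (first i) * H (first i + g))]]); split=> //.
- move=> i; have [en [ep [ei [_ [_ [_ [eg [_ _]]]]]]]] := hw i.
  have ip := ltn_ord i.
  have fb := first_bounds i; set s := first i in fb *.
  have dvs : 2 * g %| s by apply: dvdn_start.
  have [sf1 sf2] := start_first dvs.
  have q1 : s * n <= n * n by rewrite leq_mul2r; lia.
  have q2 : (s + g) * n <= 2 * (n * n) by rewrite mulnA leq_mul2r; lia.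
  have q3 := leq_div (s * n) p; have q4 := leq_div ((s + g) * n) p.
  rewrite /= !(en, ep, ei, eg) /= -/(start (2 * g) i) -/s ?(en, ep, ei, eg) /= -/(bd s) -/(bd (s + g)).
  have sp : s < p by case/andP: fb => h _; apply: leq_ltn_trans h ip.
  have ls := bd_lt_n hp sp.
  have lsg : s + g < p -> bd (s + g) < n by apply: (bd_lt_n hp).
  have es : sh (bd s) = Word (H s) by have := h1 (Ordinal sp); rewrite /= sf1.
  have esg : s + g < p -> sh (bd (s + g)) = Word (H (s + g)).
    by move=> hsg; have := h1 (Ordinal hsg); rewrite /= sf2.
  clear dvs; clearbody s.
  move: (i %/ (2 * g)) (leq_div i (2 * g)) => q hq.
  
  split; first by fits.
  do 4!(split; first by fits).
  rewrite /b addn1; split; first by fits.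
  move: lsg esg; case: ltnP => hsg /= lsg esg; last first.
    split=> //.
    by move=> y; rewrite !inE !negb_or => /and5P[/negbTE-> /negbTE-> /negbTE-> /negbTE-> /negbTE->].
  rewrite ?(en, ep, eg) /=; split; first by fits.
  split=> //; split=> //; first exact: lsg.
  split=> //.
    by move=> y; rewrite !inE !negb_or => /and5P[/negbTE-> /negbTE-> /negbTE-> /negbTE-> /negbTE->].
  by rewrite !mul1n esg // es.
- move=> sh' prs' hq hun; exists H, sh0; split; last first.
    by move=> i; have [view [[_ _ h4] _]] := hq i.
  have off i : same_off mods (prs i) (prs' i) by have [view [[_ h4 _] _]] := hq i.
  have esh x : sh' x = sh x by apply: hun => i [].
  split.
  + by split=> // i; move: (hw i); rewrite /= !off.
  + by move=> i; rewrite esh.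
  + by move=> x; rewrite esh; apply: h2.
  + by move=> i; rewrite off.
Qed.

Lemma triple_unpost :
  triple unpost_count (fun sh prs => exists H sh0, posted H sh0 sh prs /\ fetched H prs)
    (fun sh prs => exists H, level g H sh prs /\ fetched H prs).
Proof.
apply: triple_segment => // sh prs [H [sh0 [[[hb hw] h1 h2 h3] hf]]].
pose own (i : 'I_p) x := x = bd i.
exists own, own, (fun (i : 'I_p) (sh' pr' : memory) => sh' (bd i) = sh0 (bd i) /\ pr' = prs i); split=> //.
- by move=> i j x hij -> /(bd_inj hp)/val_inj e; rewrite e eqxx in hij.
- move=> i; have [_ [_ [_ [_ [ea _]]]]] := hw i.
  have hbn := bd_lt_n hp (ltn_ord i).
  by rewrite /= !ea /= eqxx h3.
- move=> sh' prs' hq hun.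
  have ep i : prs' i = prs i by have [view [[_ ->]]] := hq i.
  exists H; split; last by move=> i; rewrite ep; apply: hf.
  split; last by move=> i; rewrite ep; apply: hw.
  apply: blocks_eq hb => x xn.
  have [/existsP[i /eqP->]|/existsPn hx] := boolP [exists i : 'I_p, x == bd i].
    by have [view [[h _] ->]] := hq i.
  by rewrite hun ?h2 // => i; apply/eqP; apply: hx.
Qed.

End Merge.
End Assembly.

(** * Tangents and reversals for all pairs of groups at once *)

Section Merging.
Variables (R : realType) (prog : seq instr) (n p : nat) (P : 'I_n -> point R).
Hypothesis hp : 0 < p <= n.
Hypothesis P_sorted : presorted P.
Variable g : nat.
Hypothesis g0 : 0 < g.

Notation memory := (nat -> value R).
Notation Q := (nat_points P).
Notation B := (n %/ p + 1).
Notation bd := (bd n p).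
Notation triple := (triple prog n (p := p)).
Notation first i := (start (2 * g) i).
Notation last s := (minn (s + 2 * g) p).

Let hM : 64 * (n * n + n + 1) <= max_word n.
Proof. by apply: max_word_ge; lia. Qed.

Let n0 : 0 < n.
Proof. by lia. Qed.

Section Shape.
Variables (H : nat -> nat) (sh : memory).

Definition last_left s :=
  bridge_left n (fun x => point_of (sh x)) (bd s) (bd (s + g)) (H s) (H (s + g)).
Definition first_right s :=
  bridge_right n (fun x => point_of (sh x)) (bd s) (bd (s + g)) (H s) (H (s + g)).
(** Without a partner, [lo], [hi] and [mid] are all 0, so that both reversals are the identity. *)
Definition lo s := if s + g < p then bd s + last_left s + 1 else 0.
Definition hi s := if s + g < p then bd (s + g) + H (s + g) else 0.
Definition mid s := if s + g < p then lo s + (H (s + g) - first_right s) else 0.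
Definition merged s :=
  if s + g < p then last_left s + 1 + (H (s + g) - first_right s) else H s.

Hypothesis hb : blocks p P g H sh.

Lemma two_blocks s : s + g < p -> 2 * g %| s ->
  [/\ block P sh (bd s) (bd (s + g)) (H s),
      block P sh (bd (s + g)) (bd (last s)) (H (s + g)),
      bd s < bd (s + g) & bd (s + g) < bd (last s) <= n].
Proof.
move=> hsg hd; have hg : g %| s := dvdn_trans (dvdn_mull 2 (dvdnn g)) hd.
have sp : s < p by lia.
split.
- by have := hb sp hg; rewrite (minn_idPl (ltnW hsg)).
- have := hb hsg (_ : g %| s + g); rewrite dvdn_addl ?dvdnn // => /(_ hg).
  by rewrite -addnA addnn -mul2n.
- by apply: (bd_lt hp); lia.
- rewrite (bd_lt hp); last by lia.
  by apply: (bd_le_n hp); rewrite geq_minr.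
Qed.

Lemma bridge_bounds s : s + g < p -> 2 * g %| s ->
  [/\ bd s <= lo s, lo s <= mid s, mid s <= hi s, hi s <= bd (last s) &
   0 < H s /\ 0 < H (s + g)].
Proof.
move=> hsg hd; have [[b1 [t1 l1 c1]] [b2 [t2 l2 c2]] lt1 /andP[lt2 le]] := two_blocks hsg hd.
have [hx _] := bridge_leftP n0 P_sorted lt1 lt2 le l1 l2 b1 b2 c1 c2.
have [hz _ _] := bridge_rightP n0 P_sorted lt1 lt2 le l1 l2 b1 b2 c1 c2.
rewrite /lo /mid /hi /lo hsg -/(last_left s) -/(first_right s) in hx hz *.
have [p1 _] := chain_first c1 lt1; have [p2 _] := chain_first c2 lt2.
clear l1 l2 c1 c2 hd.
move: (bd s) (bd (s + g)) (bd (last s)) (last_left s) (first_right s) b1 b2 lt1 lt2 le hx hz.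
move=> a b c x z b1 b2 lt1 lt2 le hx hz; split=> //; lia.
Qed.

End Shape.

Definition bridged (H : nat -> nat) (sh : memory) (i : nat) : seq (nat * nat) :=
  base n p i g ++ [:: (vs, first i); (vlo, lo H sh (first i)); (vhi, hi H (first i));
    (vmid, mid H sh (first i)); (vh, merged H sh (first i))].

Lemma block_distinct sh a c h u : block P sh a c h -> c <= n -> u.+1 < h ->
  (point_of (sh (a + u))).1 != (point_of (sh (a + u.+1))).1.
Proof.
move=> [hh [t [[t1 _] t2] [_ c2 _]]] cn hu.
rewrite !t2 /=; [|lia|lia].
have := c2 u u.+1 (ltnSn u) hu => lt; rewrite lt_eqF //.
by apply: nat_points_xlt => //; have := t1 (a + u.+1); lia.
Qed.

Lemma triple_find_bridge :
  triple find_bridge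
    (fun sh prs => exists H, level P g H sh prs /\ fetched n g H prs)
    (fun sh prs => exists H sh0, [/\ blocks p P g H sh0, forall x, sh x = sh0 x
       & forall i : 'I_p, words (prs i) (bridged H sh0 i)]).
Proof.
apply: triple_segment => // sh prs [H [[hb hw] hf]].
exists (fun _ _ => True), (fun _ _ => False), (fun (i : 'I_p) (sh' pr' : memory) => sh' = sh /\
  words pr' (bridged H sh i)); split=> //; last first.
  move=> sh' prs' hq hun; exists H, sh; split=> // [x|i]; first by apply: hun => i [].
  by have [view [[_ h] _]] := hq i.
move=> i; have [en [ep [ei [eB [ea [eW [eg [eh _]]]]]]]] := hw i.
have [es [el [er [ehl [ehr _]]]]] := hf i.
have fb := first_bounds g0 i.
have hd : 2 * g %| first i by apply: dvdn_start.
rewrite /bridged; move: (first i) fb hd es el er ehl ehr => s fb hd es el er ehl ehr.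
have hsA x : x < n -> sh x = Pt (point_of (sh x)) by apply: (blocks_cover hp g0 hb).
have ip := ltn_ord i.
case hsg: (s + g < p) er ehl ehr => er ehl ehr; rewrite /= ?mul0n ?mul1n in er ehl ehr.
  have [b1 b2 lt1 /andP[lt2 le]] := two_blocks hb hsg hd.
  have [_ _ _ _ [p1 p2]] := bridge_bounds hb hsg hd.
  have [hh1 _] := b1; have [hh2 _] := b2.
  apply: (wp_find_bridge (a := bd s) (b := bd (s + g)) (h1 := H s) (h2 := H (s + g))
    p n0 (fun=> False) (fun _ _ => I) hsA) => //=.
  - by lia.
  - by lia.
  - by move=> u hu; apply: (block_distinct b1) => //; lia.
  - by move=> u hu; apply: (block_distinct b2).
  move=> pr' off hpos _; have [e1 [e2 [e3 [e4 _]]]] := hpos p2.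
  split=> //; rewrite /lo /hi /mid /merged /lo hsg /= e1 e2 e3 e4 !off //.
have sn : bd s <= n by apply: (bd_le_n hp); lia.
(* A group without a partner runs the same code on two empty hulls. *)
apply: (@wp_find_bridge R n p n0 (fun=> True) (fun=> False) sh (fun x => point_of (sh x)) (bd s) 0 0 0
  (fun _ _ => I) hsA) => //=; first by lia.
move=> pr' off _ hz; have [[e1 [e2 [e3 _]]] e4] := hz erefl.
split=> //; rewrite /lo /hi /mid /merged hsg /= e1 e2 e3 e4 !off //; do 11!(split=> //).
have hg : g %| s := dvdn_trans (dvdn_mull 2 (dvdnn g)) hd.
rewrite eh; split=> //; congr (Word (H _)); apply: start_eq => //.
by clear -fb hsg ip; lia.
Qed.

(** Fixing the initial memories lets the postcondition refer to them. *)
Lemma triple_fix c (Pre Post : assertion R p) :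
  (forall sh1 prs1, Pre sh1 prs1 ->
     triple c (fun sh prs => sh = sh1 /\ prs = prs1) Post) -> triple c Pre Post.
Proof. by move=> h l cfg sh prs hc hat hPre; apply: (h sh prs hPre) hc hat _. Qed.

Lemma start_start i : first (first i) = first i.
Proof. by apply: start_eq; rewrite ?muln_gt0 ?dvdn_start //; lia. Qed.

Lemma last_bounds s : s < p -> bd s < bd (last s) <= n.
Proof.
move=> sp; rewrite (bd_lt hp); last by lia.
by apply: (bd_le_n hp); rewrite geq_minr.
Qed.

Lemma same_first (i : 'I_p) j : first i <= j < first i + 2 * g -> first j = first i.
Proof. by apply: start_eq; rewrite ?muln_gt0 //; apply: dvdn_start. Qed.

Lemma first_disjoint (i j : 'I_p) x : bd (first i) <= x < bd (last (first i)) ->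
  bd (first j) <= x < bd (last (first j)) -> first i = first j.
Proof.
have aux (k k' : 'I_p) : first k < first k' -> last (first k) <= first k'.
  move=> lt; have fk := first_bounds g0 k; have fk' := first_bounds g0 k'.
  rewrite geq_min; apply/orP; left; rewrite leqNgt; apply/negP => lt2.
  have fk2 : first k <= first k' < first k + 2 * g by lia.
  have e := same_first fk2; have := start_start k'; lia.
move=> hi hj; case: (ltngtP (first i) (first j)) => // lt.
  by have := bd_le hp (aux _ _ lt); lia.
by have := bd_le hp (aux _ _ lt); lia.
Qed.

Lemma triple_reverse hc (l r : nat -> nat) (sh1 : memory) (prs1 : 'I_p -> memory) :
  hc < tmp -> hc \notin [:: vt; vk; vX; vY] ->
  (forall i : 'I_p, words (prs1 i) [:: (vi, nat_of_ord i); (vB, B); (vs, first i);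
     (vlo, l (first i)); (hc, r (first i))]) ->
  (forall i : 'I_p, l (first i) <= n /\ r (first i) <= n) ->
  (forall i : 'I_p, l (first i) < r (first i) ->
     bd (first i) <= l (first i) /\ r (first i) <= bd (last (first i))) ->
  triple (reverse hc) (fun sh prs => sh = sh1 /\ prs = prs1)
    (fun sh prs => (forall i, same_off [:: vt; vk; vX; vY] (prs1 i) (prs i)) /\
       forall (i : 'I_p) x, bd (first i) <= x < bd (last (first i)) ->
         sh x = sh1 (flip (l (first i)) (r (first i)) x)).
Proof.
move=> hct hc0 hw hn hb; apply: triple_segment.
  by rewrite /= /all hct.
move=> _ _ [-> ->].
pose k0 (i : 'I_p) := (i - first i) * B.
pose own (i : 'I_p) := flip_share n p (l (first i)) (r (first i)) (k0 i).
exists own, own, (fun (i : 'I_p) (sh' pr' : memory) => same_off [:: vt; vk; vX; vY] (prs1 i) pr' /\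
  forall x, own i x -> sh' x = sh1 (flip (l (first i)) (r (first i)) x)); split=> //.
- move=> i j x ij [h1 h2] [h3 h4].
  have e : first i = first j.
    apply: (@first_disjoint _ _ x); first by have [] := hb i ltac:(lia); lia.
    by have [] := hb j ltac:(lia); lia.
  rewrite -e in h3 h4; move: h2 h4; rewrite /k0 -e; move: (depth _ _ _) => d h2 h4.
  have fi := first_bounds g0 i; have fj := first_bounds g0 j; rewrite -e in fj.
  (* Within a pair, the depth of a cell determines the processor in charge of it; different pairs
     have disjoint ranges by [first_disjoint]. *)
  have q k : k * B <= d < k * B + B -> d %/ B = k.
    move=> hk; rewrite -(subnKC (m := k * B) (n := d)); last by case/andP: hk.
    by rewrite divnMDl ?addn1 // divn_small ?addn0; lia.
  have e2 : i - first i = j - first i by rewrite -(q _ h2) -(q _ h4).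
  by case/eqP: ij; apply: val_inj => /=; lia.
- move=> i; have [ei [eB [es [el [er _]]]]] := hw i; have [ln rn] := hn i.
  have := hc0; rewrite !inE !negb_or => /and4P[/negbTE c1 /negbTE c2 /negbTE c3 /negbTE c4].
  have ip := ltn_ord i; have fi := first_bounds g0 i.
  have hpB : p * B <= 2 * n.
    by rewrite mulnDr muln1 mulnC; have := leq_divM n p; lia.
  have hk : k0 i + B <= p * B by rewrite -mulSnr leq_mul2r; apply/orP; right; lia.
  have hB : B <= n + 1 by rewrite leq_add2r leq_div.
  apply: wp_seqI; rewrite [wp _ _ _ _ (Assign _ _) _ _ _]/= eB /=; split; first by fits.
  rewrite ?(ei, es, eB) /= -/(k0 i).
  split.
    have h1 : k0 i <= 2 * n := leq_trans (leq_trans (leq_addr _ _) hk) hpB.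
    move: (k0 i) h1 => k h1; clear hpB hk hB.
    by split=> //; [split=> //; lia|lia].
  apply: (@wp_reverse_loop R n p n0 _ _ hc (l (first i)) (r (first i)) (k0 i)) => //.
  + by lia.
  + by rewrite /= el er c1 c2.
  + move=> sh' pr' off hsh; split=> // y hy; rewrite off //=.
    by move: hy; rewrite !inE !negb_or => /and4P[/negbTE-> /negbTE-> _ _].
- move=> sh' prs' hq hun; split; first by move=> i; have [view [[h _] _]] := hq i.
  move=> i x hx.
  have [hin|hout] := boolP (l (first i) <= x < r (first i)); last first.
    rewrite hun /flip ?(negbTE hout) // => j [hj _].
    have e : first i = first j.
      by apply: (@first_disjoint _ _ x) => //; have [] := hb j ltac:(lia); lia.
    by rewrite -e in hj; rewrite hj in hout.
  have [bl br] := hb i ltac:(lia).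
  pose d := depth (l (first i)) (r (first i)) x.
  (* Every cell of the reversed range has a processor in charge: by [bd_len] its depth is small
     enough for [first i + d %/ B] to belong to the pair. *)
  have hd : d < (last (first i) - first i) * B.
    have fi := first_bounds g0 i; have ip := ltn_ord i.
    apply: leq_trans (bd_len hp (x := first i) (y := last (first i)) _); last by lia.
    by rewrite /d /depth; lia.
  have hdB : d %/ B < last (first i) - first i by rewrite ltn_divLR // addn1.
  have jp : first i + d %/ B < p by lia.
  have ej : first (first i + d %/ B) = first i.
    apply: same_first; rewrite leq_addr ltn_add2l.
    by apply: leq_trans hdB _; rewrite leq_subLR geq_minl.
  have ej' : first (Ordinal jp) = first i by [].
  have ow : own (Ordinal jp) x.
    rewrite /own /k0 ej' /flip_share -/d; split=> //.
    by rewrite addKn leq_divM -mulSnr ltn_ceil // addn1.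
  by have [view [[_ h] e]] := hq (Ordinal jp); rewrite e // h // ej'.
Qed.

End Merging.

(** * One round of merging *)

Section MergeBody.
Variables (R : realType) (prog : seq instr) (n p : nat) (P : 'I_n -> point R).
Hypothesis hp : 0 < p <= n.
Hypothesis P_sorted : presorted P.
Variable g : nat.
Hypothesis g0 : 0 < g.

Notation memory := (nat -> value R).
Notation bd := (bd n p).
Notation triple := (triple prog n (p := p)).
Notation first i := (start (2 * g) i).
Notation last s := (minn (s + 2 * g) p).
Notation lo := (lo n p g).
Notation hi := (hi n p g).
Notation mid := (mid n p g).

Let hM : 64 * (n * n + n + 1) <= max_word n.
Proof. by apply: max_word_ge; lia. Qed.

Lemma shape_bounds H (sh : memory) (i : 'I_p) : blocks p P g H sh ->
  let s := first i in
  [/\ lo H sh s <= n, hi H s <= n, mid H sh s <= n,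
    (lo H sh s < hi H s -> bd s <= lo H sh s /\ hi H s <= bd (last s)) &
    (lo H sh s < mid H sh s -> bd s <= lo H sh s /\ mid H sh s <= bd (last s))].
Proof.
move=> hb s; have hd : 2 * g %| s by apply: dvdn_start.
case hsg: (s + g < p); last by rewrite /lo /hi /mid hsg.
have [q1 q2 q3 q4 _] := bridge_bounds hp P_sorted g0 hb hsg hd.
have /andP[_ q5] := last_bounds hp g0 (s := s) ltac:(lia).
by split; [lia|lia|lia|move=> _; split; lia|move=> _; split; lia].
Qed.

(** Between the two reversals the array need not satisfy [blocks], so the present memory is
    described by an address map [f] into the memory [sh0] before both. *)
Definition reversed (H : nat -> nat) (sh0 sh : memory) (prs : 'I_p -> memory) (f : nat -> nat -> nat) :=
  [/\ blocks p P g H sh0, forall i : 'I_p, words (prs i) (bridged n p g H sh0 i)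
    & forall (i : 'I_p) x, bd (first i) <= x < bd (last (first i)) ->
        sh x = sh0 (f (first i) x)].

Definition flip1 H (sh0 : memory) s := flip (lo H sh0 s) (hi H s).
Definition flip2 H (sh0 : memory) s := flip1 H sh0 s \o flip (lo H sh0 s) (mid H sh0 s).

Lemma triple_reverse_hi :
  triple (reverse vhi)
    (fun sh prs => exists H sh0, [/\ blocks p P g H sh0, forall x, sh x = sh0 x
       & forall i : 'I_p, words (prs i) (bridged n p g H sh0 i)])
    (fun sh prs => exists H sh0, reversed H sh0 sh prs (flip1 H sh0)).
Proof.
apply: triple_fix => sh1 prs1 [H [sh0 [hb hsh hw]]].
apply: triple_weaken (fun _ _ h => h) _ (@triple_reverse R prog n p hp g g0 vhi (lo H sh0) (hi H)
  sh1 prs1 isT isT _ _ _).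
- move=> sh prs [hoff h]; exists H, sh0; split=> // i; last by move=> x hx; rewrite (h i) // hsh.
  by move: (hw i); rewrite /bridged /= !hoff.
- move=> i; have [_ [_ [e2 [e3 [_ [_ [_ [e7 [e8 [e9 _]]]]]]]]]] := hw i.
  by rewrite /= e2 e3 e7 e8 e9.
- by move=> i; have [] := shape_bounds i hb.
- by move=> i; have [] := shape_bounds i hb.
Qed.

Lemma triple_reverse_mid :
  triple (reverse vmid)
    (fun sh prs => exists H sh0, reversed H sh0 sh prs (flip1 H sh0))
    (fun sh prs => exists H sh0, reversed H sh0 sh prs (flip2 H sh0)).
Proof.
apply: triple_fix => sh1 prs1 [H [sh0 [hb hw hsh]]].
apply: triple_weaken (fun _ _ h => h) _ (@triple_reverse R prog n p hp g g0 vmid (lo H sh0) (mid H sh0)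
  sh1 prs1 isT isT _ _ _).
- move=> sh prs [hoff h]; exists H, sh0; split=> // i.
    by move: (hw i); rewrite /bridged /= !hoff.
  (* The description of the first reversal holds only inside the range of the pair, so the reflected
     address must be shown to stay there. *)
  move=> x hx; rewrite (h i) // (hsh i) // /flip; case: ifP => // hx2.
  by have [_ _ _ _ []] := shape_bounds i hb; lia.
- move=> i; have [_ [_ [e2 [e3 [_ [_ [_ [e7 [e8 [_ [e9 _]]]]]]]]]]] := hw i.
  by rewrite /= e2 e3 e7 e8 e9.
- by move=> i; have [] := shape_bounds i hb.
- by move=> i; have [] := shape_bounds i hb.
Qed.

Lemma blocks_merged H (sh0 sh : memory) :
  blocks p P g H sh0 ->
  (forall (i : 'I_p) x, bd (first i) <= x < bd (last (first i)) ->
     sh x = sh0 (flip2 H sh0 (first i) x)) ->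
  blocks p P (2 * g) (merged n p g H sh0) sh.
Proof.
move=> hb hsh s sp hd.
have es : first (Ordinal sp) = s by apply: start_eq; rewrite ?muln_gt0 //=; lia.
have {}hsh x : bd s <= x < bd (last s) -> sh x = sh0 (flip2 H sh0 s x).
  by move=> hx; have := hsh (Ordinal sp) x; rewrite es; apply.
case hsg: (s + g < p); last first.
  rewrite /merged hsg; apply: (block_eq (sh := sh0)).
    by move=> x hx; rewrite hsh // /flip2 /= /flip1 /flip /lo /hi /mid hsg.
  have hg : g %| s := dvdn_trans (dvdn_mull 2 (dvdnn g)) hd.
  by have := hb s sp hg; congr (block _ _ _ (bd _) _); lia.
have [[b1 [t1 l1 c1]] [b2 [t2 l2 c2]] lt1 /andP[lt2 le]] := two_blocks hp g0 hb hsg hd.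
rewrite /merged hsg.
apply: (block_merge _ P_sorted lt1 lt2 le l1 l2 b1 b2 c1 c2); first lia.
by move=> x hx; rewrite hsh // /flip2 /= /flip1 /lo /hi /mid /lo hsg.
Qed.

Lemma triple_double : g < p ->
  triple (Assign vg (2 * Var vg))
    (fun sh prs => exists H sh0, reversed H sh0 sh prs (flip2 H sh0))
    (fun sh prs => exists H, level P (2 * g) H sh prs).
Proof.
move=> gp; apply: triple_segment => // sh prs [H [sh0 [hb hw hsh]]].
exists (fun _ _ => True), (fun _ _ => False), (fun (i : 'I_p) (sh' pr' : memory) =>
  words pr' (base n p i (2 * g) ++ [:: (vh, merged n p g H sh0 (first i))])); split=> //; last first.
  move=> sh' prs' hq hun; exists (merged n p g H sh0).
  have esh x : sh' x = sh x by apply: hun => i [].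
  split; last by move=> i; have [view [h _]] := hq i.
  by apply: blocks_merged => // i x hx; rewrite esh; apply: hsh.
move=> i; have [e0 [e1 [e2 [e3 [e4 [e5 [e6 [e7 [_ [_ [_ [e8 _]]]]]]]]]]]] := hw i.
rewrite /= e6 /= e0 e1 e2 e3 e4 e5 e8; split; first by split=> //; lia.
by do !split.
Qed.

Lemma triple_merge_body : g < p ->
  triple merge_body (fun sh prs => exists H, level P g H sh prs)
    (fun sh prs => exists H, level P (2 * g) H sh prs).
Proof.
move=> gp; rewrite /merge_body; apply: triple_seq (triple_post hp (g := g)) _.
apply: triple_seq (triple_fetch hp g0 gp) _.
apply: triple_seq (triple_unpost hp (g := g)) _.
apply: triple_seq (triple_find_bridge hp P_sorted g0) _.
apply: triple_seq triple_reverse_hi _.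
exact: triple_seq triple_reverse_mid (triple_double gp).
Qed.

End MergeBody.

(** * The whole program *)

Section Program.
Variables (R : realType) (n p : nat) (P : 'I_n -> point R).
Hypothesis hp : 0 < p <= n.
Hypothesis P_sorted : presorted P.

Notation memory := (nat -> value R).
Notation bd := (bd n p).
Definition code := compile hull_program 0.
Definition hull_algorithm := algorithm_of code.
Notation triple := (triple code n (p := p)).

Let hM : 64 * (n * n + n + 1) <= max_word n.
Proof. by apply: max_word_ge; lia. Qed.

Lemma ltn_up_log j : j <= up_log 2 p -> (2 ^ j < p) = (j < up_log 2 p).
Proof.
move=> hj; apply/idP/idP => h.
  rewrite ltnNge; apply/negP => h2.
  by have := up_logP p (isT : 1 < 2); rewrite leqNgt (leq_ltn_trans _ h) // leq_exp2l.
by rewrite ltnNge; apply/negP => /(up_log_min (isT : 1 < 2)); rewrite leqNgt h.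
Qed.

Lemma triple_merge_loop :
  triple merge_loop (fun sh prs => exists H, level P 1 H sh prs)
    (fun sh prs => exists H, level P (2 ^ up_log 2 p) H sh prs).
Proof.
apply: (triple_while (I := fun j sh prs => exists H, level P (2 ^ j) H sh prs)) => //.
- move=> j sh prs i hj [H [_ hw]].
  have [_ [e1 [_ [_ [_ [_ [e6 _]]]]]]] := hw i.
  have h2 : 2 ^ j <= 2 * p.
    case: j hj {hw e6} => [|j] hj; first by rewrite expn0; lia.
    by rewrite expnS leq_mul2l /=; apply: ltnW; rewrite ltn_up_log //; lia.
  rewrite /= e6 e1 /= addn1; split; first by fits.
  by rewrite ltn_up_log // eqb0 -leqNgt eqn_leq hj.
- move=> j hj; rewrite expnS; apply: triple_merge_body => //; first by rewrite expn_gt0.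
  by rewrite ltn_up_log // ltnW.
Qed.

Lemma triple_program :
  triple hull_program (initial P)
    (fun sh prs => exists h, block P sh 0 n h /\ forall i, prs i 0 = Word h).
Proof.
apply: triple_seq (triple_setup hp P_sorted) _.
apply: triple_seq triple_merge_loop _.
apply: triple_segment => // sh prs [H [hb hw]].
exists (fun _ _ => True), (fun _ _ => False), (fun (i : 'I_p) (sh' pr' : memory) =>
  pr' 0 = Word (H 0)); split=> //; last first.
  move=> sh' prs' hq hun; exists (H 0); split; last by move=> i; have [view [h _]] := hq i.
  have := hb 0 ltac:(lia) (dvdn0 _).
  (* The final group size is at least [p], so the group starting at processor 0 covers the whole
     array. *)
  rewrite add0n (minn_idPr (up_logP _ _)) // (bd_p hp) /bd mul0n div0n.
  by apply: block_eq => x _; apply: hun => i [].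
move=> i; have [_ [_ [_ [_ [_ [_ [_ [e7 _]]]]]]]] := hw i.
rewrite /= e7 /=; split=> //; congr (Word (H _)).
by rewrite /start divn_small // (leq_trans (ltn_ord i) (up_logP _ _)).
Qed.

Lemma program_correct : exists c : config R p,
  halts_at hull_algorithm P (cost n p hull_program) c /\ upper_hull_output P c.
Proof.
have hat : at_line 0 (shared (init p P)) (private (init p P)) (init p P) by split.
have hc : code_at code 0 (compile hull_program 0) by [].
have [|c [sh [prs [hr [hpc hag hsh] [h [hb h0]]]]]] := triple_program hc hat.
  split=> [x xn|i]; last by [].
  by rewrite /= /nat_points insubT.
exists c; split.
  by split=> // i; rewrite /active hpc add0n -leqNgt -(size_compile _ 0).
have [hn [t [[t1 t2] t3] [c1 c2 c3]]] := hb.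
have tlt (i : 'I_n) : t i < n by have := t1 i; rewrite ltn_ord => /(_ isT) /andP[].
have tinj : injective (fun i : 'I_n => Ordinal (tlt i)).
  by move=> i j [] /t2 e; apply: val_inj; apply: e; rewrite ltn_ord.
exists (perm tinj), h.
have sE (i : 'I_n) : nat_points P (t i) = P (perm tinj i).
  by rewrite permE -nat_pointsE.
split=> [|i|i|i j ij jh|i _].
- by rewrite subn0 in hn.
- by rewrite hsh t3 ?ltn_ord // sE.
- rewrite upper_hull_pointP //; rewrite permE /=; split=> [hi|/c3 [u uh e]].
    exact: (c1 i hi).
  have -> // : nat_of_ord i = u.
  by apply: t2; rewrite ?ltn_ord //; have := ltn_ord i; lia.
- rewrite -!sE; apply: nat_points_xlt => //; exact: (c2 i j).
- by rewrite hag // h0.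
Qed.

End Program.

(** * Running time *)

Lemma cost_bound : exists C, forall n p, 0 < p <= n ->
  cost n p hull_program * p <= C * n * bits n ^ 3.
Proof.
(* The instruction counts sum to at most [1000 * b * s ^ 3] with [b = n %/ p + 1] and [s = bits n];
   the cube comes from the merge rounds, the left search and the slope search inside it. The factor
   2 comes from [b * p <= 2 * n]. *)
exists 2000 => n p hp.
have hL : up_log 2 p <= bits n.
  apply: up_log_min => //; case/andP: hp => _ /leq_trans; apply.
  by apply: ltnW; apply: trunc_log_ltn.
have hdiv : (n %/ p + 1) * p <= 2 * n by have := leq_divM n p; lia.
rewrite /hull_program /setup /merge_loop /merge_body /graham_loop.
cbv [cost graham_test graham_pop graham_push width_loop post_count fetch_counts
  unpost_count find_bridge slope_search left_probe left_update left_search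
  right_search reverse reverse_loop esize compile_expr size cat].
have s0 : 0 < bits n by [].
have b0 : 0 < n %/ p + 1 by rewrite addn1.
move: (n %/ p + 1) (bits n) (up_log 2 p) b0 s0 hL hdiv => b s L b0 s0 hL hdiv.
apply: (@leq_trans (1000 * (b * s ^ 3) * p)); last first.
  apply: (@leq_trans (1000 * s ^ 3 * (b * p))); first by apply: eq_leq; lia.
  by apply: (@leq_trans (1000 * s ^ 3 * (2 * n))); [rewrite leq_mul2l hdiv orbT | lia].
rewrite leq_mul2r; apply/orP; right.
have -> : s ^ 3 = s * s * s by rewrite !expnS expn0 muln1 mulnA.
have k1 : s <= s * s by rewrite leq_pmulr.
have k2 : s * s <= s * s * s by rewrite leq_pmulr.
have k3 : L * s <= s * s by rewrite leq_mul2r hL orbT.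
have k4 : L * s * s <= s * s * s by rewrite leq_mul2r k3 orbT.
have k5 : s * s * s <= b * (s * s * s) by rewrite leq_pmull.
have k6 : b <= b * (s * s * s) by rewrite leq_pmulr // !muln_gt0 s0.
have k7 : L * b <= b * (s * s * s) by rewrite mulnC leq_mul2l; apply/orP; right; lia.
lia.
Qed.

Theorem corollary22 (R : realType) :
  exists A : algorithm,
    sync_strict_PIP A (@presorted_points R) /\
    constructs_convex_hull A (@presorted_points R).
Proof.
exists hull_algorithm; split; last first.
  move=> n p P hp hP; have [c hc] := program_correct hp hP.
  by exists (cost n p hull_program), c.
have [C hC] := cost_bound.
split.
- by [].
- by exists ncells.
- exists C, 3 => n p P hp hP; have [c [hc _]] := program_correct hp hP.
  exists (cost n p hull_program), c; split=> //.
  apply: leq_trans (hC n p hp); rewrite leq_mul2r; apply/orP; right.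
  apply/bigmax_leqP => i _; rewrite /operations.
  (* A processor performs at most one operation per synchronous step. *)
  apply: (@leq_trans (\sum_(0 <= s < cost n p hull_program) 1)).
    by apply: leq_sum => s _; case: (run _ _ _ _) => // c'; case: (active _ _ _).
  by rewrite sum_nat_const_nat subn0 muln1.
- by exists ncells.
Qed.
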